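(* Let $\Lambda$ be a topological $k$-graph and for $n\in\mathbb N^k$ let $X_n$ be the right-Hilbert $C_0(\Lambda^0)$--$C_0(\Lambda^0)$ bimodule of the topological graph $(\Lambda^0,\Lambda^n,s|_{\Lambda^n},r|_{\Lambda^n})$, regarded as a subspace of $C_0(\Lambda^n)$. For $f\in X_m$ and $g\in X_n$, define $fg : \Lambda^{m+n}\to\mathbb C$ by $(fg)(\lambda):=f(\lambda(0,m))\,g(\lambda(m,m+n))$. Under this multiplication the family $X:=\bigsqcup_{n\in\mathbb N^k}X_n$ of right-Hilbert $C_0(\Lambda^0)$--$C_0(\Lambda^0)$ bimodules is a product system over $\mathbb N^k$.
   Context: Topological $k$-graphs. A topological $k$-graph is a pair $(\Lambda,d)$: $\Lambda$ is a small category with a second countable locally compact Hausdorff topology such that composition is continuous and open, the range map $r$ is continuous and the source map $s$ is a local homeomorphism, and $d:\Lambda\to\mathbb N^k$ is a continuous functor such that if $d(\lambda)=m+n$ there are unique $\mu,\nu$ with $d(\mu)=m$, $d(\nu)=n$, $\lambda=\mu\nu$. $\Lambda^m=d^{-1}(m)$. For $0\le m\le n\le d(\lambda)$, $\lambda(m,n)$ is the unique path of degree $n-m$ with $\lambda=\mu\lambda(m,n)\nu$, $d(\mu)=m$, $d(\nu)=d(\lambda)-n$. The bimodules. With $A=C_0(\Lambda^0)$, $X_n$ is the completion of $C_c(\Lambda^n)$ in the norm $\|f\|_A=\|\langle f,f\rangle_A^n\|^{1/2}$ for the operations $\langle f,g\rangle_A^n(v)=\sum_{\eta\in\Lambda^n,\,s(\eta)=v}\overline{f(\eta)}g(\eta)$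 and $(a\cdot f\cdot b)(\lambda)=a(r(\lambda))f(\lambda)b(s(\lambda))$; Katsura shows that $X_n$ is a subspace of $C_0(\Lambda^n)$ (namely the $f\in C_0(\Lambda^n)$ with $\langle f,f\rangle_A^n\in C_0(\Lambda^0)$, with the same formulas). Product systems. A right-Hilbert $A$--$A$ bimodule is a right Hilbert $A$-module with a left action of $A$ by adjointable operators. A product system over a unital discrete semigroup $P$ is a semigroup $X$ with a semigroup homomorphism $d:X\to P$ such that each $X_p=d^{-1}(p)$ is a right-Hilbert $A$--$A$ bimodule, $X_e={}_AA_A$ (the algebra $A$ with inner product $a^*b$ and multiplication actions), the multiplication on $X$ implements isomorphisms $X_p\otimes_AX_q\cong X_{pq}$ for $p,q\in P\setminus\{e\}$, and implements the right and left actions of $X_e=A$ on each $X_p$. The inner product on the balanced tensor product is $\langle x_1\otimes_Ay_1,x_2\otimes_Ay_2\rangle_A=\langle y_1,\langle x_1,x_2\rangle_A\cdot y_2\rangle_A$. *)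

(* Defs.v *)
From mathcomp Require Import all_boot all_order all_algebra.
From mathcomp Require Import all_classical all_reals all_analysis.
From mathcomp Require Import complex.
From mathcomp.analysis.showcase Require Import summability.

Set Implicit Arguments.
Unset Strict Implicit.
Unset Printing Implicit Defensive.

Import Order.TTheory GRing.Theory Num.Theory.
Import numFieldNormedType.Exports.
Local Open Scope classical_set_scope.
Local Open Scope ring_scope.

Notation normc := ComplexField.Normc.normc.

(* An element of P, and d when P is empty. *)
Definition pick_in (T : Type) (d : T) (P : set T) : T :=
  if pselect (P !=set0) is left ex then projT1 (cid ex) else d.

(* Spaces are subsets [vcar] of an ambient type on which the operations are  *)
(* total: as for X_n inside the functions on Lambda^n, the operations are    *)
(* given by formulas and it is part of each axiom system that they restrict  *)
(* to the carrier. Everything is meaningful on the carrier only.             *)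

Record lspace (R : realType) := LSpace {
  vsort :> Type;
  vcar : set vsort;
  vzero : vsort;
  vadd : vsort -> vsort -> vsort;
  vscale : R[i] -> vsort -> vsort }.
Arguments vcar {R} l.
Arguments vzero {R l}.
Arguments vadd {R l}.
Arguments vscale {R l}.

Record is_lspace (R : realType) (V : lspace R) : Prop := IsLSpace {
  vzero_in : vcar V vzero;
  vadd_in : forall x y, vcar V x -> vcar V y -> vcar V (vadd x y);
  vscale_in : forall c x, vcar V x -> vcar V (vscale c x);
  vaddA : forall x y z, vcar V x -> vcar V y -> vcar V z ->
    vadd x (vadd y z) = vadd (vadd x y) z;
  vaddC : forall x y, vcar V x -> vcar V y -> vadd x y = vadd y x;
  vadd0 : forall x, vcar V x -> vadd vzero x = x;
  vaddN : forall x, vcar V x -> vadd x (vscale (-1) x) = vzero;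
  vscaleA : forall c d x, vcar V x -> vscale c (vscale d x) = vscale (c * d) x;
  vscale1 : forall x, vcar V x -> vscale 1 x = x;
  vscaleDl : forall c d x, vcar V x ->
    vscale (c + d) x = vadd (vscale c x) (vscale d x);
  vscaleDr : forall c x y, vcar V x -> vcar V y ->
    vscale c (vadd x y) = vadd (vscale c x) (vscale c y) }.

Definition vsub (R : realType) (V : lspace R) (x y : V) : V :=
  vadd x (vscale (-1) y).

Definition norm_complete (R : realType) (V : lspace R) (nrm : V -> R) : Prop :=
  forall u : nat -> V, (forall n, vcar V (u n)) ->
  (forall e : R, 0 < e -> exists N : nat, forall m n : nat,
     (N <= m)%N -> (N <= n)%N -> nrm (vsub (u m) (u n)) < e) ->
  exists2 l, vcar V l & (fun n => nrm (vsub (u n) l)) @ \oo --> (0 : R).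

Record star_algebra (R : realType) := StarAlgebra {
  aspace :> lspace R;
  amul : aspace -> aspace -> aspace;
  astar : aspace -> aspace;
  anorm : aspace -> R }.
Arguments amul {R s}.
Arguments astar {R s}.
Arguments anorm {R s}.

Record is_cstar_algebra (R : realType) (A : star_algebra R) : Prop := IsCstar {
  cs_lspace : is_lspace A;
  cs_mul_in : forall a b, vcar A a -> vcar A b -> vcar A (amul a b);
  cs_star_in : forall a, vcar A a -> vcar A (astar a);
  cs_mulA : forall a b c, vcar A a -> vcar A b -> vcar A c ->
    amul a (amul b c) = amul (amul a b) c;
  cs_mulDl : forall a b c, vcar A a -> vcar A b -> vcar A c ->
    amul (vadd a b) c = vadd (amul a c) (amul b c);
  cs_mulDr : forall a b c, vcar A a -> vcar A b -> vcar A c ->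
    amul a (vadd b c) = vadd (amul a b) (amul a c);
  cs_mulZl : forall t a b, vcar A a -> vcar A b ->
    amul (vscale t a) b = vscale t (amul a b);
  cs_mulZr : forall t a b, vcar A a -> vcar A b ->
    amul a (vscale t b) = vscale t (amul a b);
  cs_starK : forall a, vcar A a -> astar (astar a) = a;
  cs_starD : forall a b, vcar A a -> vcar A b ->
    astar (vadd a b) = vadd (astar a) (astar b);
  cs_starZ : forall t a, vcar A a -> astar (vscale t a) = vscale (conjc t) (astar a);
  cs_starM : forall a b, vcar A a -> vcar A b ->
    astar (amul a b) = amul (astar b) (astar a);
  cs_norm_ge0 : forall a, vcar A a -> 0 <= anorm a;
  cs_norm_eq0 : forall a, vcar A a -> anorm a = 0 -> a = vzero;
  cs_normD : forall a b, vcar A a -> vcar A b ->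
    anorm (vadd a b) <= anorm a + anorm b;
  cs_normZ : forall t a, vcar A a -> anorm (vscale t a) = normc t * anorm a;
  cs_normM : forall a b, vcar A a -> vcar A b -> anorm (amul a b) <= anorm a * anorm b;
  cs_norm_star : forall a, vcar A a -> anorm (amul (astar a) a) = anorm a ^+ 2;
  cs_complete : norm_complete (@anorm R A) }.

Record bimodule (R : realType) (A : star_algebra R) := Bimodule {
  mspace :> lspace R;
  lact : A -> mspace -> mspace;
  ract : mspace -> A -> mspace;
  ip : mspace -> mspace -> A }.
Arguments lact {R A b}.
Arguments ract {R A b}.
Arguments ip {R A b}.

Definition mnorm (R : realType) (A : star_algebra R) (X : bimodule A) (x : X) : R :=
  Num.sqrt (anorm (ip x x)).

(* The left action is a *-homomorphism into the adjointable operators:       *)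
(* [hb_lactP] says that a acts by an operator with adjoint a^*.              *)
Record is_right_hilbert_bimodule (R : realType) (A : star_algebra R)
    (X : bimodule A) : Prop := IsHilbertBimodule {
  hb_lspace : is_lspace X;
  hb_ract_in : forall x a, vcar X x -> vcar A a -> vcar X (ract x a);
  hb_ractDl : forall x y a, vcar X x -> vcar X y -> vcar A a ->
    ract (vadd x y) a = vadd (ract x a) (ract y a);
  hb_ractDr : forall x a b, vcar X x -> vcar A a -> vcar A b ->
    ract x (vadd a b) = vadd (ract x a) (ract x b);
  hb_ractZl : forall t x a, vcar X x -> vcar A a ->
    ract (vscale t x) a = vscale t (ract x a);
  hb_ractZr : forall t x a, vcar X x -> vcar A a ->
    ract x (vscale t a) = vscale t (ract x a);
  hb_ractA : forall x a b, vcar X x -> vcar A a -> vcar A b ->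
    ract (ract x a) b = ract x (amul a b);
  hb_ip_in : forall x y, vcar X x -> vcar X y -> vcar A (ip x y);
  hb_ipD : forall x y z, vcar X x -> vcar X y -> vcar X z ->
    ip x (vadd y z) = vadd (ip x y) (ip x z);
  hb_ipZ : forall t x y, vcar X x -> vcar X y ->
    ip x (vscale t y) = vscale t (ip x y);
  hb_ip_ract : forall x y a, vcar X x -> vcar X y -> vcar A a ->
    ip x (ract y a) = amul (ip x y) a;
  hb_ip_star : forall x y, vcar X x -> vcar X y -> astar (ip x y) = ip y x;
  hb_ip_pos : forall x, vcar X x ->
    exists2 b, vcar A b & ip x x = amul (astar b) b;
  hb_ip_def : forall x, vcar X x -> ip x x = vzero -> x = vzero;
  hb_complete : norm_complete (@mnorm R A X);
  hb_lact_in : forall a x, vcar A a -> vcar X x -> vcar X (lact a x);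
  hb_lactD : forall a b x, vcar A a -> vcar A b -> vcar X x ->
    lact (vadd a b) x = vadd (lact a x) (lact b x);
  hb_lactZ : forall t a x, vcar A a -> vcar X x ->
    lact (vscale t a) x = vscale t (lact a x);
  hb_lactM : forall a b x, vcar A a -> vcar A b -> vcar X x ->
    lact (amul a b) x = lact a (lact b x);
  hb_lactP : forall a x y, vcar A a -> vcar X x -> vcar X y ->
    ip (lact a x) y = ip x (lact (astar a) y) }.

Record is_bimodule_iso (R : realType) (A : star_algebra R) (X Y : bimodule A)
    (U : X -> Y) : Prop := IsBimoduleIso {
  iso_bij : set_bij (vcar X) (vcar Y) U;
  iso_add : forall x y, vcar X x -> vcar X y -> U (vadd x y) = vadd (U x) (U y);
  iso_scale : forall t x, vcar X x -> U (vscale t x) = vscale t (U x);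
  iso_lact : forall a x, vcar A a -> vcar X x -> U (lact a x) = lact a (U x);
  iso_ract : forall x a, vcar X x -> vcar A a -> U (ract x a) = ract (U x) a;
  iso_ip : forall x y, vcar X x -> vcar X y -> ip (U x) (U y) = ip x y }.

Definition standard_bimodule (R : realType) (A : star_algebra R) : bimodule A :=
  @Bimodule R A A amul amul (fun a b => amul (astar a) b).

(* The balanced tensor product X (x)_A Y.                                    *)
(*                                                                          *)
(* A finite sum of elementary tensors is a sequence of pairs, and [tpair] is *)
(* the semi-inner product determined by                                      *)
(*   <x1 (x) y1, x2 (x) y2> = <y1, <x1, x2> . y2>.                           *)
(* X (x)_A Y is its separated completion: classes of Cauchy sequences modulo *)
(* sequences of vanishing seminorm. Differences such as                      *)
(* xa (x) y - x (x) ay have seminorm 0, so this is balanced over A.          *)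

Section tensor_product.
Variables (R : realType) (A : star_algebra R) (X Y : bimodule A).

Definition tsum := seq (X * Y).

Definition tsum_in (s : tsum) : Prop :=
  all (fun p => (p.1 \in vcar X) && (p.2 \in vcar Y)) s.

Definition tscale (t : R[i]) (s : tsum) : tsum :=
  [seq (vscale t p.1, p.2) | p <- s].

Definition tpair (s s' : tsum) : A :=
  \big[vadd/vzero]_(p <- s) \big[vadd/vzero]_(q <- s')
    ip p.2 (lact (ip p.1 q.1) q.2).

Definition tdist (s s' : tsum) : R :=
  let d := s ++ tscale (-1) s' in Num.sqrt (anorm (tpair d d)).

Definition tcauchy (w : nat -> tsum) : Prop :=
  (forall n, tsum_in (w n)) /\
  (forall e : R, 0 < e -> exists N : nat, forall m n : nat,
     (N <= m)%N -> (N <= n)%N -> tdist (w m) (w n) < e).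

Definition tclass (w : nat -> tsum) : set (nat -> tsum) :=
  [set w' | tcauchy w' /\ (fun n => tdist (w n) (w' n)) @ \oo --> (0 : R)].

Definition trep (c : set (nat -> tsum)) : nat -> tsum := pick_in (fun=> [::]) c.

Definition alim (a : nat -> A) : A :=
  pick_in vzero
    [set l | vcar A l /\ (fun n => anorm (vsub (a n) l)) @ \oo --> (0 : R)].

Definition tensor_space : lspace R := @LSpace R (set (nat -> tsum))
  [set c | exists2 w, tcauchy w & c = tclass w]
  (tclass (fun=> [::]))
  (fun c c' => tclass (fun n => trep c n ++ trep c' n))
  (fun t c => tclass (fun n => tscale t (trep c n))).

Definition tensor : bimodule A := @Bimodule R A tensor_space
  (fun a c => tclass (fun n => [seq (lact a p.1, p.2) | p <- trep c n]))
  (fun c a => tclass (fun n => [seq (p.1, ract p.2 a) | p <- trep c n]))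
  (fun c c' => alim (fun n => tpair (trep c n) (trep c' n))).

Definition elementary_tensor (x : X) (y : Y) : tensor := tclass (fun=> [:: (x, y)]).

End tensor_product.

(* P is the unital semigroup (P, op, e), and X = { p : P & X p } is the      *)
(* disjoint union with its degree map [projT1]; [mul] makes [projT1]         *)
(* multiplicative. [iota] is the identification of A with X_e.               *)

Record is_product_system (R : realType) (A : star_algebra R)
    (P : Type) (e : P) (op : Monoid.law e) (X : P -> bimodule A)
    (mul : forall p q, X p -> X q -> X (op p q)) (iota : A -> X e) : Prop :=
  IsProductSystem {
  ps_algebra : is_cstar_algebra A;
  ps_fibre : forall p, is_right_hilbert_bimodule (X p);
  ps_mul_in : forall p q (x : X p) (y : X q),
    vcar (X p) x -> vcar (X q) y -> vcar (X (op p q)) (mul p q x y);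
  ps_mulA : forall p q r (x : X p) (y : X q) (z : X r),
    vcar (X p) x -> vcar (X q) y -> vcar (X r) z ->
    existT (fun p => vsort (X p)) _ (mul _ _ (mul _ _ x y) z) =
    existT (fun p => vsort (X p)) _ (mul _ _ x (mul _ _ y z));
  ps_unit : is_bimodule_iso (X := standard_bimodule A) (Y := X e) iota;
  ps_tensor : forall p q, p <> e -> q <> e ->
    exists U : tensor (X p) (X q) -> X (op p q),
      is_bimodule_iso U /\
      (forall x y, vcar (X p) x -> vcar (X q) y ->
         U (elementary_tensor x y) = mul p q x y);
  ps_lact : forall p a (x : X p), vcar A a -> vcar (X p) x ->
    existT (fun p => vsort (X p)) _ (mul _ _ (iota a) x) =
    existT (fun p => vsort (X p)) _ (lact a x);
  ps_ract : forall p (x : X p) a, vcar (X p) x -> vcar A a ->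
    existT (fun p => vsort (X p)) _ (mul _ _ x (iota a)) =
    existT (fun p => vsort (X p)) _ (ract x a) }.

(* R[i]^o is R[i] with the topology of its norm; R[i] itself has none. *)
Definition C0 (R : realType) (E : topologicalType) : set (E -> R[i]) :=
  [set f | continuous (f : E -> R[i]^o) /\
           forall e : R, 0 < e ->
             exists2 K, compact K & forall x, ~ K x -> normc (f x) < e].
Arguments C0 : clear implicits.

Definition fun_space (R : realType) (E : Type) (D : set (E -> R[i])) : lspace R :=
  @LSpace R (E -> R[i]) D (fun=> 0) (fun f g x => f x + g x) (fun t f x => t * f x).

Definition C0_algebra (R : realType) (E : topologicalType) : star_algebra R :=
  @StarAlgebra R (fun_space (C0 R E))
    (fun f g x => f x * g x) (fun f x => conjc (f x))
    (fun f => sup (range (fun x => normc (f x)))).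

Section graph_bimodule.
Variables (R : realType) (E0 E1 : topologicalType) (s r : E1 -> E0).

Definition fibre_term (f g : E1 -> R[i]) (v : E0) (x : [set x | s x = v]) : R[i]^o :=
  conjc (f (val x)) * g (val x).

(* Unordered sum over the possibly infinite set s^-1(v). *)
Definition graph_ip (f g : E1 -> R[i]) (v : E0) : R[i] := sum (@fibre_term f g v).

(* [sum] is junk where the series diverges, so that <f, f> in C_0(E0)        *)
(* includes convergence at every vertex.                                     *)
Definition graph_module : set (E1 -> R[i]) :=
  [set f | [/\ C0 R E1 f,
               forall v, cvg (partial_sum (@fibre_term f f v) @ totally) &
               C0 R E0 (graph_ip f f)]].

Definition graph_bimodule : bimodule (C0_algebra R E0) :=
  @Bimodule R (C0_algebra R E0) (fun_space graph_module)
    (fun (a : E0 -> R[i]) (f : E1 -> R[i]) x => a (r x) * f x)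
    (fun (f : E1 -> R[i]) (a : E0 -> R[i]) x => f x * a (s x))
    graph_ip.

End graph_bimodule.

(* A small category, presented by its arrows, with a functor to N^k. Objects *)
(* are identified with their identity arrows: [rng x] and [src x] are the    *)
(* identities at the range and the source of x. [comp x y] is xy, which is   *)
(* meaningful when src x = rng y.                                            *)
Record graded_category (k : nat) := GradedCategory {
  arrow :> topologicalType;
  rng : arrow -> arrow;
  src : arrow -> arrow;
  comp : arrow -> arrow -> arrow;
  deg : arrow -> {ffun 'I_k -> nat};
  rng_rng : forall x, rng (rng x) = rng x;
  src_rng : forall x, src (rng x) = rng x;
  rng_src : forall x, rng (src x) = src x;
  src_src : forall x, src (src x) = src x;
  rng_comp : forall x y, src x = rng y -> rng (comp x y) = rng x;
  src_comp : forall x y, src x = rng y -> src (comp x y) = src y;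
  comp_rng : forall x, comp (rng x) x = x;
  comp_src : forall x, comp x (src x) = x;
  compA : forall x y z, src x = rng y -> src y = rng z ->
    comp x (comp y z) = comp (comp x y) z;
  deg_rng : forall x, deg (rng x) = 0;
  deg_src : forall x, deg (src x) = 0;
  deg_comp : forall x y, src x = rng y -> deg (comp x y) = deg x + deg y }.
Arguments rng {k g}.
Arguments src {k g}.
Arguments comp {k g}.
Arguments deg {k g}.

Section paths.
Variables (k : nat) (L : graded_category k).

(* Lambda^n; as a type it carries the subspace topology. *)
Definition level (n : {ffun 'I_k -> nat}) : set L := [set x | deg x = n].

Definition composable : set (L * L)%type := [set p | src p.1 = rng p.2].

Definition compose (p : composable) : L := comp (val p).1 (val p).2.

Definition src0 (x : L) : level 0 := SigSub (mem_set (deg_src x : level 0 (src x))).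
Definition rng0 (x : L) : level 0 := SigSub (mem_set (deg_rng x : level 0 (rng x))).

(* y = x(m,n), for m <= n <= deg x: the inequalities and the differences     *)
(* n - m, deg x - n are expressed by the sums.                               *)
Definition is_segment (x : L) (m n : {ffun 'I_k -> nat}) (y : L) : Prop :=
  exists u w : L, [/\ deg u = m, m + deg y = n, n + deg w = deg x,
    src u = rng y /\ src y = rng w & x = comp u (comp y w)].

Definition segment (x : L) (m n : {ffun 'I_k -> nat}) : L :=
  pick_in x [set y | is_segment x m n y].

End paths.
Arguments level {k} L n.
Arguments composable {k} L.
Arguments compose {k} L.
Arguments src0 {k L}.
Arguments rng0 {k L}.

Definition open_map (S T : topologicalType) (f : S -> T) : Prop :=
  forall U : set S, open U -> open (f @` U).

Definition local_homeomorphism (S T : topologicalType) (f : S -> T) : Prop :=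
  forall x, exists U : set S,
    [/\ open U, U x, open (f @` U), {within U, continuous f} &
        exists g : T -> S, {within f @` U, continuous g} /\
                           (forall y, U y -> g (f y) = y)].

Record is_topological_kgraph (k : nat) (L : graded_category k) : Prop :=
  IsTopologicalKgraph {
  kg_second_countable : @second_countable L;
  kg_locally_compact : locally_compact [set: L];
  kg_hausdorff : hausdorff_space L;
  kg_comp_continuous : continuous (compose L);
  kg_comp_open : open_map (compose L);
  kg_rng_continuous : continuous (@rng0 k L);
  kg_src_local_homeo : local_homeomorphism (@src0 k L);
  kg_deg_continuous :
    continuous (deg : L -> discrete_topology {ffun 'I_k -> nat});
  kg_factorization : forall (x : L) (m n : {ffun 'I_k -> nat}), deg x = m + n ->
    exists! p : (L * L)%type,
      [/\ deg p.1 = m, deg p.2 = n, src p.1 = rng p.2 & x = comp p.1 p.2] }.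

Record topological_kgraph (k : nat) := TopologicalKgraph {
  kg_category :> graded_category k;
  kg_axioms : is_topological_kgraph kg_category }.

Section kgraph_product_system.
Variables (R : realType) (k : nat) (L : topological_kgraph k).
Implicit Types m n l : {ffun 'I_k -> nat}.

Lemma segment_exists (x : L) m n l :
  deg x = m + n + l -> exists y, is_segment x m (m + n) y.
Proof.
move=> dx.
have [[u v] [[/= du dv suv xuv] _]] :=
  kg_factorization (kg_axioms L) (etrans dx (esym (addrA m n l))).
have [[y w] [[/= dy dw syw vyw] _]] := kg_factorization (kg_axioms L) dv.
exists y, u, w; split => //; [by rewrite dy | by rewrite dw dx | | by rewrite -vyw].
by split => //; rewrite suv vyw rng_comp.
Qed.

Lemma deg_segment (x : L) m n l :
  deg x = m + n + l -> deg (segment x m (m + n)) = n.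
Proof.
move=> /segment_exists ex; rewrite /segment /pick_in.
case: pselect => [ex'|/(_ ex)//].
case: (cid ex') => y /= [u [w [_ /ffunP dy _ _ _]]].
by apply/ffunP => i; have := dy i; rewrite !ffunE => /addnI.
Qed.

Lemma head_subproof m n (x : level L (m + n)) :
  level L m (segment (val x) 0 m).
Proof.
have /deg_segment : deg (val x) = 0 + m + n by rewrite add0r; exact: set_mem (valP x).
by rewrite add0r.
Qed.

Lemma tail_subproof m n (x : level L (m + n)) :
  level L n (segment (val x) m (m + n)).
Proof.
apply: (@deg_segment _ _ _ 0).
by rewrite addr0; exact: set_mem (valP x).
Qed.

(* x(0,m) and x(m,m+n) for x in Lambda^(m+n) *)
Definition path_head m n (x : level L (m + n)) : level L m :=
  SigSub (mem_set (head_subproof x)).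
Definition path_tail m n (x : level L (m + n)) : level L n :=
  SigSub (mem_set (tail_subproof x)).

Definition kgraph_bimodule n : bimodule (C0_algebra R (level L 0)) :=
  @graph_bimodule R (level L 0) (level L n)
    (fun x => src0 (val x)) (fun x => rng0 (val x)).

Definition kgraph_mul m n (f : kgraph_bimodule m) (g : kgraph_bimodule n) :
    kgraph_bimodule (m + n) :=
  fun x : level L (m + n) => f (path_head x) * g (path_tail x).

End kgraph_product_system.

(* Main.v *)
Require Import Defs.
From mathcomp Require Import all_boot all_order all_algebra finmap complex.
From mathcomp Require Import all_classical all_reals all_analysis.
From mathcomp Require Import ring lra.
From mathcomp.analysis.showcase Require Import summability.
Set Implicit Arguments.
Unset Strict Implicit.
Unset Printing Implicit Defensive.
Import Order.TTheory GRing.Theory Num.Theory.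
Import numFieldNormedType.Exports.
Import ComplexField.Normc.
Local Open Scope classical_set_scope.
Local Open Scope ring_scope.

(** Why the bimodules X_n form a product system.

    The analytic core is one fact about a local homeomorphism s on a Hausdorff
    space ([fibre_sum_continuous]): if a continuous function is dominated by another one whose sums over the fibres of s depend
    continuously on the base point, then its own sums over the fibres are
    continuous. Together with the corresponding estimates at infinity this
    shows that the module X_n is closed under sums, bounded continuous
    multipliers and the two actions, and that all inner products lie in
    C_0(Lambda^0). Completeness follows from the completeness of the uniform
    norm and from the triangle inequality in the l^2 space of each fibre; so
    X_n is a right-Hilbert bimodule ([graph_bimodule_hilbert]).

    A path of degree m + n is a pair of a head and a tail, by unique
    factorization. Since composition is continuous and open, head and tail
    depend continuously on the path, which gives that fg vanishes at infinity.
    Summing over the heads before summing over the tails turns the inner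
    product of fg and f'g' into <g, <f, f'> g'>, the inner product of the
    balanced tensor product ([path_mul_ip]).

    Whenever a pairing X x Y -> Z of Hilbert bimodules has this inner product
    formula and the sums of its values are dense, it induces an isomorphism
    from the balanced tensor product of X and Y to Z ([tensor_map_iso]): it is
    isometric on finite sums of elementary tensors, extends to the completion,
    and is onto by density.

    It remains to see that the products fg span a dense subspace of X_(m+n)
    ([kgraph_mul_dense]). Around each path there is a bump w such that w b is
    a single product fg for every bounded continuous b ([splitting_bump]): the
    source maps are injective near the head and the tail of the path, so that,
    near it, a path is determined by its tail. For bumps w_1, ..., w_N the
    function (1 - (1 - w_1) ... (1 - w_N)) h is therefore a sum of N products.
    Given h in X_(m+n), finitely many bumps centred at well-chosen paths make
    the norm of (1 - w_1) ... (1 - w_N) h small. Over a single vertex it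
    suffices to remove a finite set of paths that carries most of the sum of
    |h|^2; the continuity of fibre sums extends the estimate to a neighbourhood
    of the vertex, and compactness to all vertices.

    Associativity and the identification of X_0 with C_0(Lambda^0) are
    consequences of unique factorization. *)

Local Notation re := complex.Re.
Local Notation im := complex.Im.

(** * Complex numbers and continuity *)

Section complex_norm.
Variable R : realType.
Implicit Types z w : R[i].
Local Open Scope complex_scope.

Lemma normc_ge0 z : 0 <= normc z.
Proof. by case: z => a b; exact: sqrtr_ge0. Qed.

Lemma ler_normcD z w : normc (z + w) <= normc z + normc w.
Proof. exact: le_normcD. Qed.

Lemma normcNN z : normc (- z) = normc z.
Proof. exact: normcN. Qed.

Lemma normc_distC z w : normc (z - w) = normc (w - z).
Proof. by rewrite -normcNN opprB. Qed.

Lemma ler_dist_normc z w : normc z - normc w <= normc (z - w).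
Proof. by rewrite lerBlDr -[in leLHS](subrK w z) ler_normcD. Qed.

Lemma dist_normc_le z w : `|normc z - normc w| <= normc (z - w).
Proof. by rewrite ler_norml lerNl opprB ler_dist_normc normc_distC ler_dist_normc. Qed.

Lemma ler_normc_dist z w u : normc (z - w) <= normc (z - u) + normc (u - w).
Proof. by rewrite -[z - w](subrKA u) ler_normcD. Qed.

Lemma normc_real (x : R) : normc x%:C = `|x|.
Proof. by rewrite /= expr0n addr0 sqrtr_sqr. Qed.

Lemma normc_conj z : normc z^* = normc z.
Proof. by case: z => a b /=; rewrite sqrrN. Qed.

Lemma mul_conjc z : z^* * z = (normc z ^+ 2)%:C.
Proof. by rewrite mulrC -sqr_normc rmorphXn. Qed.

Lemma normc_sum (I : Type) (s : seq I) (F : I -> R[i]) :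
  normc (\sum_(i <- s) F i) <= \sum_(i <- s) normc (F i).
Proof.
elim/big_ind2 : _ => [|x1 x2 y1 y2 h1 h2|//]; first by rewrite normc0.
by rewrite (le_trans (ler_normcD _ _)) ?lerD.
Qed.

Lemma normc_le_ReIm z : normc z <= `|re z| + `|im z|.
Proof.
have -> : z = (re z)%:C + 'i * (im z)%:C by case: z => a b; simpc.
rewrite (le_trans (ler_normcD _ _)) ?normcM ?normc_real //=.
rewrite !(mul0r,mul1r,oppr0,addr0,add0r,mulr0,subr0).
by rewrite expr0n expr1n add0r sqrtr1 mul1r.
Qed.

Lemma Re_le_normc z : `|re z| <= normc z.
Proof. by case: z => a b /=; rewrite -sqrtr_sqr ler_wsqrtr // lerDl sqr_ge0. Qed.

Lemma Im_le_normc z : `|im z| <= normc z.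
Proof. by case: z => a b /=; rewrite -sqrtr_sqr ler_wsqrtr // lerDr sqr_ge0. Qed.

(** The norm of R[i] takes values in R[i]; its balls are cut out by the real
    number normc, on which the order is total. *)
Lemma cvg_complexP (T : Type) (F : set_system T) (FF : Filter F) (f : T -> R[i]^o)
    (l : R[i]^o) :
  f @ F --> l <-> (forall e : R, 0 < e -> \forall x \near F, normc (f x - l) < e).
Proof.
split=> [/cvgr_distC_lt fl e e0|fl].
  have e0' : 0 < e%:C :> R[i] by rewrite ltcR.
  by apply: filterS (fl _ e0') => x; rewrite ltcR.
apply/cvgrPdistC_lt => -[e e']; rewrite ltcE /= => /andP[/eqP -> e0].
by apply: filterS (fl _ e0) => x; rewrite -ltcR.
Qed.

Lemma continuous_complexP (T : topologicalType) (f : T -> R[i]^o) (x : T) :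
  {for x, continuous f} <->
  (forall e : R, 0 < e -> \forall y \near x, normc (f y - f x) < e).
Proof. exact: cvg_complexP. Qed.

Lemma continuous_normc (T : topologicalType) (f : T -> R[i]^o) (x : T) :
  {for x, continuous f} -> {for x, continuous (fun y => normc (f y))}.
Proof.
move=> /continuous_complexP fx; apply/cvgrPdistC_lt => e /fx.
apply: filterS => y; apply: le_lt_trans.
exact: dist_normc_le.
Qed.

Lemma continuous_RtoC (T : topologicalType) (f : T -> R) (x : T) :
  {for x, continuous f} -> {for x, continuous (fun y => (f y)%:C : R[i]^o)}.
Proof.
move=> /cvgr_distC_lt fx; apply/continuous_complexP => e /fx.
by apply: filterS => y; rewrite -rmorphB normc_real.
Qed.

Lemma continuous_conjc (T : topologicalType) (f : T -> R[i]^o) (x : T) :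
  {for x, continuous f} -> {for x, continuous (fun y => (f y)^* : R[i]^o)}.
Proof.
move=> /continuous_complexP fx; apply/continuous_complexP => e /fx.
by apply: filterS => y; rewrite -rmorphB normc_conj.
Qed.

End complex_norm.

(** * Unordered sums *)

Section fset_sum.
Variables (I : choiceType) (V : zmodType).
Implicit Types (A B : {fset I}) (f : I -> V).

Lemma sum_fsetDK A B f : (A `<=` B)%fset ->
  \sum_(i <- B) f i = \sum_(i <- A) f i + \sum_(i <- (B `\` A)%fset) f i.
Proof.
move=> AB; rewrite (big_fsetID _ (mem A) B); congr +%R; apply: eq_fbigl => i.
  by rewrite !inE /= andb_idl//; exact: (fsubsetP AB).
by rewrite !inE /= andbC.
Qed.

End fset_sum.

(** Unconditional summation: the limit along the net of the finite subsets. The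
    sum ranges over a subset P of the index type, so that the sums over
    different fibres of a map are sums over one type. *)
Definition has_sum (R : realType) (I : choiceType) (P : set I) (f : I -> R[i])
    (t : R[i]) : Prop :=
  forall e : R, 0 < e -> exists A : {fset I}, (forall i, i \in A -> P i) /\
    forall B : {fset I}, (A `<=` B)%fset -> (forall i, i \in B -> P i) ->
      normc (\sum_(i <- B) f i - t) < e.

Section has_sum.
Variable R : realType.
Local Open Scope complex_scope.

Section one_index.
Variable I : choiceType.
Implicit Types (P : set I) (f g : I -> R[i]) (a b : I -> R) (A B : {fset I}).

Lemma sum_RtoC (s : seq I) a : \sum_(i <- s) (a i)%:C = (\sum_(i <- s) a i)%:C :> R[i].
Proof. by rewrite rmorph_sum. Qed.

Lemma has_sum_near P f t e : has_sum P f t -> 0 < e ->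
  forall A, (forall i, i \in A -> P i) ->
  exists B, [/\ (A `<=` B)%fset, forall i, i \in B -> P i &
                normc (\sum_(i <- B) f i - t) < e].
Proof.
move=> ft e0 A AP; have [A1 [A1P h]] := ft _ e0.
have UP i : i \in (A1 `|` A)%fset -> P i by rewrite inE => /orP[/A1P|/AP].
exists (A1 `|` A)%fset; rewrite fsubsetUr; split => //.
by apply: h => //; exact: fsubsetUl.
Qed.

Lemma has_sum_unique P f t u : has_sum P f t -> has_sum P f u -> t = u.
Proof.
move=> ft fu; apply/eqP; rewrite -subr_eq0; apply/eqP/eq0_normc/eqP.
rewrite eq_le normc_ge0 andbT; apply/ler_addgt0Pr => e e0; rewrite add0r.
have e2 : 0 < e / 2 by rewrite divr_gt0.
have [A [AP At]] := ft _ e2.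
have [B [AB BP Bu]] := has_sum_near fu e2 AP.
rewrite (le_trans (ler_normc_dist _ _ (\sum_(i <- B) f i)))// [e]splitr lerD// ltW//.
by rewrite normc_distC; exact: At.
Qed.

Lemma eq_has_sum P f g t : (forall i, P i -> f i = g i) ->
  has_sum P f t -> has_sum P g t.
Proof.
move=> fg ft e /ft[A [AP h]]; exists A; split => // B AB BP.
by rewrite big_seq -(eq_bigr _ (fun i iB => fg i (BP i iB))) -big_seq; exact: h.
Qed.

Lemma has_sum0 P f : (forall i, P i -> f i = 0) -> has_sum P f 0.
Proof.
move=> f0 e e0; exists fset0; split=> [i|B _ BP]; first by rewrite inE.
by rewrite big_seq (eq_bigr _ (fun i iB => f0 i (BP i iB))) big1// subrr normc0.
Qed.

Lemma has_sumD P f g t u : has_sum P f t -> has_sum P g u ->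
  has_sum P (fun i => f i + g i) (t + u).
Proof.
move=> ft gu e e0; have e2 : 0 < e / 2 by rewrite divr_gt0.
have [A [AP At]] := ft _ e2; have [B [BP Bu]] := gu _ e2.
exists (A `|` B)%fset; split=> [i|C]; first by rewrite inE => /orP[/AP|/BP].
rewrite fsubUset => /andP[AC BC] CP; rewrite big_split /= opprD addrACA [e]splitr.
by rewrite (le_lt_trans (ler_normcD _ _))// ltrD ?At ?Bu.
Qed.

Lemma has_sumZ P f t c : has_sum P f t -> has_sum P (fun i => c * f i) (c * t).
Proof.
move=> ft e e0.
have [A [AP At]] : exists A, (forall i, i \in A -> P i) /\
    forall B, (A `<=` B)%fset -> (forall i, i \in B -> P i) ->
      normc (\sum_(i <- B) f i - t) < e / (normc c + 1).
  by apply: ft; rewrite divr_gt0// ltr_wpDl// normc_ge0.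
exists A; split => // B AB BP; rewrite -mulr_sumr -mulrBr normcM.
have c1 : 0 < normc c + 1 by rewrite ltr_wpDl ?normc_ge0.
have := At B AB BP; rewrite ltr_pdivlMr// mulrC; apply: le_lt_trans.
by rewrite ler_wpM2r ?normc_ge0// lerDl.
Qed.

Lemma has_sumN P f t : has_sum P f t -> has_sum P (fun i => - f i) (- t).
Proof.
move=> /has_sumZ => /(_ (-1)); rewrite mulN1r; apply: eq_has_sum => i _.
by rewrite mulN1r.
Qed.

Lemma has_sum_conj P f t : has_sum P f t -> has_sum P (fun i => (f i)^*) t^*.
Proof.
move=> ft e /ft[A [AP At]]; exists A; split => // B AB BP.
by rewrite -rmorph_sum -rmorphB normc_conj At.
Qed.

Lemma has_sum_single P f x : P x -> (forall i, P i -> i <> x -> f i = 0) ->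
  has_sum P f (f x).
Proof.
move=> Px f0 e e0; exists [fset x]%fset; split=> [i /[!inE]/eqP->//|B xB BP].
rewrite (big_fsetD1 x) ?(fsubsetP xB) ?inE//= addrAC subrr add0r.
rewrite big_seq big1 ?normc0// => i; rewrite !inE => /andP[/eqP ix iB].
exact: f0 (BP _ iB) ix.
Qed.

Lemma has_sum_real P a t : has_sum P (fun i => (a i)%:C) t -> (re t)%:C = t.
Proof.
move=> aT; have : t^* = t.
  apply: (has_sum_unique _ aT); apply: eq_has_sum (has_sum_conj aT) => i _.
  by rewrite conjc_real.
case: t {aT} => x y [] /eqP; rewrite eq_sym -addr_eq0 -mulr2n mulrn_eq0 /= => /eqP->.
by [].
Qed.

Section nonneg.
Variables (P : set I) (a : I -> R) (t : R).
Hypothesis a0 : forall i, P i -> 0 <= a i.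

Lemma ler_sum_fset A B : (A `<=` B)%fset -> (forall i, i \in B -> P i) ->
  \sum_(i <- A) a i <= \sum_(i <- B) a i.
Proof.
move=> AB BP; rewrite (sum_fsetDK _ AB) lerDl big_seq sumr_ge0// => i.
by rewrite inE => /andP[_ /BP /a0].
Qed.

Hypothesis aT : has_sum P (fun i => (a i)%:C) t%:C.

Lemma has_sum_ge A : (forall i, i \in A -> P i) -> \sum_(i <- A) a i <= t.
Proof.
move=> AP; apply/ler_addgt0Pr => e e0.
have [B [AB BP Bt]] := has_sum_near aT e0 AP.
rewrite (le_trans (ler_sum_fset AB BP))// -lerBlDl ltW//.
by move: Bt; rewrite sum_RtoC -rmorphB normc_real; apply: le_lt_trans; rewrite ler_norm.
Qed.

Lemma has_sum_ge0 : 0 <= t.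
Proof. by have := @has_sum_ge fset0; rewrite big_seq_fset0; apply=> i; rewrite inE. Qed.

Lemma has_sum_ge1 i : P i -> a i <= t.
Proof.
move=> Pi; have := @has_sum_ge [fset i]%fset; rewrite big_seq_fset1; apply=> j.
by rewrite inE => /eqP->.
Qed.

End nonneg.

Lemma has_sum_le (P : set I) a b s t : (forall i, P i -> a i <= b i) ->
  has_sum P (fun i => (a i)%:C) s%:C -> has_sum P (fun i => (b i)%:C) t%:C -> s <= t.
Proof.
move=> ab sa sb; rewrite -subr_ge0.
apply: (@has_sum_ge0 P (fun i => b i - a i)) => [i Pi|]; first by rewrite subr_ge0 ab.
rewrite rmorphB; have := has_sumD sb (has_sumN sa); apply: eq_has_sum => i _.
by rewrite rmorphB.
Qed.

(** The sum is the supremum of the finite partial sums. *)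
Lemma has_sum_bounded P a (M : R) : (forall i, P i -> 0 <= a i) ->
  (forall A, (forall i, i \in A -> P i) -> \sum_(i <- A) a i <= M) ->
  exists2 t, 0 <= t <= M & has_sum P (fun i => (a i)%:C) t%:C.
Proof.
move=> a0 aM.
pose S := [set u | exists2 A : {fset I}, (forall i, i \in A -> P i) & \sum_(i <- A) a i = u].
have S0 : S 0 by exists fset0; rewrite ?big_seq_fset0// => i; rewrite inE.
have SM : ubound S M by move=> _ [A AP <-]; exact: aM.
have hS : has_sup S by split; [exists 0 | exists M].
have sumS A : (forall i, i \in A -> P i) -> \sum_(i <- A) a i <= sup S.
  by move=> AP; apply: ub_le_sup; [exists M | exists A].
exists (sup S) => [|e e0].
  by rewrite (ge_sup _ SM) ?andbT; [exact: (ub_le_sup (ex_intro _ _ SM)) | exists 0].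
have [_ [A AP <-] Ae] := sup_adherent e0 hS.
exists A; split => // B AB BP; rewrite sum_RtoC -rmorphB normc_real distrC.
rewrite ger0_norm ?subr_ge0 ?sumS// ltrBlDr -ltrBlDl (lt_le_trans Ae)//.
exact: ler_sum_fset AB BP.
Qed.

(** Positive and negative parts of the real and imaginary parts reduce
    absolutely convergent sums to bounded non-negative ones. *)
Lemma has_sum_dominated P f a (T : R) : (forall i, P i -> normc (f i) <= a i) ->
  has_sum P (fun i => (a i)%:C) T%:C -> exists t, has_sum P f t.
Proof.
move=> fa aT.
have a0 i : P i -> 0 <= a i by move=> Pi; rewrite (le_trans _ (fa i Pi))// normc_ge0.
have real_part (b : I -> R) : (forall i, P i -> `|b i| <= a i) ->
    exists t, has_sum P (fun i => (b i)%:C) t.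
  move=> ba.
  have pos (c : I -> R) : (forall i, P i -> c i <= a i) ->
      exists t, has_sum P (fun i => (Num.max (c i) 0)%:C) t.
    move=> ca; have [|A AP|t _ ct] := @has_sum_bounded P (fun i => Num.max (c i) 0) T.
    - by move=> i _; rewrite le_max lexx orbT.
    - rewrite (le_trans _ (has_sum_ge a0 aT AP))// big_seq [leRHS]big_seq ler_sum// => i iA.
      by rewrite ge_max ca ?a0; [|exact: AP..].
    by exists t%:C.
  have [|t bt] := pos b; first by move=> i /ba; apply: le_trans; rewrite ler_norm.
  have [|u bu] := pos (fun i => - b i).
    by move=> i /ba; apply: le_trans; rewrite -normrN ler_norm.
  exists (t - u); have := has_sumD bt (has_sumN bu); apply: eq_has_sum => i _.
  rewrite -rmorphB; congr (_%:C); rewrite /Num.max.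
  by rewrite oppr_lt0; case: ltP => ?; case: ltP => ?; lra.
have [|t ft] := real_part (fun i => re (f i)).
  by move=> i /fa; apply: le_trans; exact: Re_le_normc.
have [|u fu] := real_part (fun i => im (f i)).
  by move=> i /fa; apply: le_trans; exact: Im_le_normc.
exists (t + 'i * u); have := has_sumD ft (has_sumZ 'i fu); apply: eq_has_sum => i _.
by case: (f i) => x y; simpc.
Qed.

(** A finite part A that nearly exhausts the dominating sum nearly exhausts all
    the sums that it dominates; this makes estimates uniform over fibres. *)
Lemma has_sum_tail P f a t T A : (forall i, P i -> normc (f i) <= a i) ->
  has_sum P f t -> has_sum P (fun i => (a i)%:C) T%:C ->
  (forall i, i \in A -> P i) ->
  normc (t - \sum_(i <- A) f i) <= T - \sum_(i <- A) a i.
Proof.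
move=> fa ft aT AP; apply/ler_addgt0Pr => e e0.
have a0 i : P i -> 0 <= a i by move=> Pi; rewrite (le_trans _ (fa i Pi))// normc_ge0.
have [B [AB BP Bt]] := has_sum_near ft e0 AP.
rewrite (le_trans (ler_normc_dist _ _ (\sum_(i <- B) f i)))// addrC.
rewrite lerD//; last by rewrite normc_distC ltW.
rewrite (sum_fsetDK _ AB) addrAC subrr add0r (le_trans (normc_sum _ _))//.
rewrite lerBrDl (le_trans _ (has_sum_ge a0 aT BP))// (sum_fsetDK _ AB) lerD2l.
rewrite big_seq [leRHS]big_seq ler_sum// => i; rewrite inE => /andP[_ /BP]; exact: fa.
Qed.

Lemma has_sum_norm_le P f a t T : (forall i, P i -> normc (f i) <= a i) ->
  has_sum P f t -> has_sum P (fun i => (a i)%:C) T%:C -> normc t <= T.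
Proof.
move=> fa ft aT; have := @has_sum_tail _ _ _ _ _ fset0 fa ft aT.
by rewrite !big_seq_fset0 !subr0; apply=> i; rewrite inE.
Qed.

Lemma has_sum_le_exists (P : set I) a b T : (forall i, P i -> 0 <= a i <= b i) ->
  has_sum P (fun i => (b i)%:C) T%:C ->
  exists2 t, 0 <= t <= T & has_sum P (fun i => (a i)%:C) t%:C.
Proof.
move=> ab bT; apply: has_sum_bounded => [i /ab/andP[]//|A AP].
have b0 i : P i -> 0 <= b i by move=> /ab/andP[]; exact: le_trans.
apply: le_trans (has_sum_ge b0 bT AP).
by rewrite big_seq [leRHS]big_seq ler_sum// => i /AP/ab/andP[].
Qed.

Section square_summable.
Variables (P : set I) (f g : I -> R[i]) (S T : R).
Hypothesis fS : has_sum P (fun i => (normc (f i) ^+ 2)%:C) S%:C.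
Hypothesis gT : has_sum P (fun i => (normc (g i) ^+ 2)%:C) T%:C.

Lemma has_sum_sq_ge0 : 0 <= S.
Proof. by apply: has_sum_ge0 fS => i _; rewrite sqr_ge0. Qed.

Lemma has_sum_sq_eq0 : S = 0 -> forall i, P i -> f i = 0.
Proof.
move=> S0 i Pi; have := has_sum_ge1 (fun i _ => sqr_ge0 _) fS Pi.
by rewrite S0 => h; apply/eq0_normc/eqP; rewrite -sqrf_eq0 eq_le h sqr_ge0.
Qed.

Lemma has_sum_sq_comb (p q : R) :
  has_sum P (fun i => (p * normc (f i) ^+ 2 + q * normc (g i) ^+ 2)%:C)
            (p * S + q * T)%:C.
Proof.
rewrite !rmorphD !rmorphM.
have := has_sumD (has_sumZ p%:C fS) (has_sumZ q%:C gT).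
by apply: eq_has_sum => i _; rewrite rmorphD !rmorphM.
Qed.

Lemma sqr_normcD_le2 i : 
  0 <= normc (f i + g i) ^+ 2 <= 2 * normc (f i) ^+ 2 + 2 * normc (g i) ^+ 2.
Proof.
rewrite sqr_ge0/= (@le_trans _ _ ((normc (f i) + normc (g i)) ^+ 2))//.
  by rewrite lerXn2r ?nnegrE ?addr_ge0 ?normc_ge0 ?ler_normcD.
by have := sqr_ge0 (normc (f i) - normc (g i)); rewrite sqrrB sqrrD; lra.
Qed.

Lemma has_sum_sqN : has_sum P (fun i => (normc (- f i) ^+ 2)%:C) S%:C.
Proof. by apply: eq_has_sum fS => i _; rewrite normcNN. Qed.

Lemma square_summableD : exists2 U, 0 <= U <= 2 * S + 2 * T &
  has_sum P (fun i => (normc (f i + g i) ^+ 2)%:C) U%:C.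
Proof. by apply: has_sum_le_exists (has_sum_sq_comb 2 2) => i _; exact: sqr_normcD_le2. Qed.

Lemma normc_mul_le i : normc ((f i)^* * g i) <= 1 * normc (f i) ^+ 2 + 1 * normc (g i) ^+ 2.
Proof.
rewrite normcM normc_conj.
have := sqr_ge0 (normc (f i) - normc (g i)); rewrite sqrrB.
have := mulr_ge0 (normc_ge0 (f i)) (normc_ge0 (g i)); lra.
Qed.

Lemma square_summableM : exists t, has_sum P (fun i => (f i)^* * g i) t.
Proof. by apply: has_sum_dominated (has_sum_sq_comb 1 1) => i _; exact: normc_mul_le. Qed.

Hypotheses (S0 : 0 < S) (T0 : 0 < T).
Let a := Num.sqrt S.
Let b := Num.sqrt T.
Let a0 : 0 < a. Proof. by rewrite sqrtr_gt0. Qed.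
Let b0 : 0 < b. Proof. by rewrite sqrtr_gt0. Qed.

(** The weights are chosen such that, summed over P, they turn S and T into the
    product of the two norms a and b: b/a a^2 = a/b b^2 = a b. *)
Lemma weighted_AMGM (x y : R) : 2 * (x * y) <= (b / a) * x ^+ 2 + (a / b) * y ^+ 2.
Proof.
rewrite -subr_ge0; have -> : b / a * x ^+ 2 + a / b * y ^+ 2 - 2 * (x * y) =
    (b * x - a * y) ^+ 2 / (a * b) by field; rewrite !gt_eqF.
by rewrite divr_ge0 ?sqr_ge0// mulr_ge0 ?ltW.
Qed.

Lemma l2_triangle_gt0 U :
  has_sum P (fun i => (normc (f i + g i) ^+ 2)%:C) U%:C -> Num.sqrt U <= a + b.
Proof.
move=> fgU; rewrite -[a + b]gtr0_norm ?addr_gt0// -sqrtr_sqr ler_wsqrtr//.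
have -> : (a + b) ^+ 2 = (1 + b / a) * S + (1 + a / b) * T.
  rewrite -[S in RHS](sqr_sqrtr (ltW S0)) -[T in RHS](sqr_sqrtr (ltW T0)) -/a -/b.
  by field; rewrite !gt_eqF.
apply: has_sum_le fgU (has_sum_sq_comb (1 + b / a) (1 + a / b)) => i _.
apply: (@le_trans _ _ ((normc (f i) + normc (g i)) ^+ 2)).
  by rewrite lerXn2r ?nnegrE ?addr_ge0 ?normc_ge0 ?ler_normcD.
by have := weighted_AMGM (normc (f i)) (normc (g i)); rewrite sqrrD; lra.
Qed.

Lemma l2_Cauchy_Schwarz_gt0 t :
  has_sum P (fun i => (f i)^* * g i) t -> normc t <= a * b.
Proof.
move=> fgt; have -> : a * b = (b / a / 2) * S + (a / b / 2) * T.
  rewrite -[S in RHS](sqr_sqrtr (ltW S0)) -[T in RHS](sqr_sqrtr (ltW T0)) -/a -/b.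
  by field; rewrite !gt_eqF.
apply: has_sum_norm_le fgt (has_sum_sq_comb (b / a / 2) (a / b / 2)) => i _.
by have := weighted_AMGM (normc (f i)) (normc (g i)); rewrite normcM normc_conj; lra.
Qed.

End square_summable.

Lemma l2_triangle (P : set I) f g (S T U : R) :
  has_sum P (fun i => (normc (f i) ^+ 2)%:C) S%:C ->
  has_sum P (fun i => (normc (g i) ^+ 2)%:C) T%:C ->
  has_sum P (fun i => (normc (f i + g i) ^+ 2)%:C) U%:C ->
  Num.sqrt U <= Num.sqrt S + Num.sqrt T.
Proof.
move=> fS gT fgU.
have [S0|S0] := eqVneq S 0.
  have [<-] : U%:C = T%:C.
    apply: has_sum_unique fgU _; apply: eq_has_sum gT => i Pi.
    by rewrite (has_sum_sq_eq0 fS S0 Pi) add0r.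
  by rewrite lerDr sqrtr_ge0.
have [T0|T0] := eqVneq T 0.
  have [<-] : U%:C = S%:C.
    apply: has_sum_unique fgU _; apply: eq_has_sum fS => i Pi.
    by rewrite (has_sum_sq_eq0 gT T0 Pi) addr0.
  by rewrite lerDl sqrtr_ge0.
have {}S0 : 0 < S by rewrite lt_neqAle eq_sym S0 (has_sum_sq_ge0 fS).
have {}T0 : 0 < T by rewrite lt_neqAle eq_sym T0 (has_sum_sq_ge0 gT).
exact: l2_triangle_gt0 fS gT S0 T0 _ fgU.
Qed.

Lemma l2_Cauchy_Schwarz (P : set I) f g (S T : R) t :
  has_sum P (fun i => (normc (f i) ^+ 2)%:C) S%:C ->
  has_sum P (fun i => (normc (g i) ^+ 2)%:C) T%:C ->
  has_sum P (fun i => (f i)^* * g i) t -> normc t <= Num.sqrt S * Num.sqrt T.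
Proof.
move=> fS gT fgt.
have [S0|S0] := eqVneq S 0.
  have -> : t = 0; last by rewrite normc0 mulr_ge0 ?sqrtr_ge0.
  apply: has_sum_unique fgt _; apply: has_sum0 => i Pi.
  by rewrite (has_sum_sq_eq0 fS S0 Pi) rmorph0 mul0r.
have [T0|T0] := eqVneq T 0.
  have -> : t = 0; last by rewrite normc0 mulr_ge0 ?sqrtr_ge0.
  apply: has_sum_unique fgt _; apply: has_sum0 => i Pi.
  by rewrite (has_sum_sq_eq0 gT T0 Pi) mulr0.
have {}S0 : 0 < S by rewrite lt_neqAle eq_sym S0 (has_sum_sq_ge0 fS).
have {}T0 : 0 < T by rewrite lt_neqAle eq_sym T0 (has_sum_sq_ge0 gT).
exact: l2_Cauchy_Schwarz_gt0 fS gT S0 T0 _ fgt.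
Qed.

End one_index.
End has_sum.

(** * Reindexing and fibrewise summation *)

Section has_sum_maps.
Variable R : realType.
Local Open Scope complex_scope.
Variables (I J : choiceType) (h : I -> J) (P : set I) (Q : set J).
Hypothesis hP : forall i, P i -> Q (h i).

Section bijection.
Hypothesis h_inj : forall i i', P i -> P i' -> h i = h i' -> i = i'.
Hypothesis h_surj : forall j, Q j -> exists2 i, P i & h i = j.

Lemma fset_lift (B : {fset J}) : (forall j, j \in B -> Q j) ->
  exists2 A : {fset I}, (forall i, i \in A -> P i) & [fset h i | i in A]%fset = B.
Proof.
move=> BQ; have [s sP hs] : exists2 s : seq I, (forall i, i \in s -> P i) & map h s = B.
  have : forall j, j \in enum_fset B -> Q j by [].
  elim: (enum_fset B) => [_|j s IHs jsQ]; first by exists [::].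
  have [i Pi hi] := h_surj (jsQ j (mem_head _ _)).
  have [|t tP ht] := IHs; first by move=> k ks; apply: jsQ; rewrite inE ks orbT.
  exists (i :: t) => [k|]; last by rewrite /= hi ht.
  by rewrite inE => /orP[/eqP->|/tP].
exists [fset i | i in s]%fset => [i /[!inE]/sP //|].
apply/fsetP => j; apply/imfsetP/idP => /= [[i /[!inE] is_ ->]|jB].
  by rewrite -[_ \in _]/(_ \in enum_fset B) -hs map_f.
have /mapP[i is_ ->] : j \in map h s by rewrite hs.
by exists i => //; rewrite inE.
Qed.

Lemma has_sum_reindex (f : J -> R[i]) t :
  has_sum Q f t <-> has_sum P (f \o h) t.
Proof.
have inj (A : {fset I}) : (forall i, i \in A -> P i) -> {in A &, injective h}.
  by move=> AP i i' /AP Pi /AP Pi'; exact: h_inj.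
split=> ft e /ft[A [Ain At]].
  have [A' A'P hA'] := fset_lift Ain; exists A'; split => // B A'B BP.
  have := At [fset h i | i in B]%fset; rewrite big_imfset /=; last exact: inj.
  apply; last by move=> _ /imfsetP[i /= /BP Pi ->]; exact: hP.
  apply/fsubsetP => j; rewrite -hA' => /imfsetP[i /= iA ->].
  by apply/imfsetP; exists i => //; exact: (fsubsetP A'B).
exists [fset h i | i in A]%fset; split=> [_ /imfsetP[i /= /Ain Pi ->]|B AB BQ].
  exact: hP.
have [B' B'P hB'] := fset_lift BQ.
have := At B'; rewrite -hB' big_imfset /=; last exact: inj.
apply => //; apply/fsubsetP => i iA.
have : h i \in B by apply: (fsubsetP AB); apply/imfsetP; exists i.
rewrite -hB' => /imfsetP[i' /= i'B' hii'].
by rewrite (h_inj (Ain _ iA) (B'P _ i'B') hii').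
Qed.

End bijection.

(** Finite parts of the fibres over a finite set B that nearly exhaust them,
    and that contain the part of A over B, make up a finite part of P that
    contains A. The error is shared out among the elements of B by induction. *)
Lemma has_sum_fibres (f : I -> R[i]) (u : J -> R[i]) t :
  (forall j, Q j -> has_sum [set i | P i /\ h i = j] f (u j)) ->
  has_sum P f t -> has_sum Q u t.
Proof.
move=> fu ft e e0; have e2 : 0 < e / 2 by rewrite divr_gt0.
have [A [AP At]] := ft _ e2.
exists [fset h i | i in A]%fset; split=> [_ /imfsetP[i /= /AP Pi ->]|B AB BQ].
  exact: hP.
have [C [CP hCB AC Cu]] : exists C : {fset I}, [/\ forall i, i \in C -> P i,
    forall i, i \in C -> h i \in enum_fset B,
    forall i, i \in A -> h i \in enum_fset B -> i \in C &
    normc (\sum_(i <- C) f i - \sum_(j <- enum_fset B) u j) < e / 2].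
  have {}BQ : forall j, j \in enum_fset B -> Q j by [].
  move: (e / 2) e2 BQ (fset_uniq B) => {e e0 At AB}.
  elim: (enum_fset B) => [|j s IHs] d d0 sQ; first exists fset0.
    by split => //; rewrite big_seq_fset0 big_nil subrr normc0.
  rewrite cons_uniq => /andP[js us]; have d2 : 0 < d / 2 by rewrite divr_gt0.
  have [|C [CP hC AC Cu]] := IHs _ d2 _ us.
    by move=> k ks; apply: sQ; rewrite inE ks orbT.
  have [|D [AD DP Du]] := has_sum_near (fu j (sQ j (mem_head _ _))) d2
      (A := [fset i in A | h i == j]%fset).
    by move=> i; rewrite !inE /= => /andP[/AP Pi /eqP].
  have CD : [disjoint C & D]%fset.
    apply/fdisjointP => i iC; apply: contra js => /DP[_ <-]; exact: hC.
  exists (C `|` D)%fset; split=> [i|i|i iA|].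
  - by rewrite inE => /orP[/CP|/DP[]].
  - by rewrite !inE => /orP[/hC ->|/DP[_ ->]]; rewrite ?orbT ?eqxx.
  - rewrite !inE => /orP[/eqP hij|/(AC _ iA)->//]; rewrite [i \in D](fsubsetP AD) ?orbT//.
    by rewrite !inE /= iA hij eqxx.
  rewrite (sum_fsetDK _ (fsubsetUl C D)) fsetDUl fsetDv fset0U.
  have -> : (D `\` C = D)%fset by apply/fsetDidPl; rewrite fdisjoint_sym.
  rewrite big_cons opprD [- u j + _]addrC addrACA [d]splitr.
  by rewrite (le_lt_trans (ler_normcD _ _))// ltrD.
rewrite [e]splitr (le_lt_trans (ler_normc_dist _ _ (\sum_(i <- C) f i)))// ltrD//.
  by rewrite normc_distC.
apply: At => //; apply/fsubsetP => i iA; apply: AC => //.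
by apply: (fsubsetP AB); apply/imfsetP; exists i.
Qed.

(** A finite subset of P meets finitely many fibres, so its sum is at most a
    finite part of the sum of u. *)
Lemma has_sum_fibres_ge0 (a : I -> R) (u : J -> R) T :
  (forall i, P i -> 0 <= a i) ->
  (forall j, Q j -> has_sum [set i | P i /\ h i = j] (fun i => (a i)%:C) (u j)%:C) ->
  has_sum Q (fun j => (u j)%:C) T%:C ->
  exists t, has_sum P (fun i => (a i)%:C) t%:C.
Proof.
move=> a0 au uT.
have u0 j : Q j -> 0 <= u j by move=> Qj; apply: has_sum_ge0 (au j Qj) => i [/a0].
have [|t _ at_] := has_sum_bounded (M := T) a0; last by exists t.
move=> A AP; rewrite (partition_big_imfset _ h) /=.
have hAQ j : j \in [fset h i | i in A]%fset -> Q j by move=> /imfsetP[i /= /AP Pi ->]; exact: hP.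
rewrite (le_trans _ (has_sum_ge u0 uT hAQ))// big_seq [leRHS]big_seq ler_sum// => j /hAQ Qj.
rewrite big_fset_condE; apply: has_sum_ge (au j Qj) _ _ => [i [/a0]//|i].
by rewrite !inE /= => /andP[/AP Pi /eqP].
Qed.

End has_sum_maps.

Section unordered_sum.
Variables (R : realType).
Local Open Scope complex_scope.

Lemma cvg_partial_sumP (I : choiceType) (f : I -> R[i]^o) (t : R[i]^o) :
  partial_sum f @ totally --> t <-> has_sum setT f t.
Proof.
have -> : partial_sum f = fun A : {fset I} => \sum_(i <- A) f i.
  by apply/funext => A; rewrite big_seq_fsetE.
rewrite (cvg_complexP totally_filter); split=> ft e /ft.
  by move=> [A _ h]; exists A; split => // B AB _; exact: h.
by move=> [A [_ h]]; exists A => // B AB; exact: h.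
Qed.

Variables (E0 E1 : topologicalType) (s : E1 -> E0).

Lemma cvg_fibre_termP (f g : E1 -> R[i]) v (t : R[i]^o) :
  partial_sum (fibre_term (s := s) f g (v := v)) @ totally --> t <->
  has_sum [set x | s x = v] (fun x => (f x)^* * g x) t.
Proof.
rewrite cvg_partial_sumP (@has_sum_reindex _ _ _ (@set_val _ [set x | s x = v]) setT) //.
- by move=> x _; exact: set_mem (valP x).
- by move=> x y _ _; exact: val_inj.
- by move=> x vx; exists (SigSub (mem_set vx)).
Qed.

Lemma graph_ipE (f g : E1 -> R[i]) v t :
  has_sum [set x | s x = v] (fun x => (f x)^* * g x) t -> graph_ip s f g v = t.
Proof.
move=> /cvg_fibre_termP fg; apply: cvg_lim fg.
  exact: (@norm_hausdorff _ (R[i]^o)).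
exact: totally_filter.
Qed.

Lemma is_cvg_fibre_termP (f g : E1 -> R[i]) v :
  cvg (partial_sum (fibre_term (s := s) f g (v := v)) @ totally) <->
  has_sum [set x | s x = v] (fun x => (f x)^* * g x) (graph_ip s f g v).
Proof.
split=> [fg|/cvg_fibre_termP fg]; last by apply/cvg_ex; exists (graph_ip s f g v).
exact/cvg_fibre_termP.
Qed.

End unordered_sum.

(** * Functions vanishing at infinity *)

Section C0_functions.
Variables (R : realType) (E : topologicalType).
Local Open Scope complex_scope.
Implicit Types (f g : E -> R[i]^o) (e M : R).

Lemma C0_continuous f : C0 R E f -> continuous f.
Proof. by case. Qed.
Arguments C0_continuous [f] _ _ _ _.

Lemma C0_compact f e : C0 R E f -> 0 < e -> compact [set x | e <= normc (f x)].
Proof.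
move=> [fc fv] /fv[K cK Kf]; apply: (subclosed_compact _ cK) => [|x /= ex].
  rewrite -[X in closed X]/((fun x => normc (f x)) @^-1` [set y | e <= y]).
  by apply: closed_comp (@closed_ge _ e) => x _; exact/continuous_normc/fc.
by apply: contrapT => /Kf; rewrite ltNge ex.
Qed.

Lemma C0_bounded f : C0 R E f -> exists2 M, 0 <= M & forall x, normc (f x) <= M.
Proof.
move=> f0; have cK := C0_compact f0 ltr01.
have : compact ((fun x => normc (f x)) @` [set x | 1 <= normc (f x)]).
  apply: continuous_compact => //; apply: continuous_subspaceT => x.
  exact/continuous_normc/(C0_continuous f0).
move=> /compact_bounded[M [_ KM]].
exists (Num.max 1 (M + 1)) => [|x]; first by rewrite le_max ler01.
rewrite le_max; case: (leP 1 (normc (f x))) => [fx|/ltW->//].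
have := KM (M + 1); rewrite ltrDl ltr01 => /(_ isT (normc (f x))) /=.
by rewrite ger0_norm ?normc_ge0// => ->; rewrite ?orbT//; exists x.
Qed.

Lemma C0_le f g (M : R) : continuous f -> C0 R E g ->
  (forall x, normc (f x) <= M * normc (g x)) -> C0 R E f.
Proof.
move=> fc g0 fg; split => // e e0.
have M1 : 0 < `|M| + 1 by rewrite ltr_wpDl.
exists [set x | e / (`|M| + 1) <= normc (g x)]; first by apply: C0_compact; rewrite ?divr_gt0.
move=> x /= /negP; rewrite -ltNge ltr_pdivlMr// => ge; apply: le_lt_trans (fg x) _.
apply: le_lt_trans ge; rewrite mulrC ler_wpM2l ?normc_ge0//.
by rewrite (le_trans (ler_norm M))// lerDl.
Qed.

Lemma C0_uniform_limit f :
  (forall e, 0 < e -> exists2 g, C0 R E g & forall x, normc (f x - g x) <= e) ->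
  C0 R E f.
Proof.
move=> fg; split=> [x|e e0].
  apply/continuous_complexP => e e0; have e4 : 0 < e / 4 by rewrite divr_gt0.
  have [g g0 {}fg] := fg _ e4.
  have /continuous_complexP/(_ _ e4) := C0_continuous g0 x; apply: filterS => y gxy.
  rewrite (le_lt_trans (ler_normc_dist _ _ (g y)))//.
  have := ler_normc_dist (g y) (f x) (g x); rewrite [normc (g x - f x)]normc_distC.
  by have := fg x; have := fg y; lra.
have e2 : 0 < e / 2 by rewrite divr_gt0.
have [g g0 {}fg] := fg _ e2; exists [set x | e / 2 <= normc (g x)]; first exact: C0_compact.
move=> x /= /negP; rewrite -ltNge => ge.
have := ler_dist_normc (f x) (g x); have := fg x; lra.
Qed.

Lemma C0_0 : C0 R E (fun=> 0).
Proof.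
split=> [x|e e0]; first exact: cvg_cst.
by exists set0; [exact: compact0 | move=> x _; rewrite normc0].
Qed.

Lemma C0D f g : C0 R E f -> C0 R E g -> C0 R E (fun x => f x + g x).
Proof.
move=> f0 g0; split=> [x|e e0].
  by apply: cvgD; [exact: C0_continuous f0 x | exact: C0_continuous g0 x].
have e2 : 0 < e / 2 by rewrite divr_gt0.
exists ([set x | e / 2 <= normc (f x)] `|` [set x | e / 2 <= normc (g x)]).
  by apply: compactU; exact: C0_compact.
move=> x /not_orP[] /= /negP; rewrite -ltNge => fe /negP; rewrite -ltNge => ge.
by rewrite (le_lt_trans (ler_normcD _ _))// [e]splitr ltrD.
Qed.

Lemma continuous_mulc_at f g x : {for x, continuous f} -> {for x, continuous g} ->
  {for x, continuous (fun y => f y * g y : R[i]^o)}.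
Proof. by move=> fc gc; apply: cvgM; [exact: fc | exact: gc]. Qed.

Lemma continuous_mulc f g : continuous f -> continuous g ->
  continuous (fun x => f x * g x : R[i]^o).
Proof. by move=> fc gc x; apply: continuous_mulc_at; [exact: fc | exact: gc]. Qed.

Lemma C0_mulr f g (M : R) : continuous f -> (forall x, normc (f x) <= M) -> C0 R E g ->
  C0 R E (fun x => f x * g x).
Proof.
move=> fc fM g0; apply: (C0_le (M := M) _ g0).
  exact: continuous_mulc fc (C0_continuous g0).
by move=> x; rewrite normcM ler_wpM2r ?normc_ge0.
Qed.

Lemma C0M f g : C0 R E f -> C0 R E g -> C0 R E (fun x => f x * g x).
Proof. by move=> f0; have [M _ fM] := C0_bounded f0; exact: C0_mulr (C0_continuous f0) fM. Qed.

Lemma C0Z c f : C0 R E f -> C0 R E (fun x => c * f x).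
Proof. by apply: (C0_mulr (M := normc c)) => // x; exact: cvg_cst. Qed.

Lemma C0_conj f : C0 R E f -> C0 R E (fun x => (f x)^*).
Proof.
move=> f0; apply: (C0_le (M := 1) _ f0) => x; last by rewrite normc_conj mul1r.
exact/continuous_conjc/(C0_continuous f0).
Qed.

Lemma continuous_Re f x : {for x, continuous f} -> {for x, continuous (fun y => re (f y))}.
Proof.
move=> /continuous_complexP fx; apply/cvgrPdistC_lt => e /fx.
apply: filterS => y; apply: le_lt_trans; rewrite (le_trans _ (Re_le_normc _))//.
by case: (f y) (f x) => a b [c d].
Qed.

Lemma C0_sqrt (f : E -> R) : (forall x, 0 <= f x) -> C0 R E (fun x => (f x)%:C) ->
  C0 R E (fun x => (Num.sqrt (f x))%:C).
Proof.
move=> fp f0; split=> [x|e e0].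
  refine (@continuous_RtoC R E (fun y => Num.sqrt (f y)) x _).
  apply: (@continuous_comp _ _ _ f); last exact: sqrt_continuous.
  exact: continuous_Re (C0_continuous f0 x).
exists [set x | e ^+ 2 <= normc (f x)%:C]; first by apply: C0_compact; rewrite ?exprn_gt0.
move=> x; rewrite /mkset => /negP; rewrite -ltNge !normc_real !ger0_norm ?sqrtr_ge0// => fe.
by rewrite -[e]gtr0_norm// -sqrtr_sqr ltr_sqrt ?exprn_gt0.
Qed.

(** Convertible to the norm of [C0_algebra R E]. *)
Definition supnorm f : R := sup (range (fun x => normc (f x))).

Lemma supnorm_ub f x : C0 R E f -> normc (f x) <= supnorm f.
Proof.
move=> /C0_bounded[M _ fM]; apply: ub_le_sup; last by exists x.
by exists M => _ [y _ <-].
Qed.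

Lemma supnorm_le f M : 0 <= M -> (forall x, normc (f x) <= M) -> supnorm f <= M.
Proof.
move=> M0 fM; rewrite /supnorm; have [E0|/set0P E0] := eqVneq (range (fun x => normc (f x))) set0.
  by rewrite E0 sup0.
by apply: ge_sup => // _ [x _ <-].
Qed.

Lemma supnorm_ge0 f : C0 R E f -> 0 <= supnorm f.
Proof.
move=> f0; rewrite /supnorm.
have [->|/set0P[_ [x _ _]]] := eqVneq (range (fun x => normc (f x))) set0; first by rewrite sup0.
exact: le_trans (normc_ge0 (f x)) (supnorm_ub x f0).
Qed.

End C0_functions.

(** At each point the real and the imaginary parts are Cauchy sequences of
    reals. *)
Lemma uniform_cauchy_limit (R : realType) (T : Type) (u : nat -> T -> R[i]) :
  (forall e : R, 0 < e -> exists N : nat, forall m n : nat, (N <= m)%N -> (N <= n)%N ->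
    forall x, normc (u m x - u n x) < e) ->
  exists l : T -> R[i], forall x (e : R), 0 < e ->
    \forall n \near \oo, normc (u n x - l x) < e.
Proof.
move=> uc.
have real_part (p : R[i] -> R) : (forall z w, `|p z - p w| <= normc (z - w)) ->
    exists l : T -> R, forall x, (fun n => p (u n x)) @ \oo --> l x.
  move=> pn; suff cv x : cvgn (fun n => p (u n x)).
    by exists (fun x => limn (fun n => p (u n x))) => x; exact: cv.
  apply/cauchy_cvgP/cauchy_ballP => e e0; have [N uN] := uc _ e0.
  exists (((fun n => p (u n x)) @` [set n | (N <= n)%N]),
          ((fun n => p (u n x)) @` [set n | (N <= n)%N])).
    by split; exists N => // n /= Nn; exists n.
  move=> [_ _] [[m Nm <-] [n Nn <-]] /=; rewrite -ball_normE /=.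
  by rewrite (le_lt_trans (pn _ _))// uN.
have [a ua] : exists l : T -> R, forall x, (fun n => re (u n x)) @ \oo --> l x.
  by refine (real_part _ _) => -[z z'] [w w']; rewrite (le_trans _ (Re_le_normc _)).
have [b ub] : exists l : T -> R, forall x, (fun n => im (u n x)) @ \oo --> l x.
  by refine (real_part _ _) => -[z z'] [w w']; rewrite (le_trans _ (Im_le_normc _)).
exists (fun x => (a x +i* b x)%C) => x e e0; have e2 : 0 < e / 2 by rewrite divr_gt0.
have /cvgrPdistC_lt/(_ _ e2) A := ua x; have /cvgrPdistC_lt/(_ _ e2) := ub x.
apply: filterS2 A => n A B; rewrite (le_lt_trans (normc_le_ReIm _))// [e]splitr ltrD//.
  by move: A; case: (u n x).
by move: B; case: (u n x).
Qed.

Section C0_algebra.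
Variables (R : realType) (E : topologicalType).
Local Open Scope complex_scope.

Lemma is_lspace_fun_space (T : Type) (D : set (T -> R[i])) :
  D (fun=> 0) -> (forall f g, D f -> D g -> D (fun x => f x + g x)) ->
  (forall c f, D f -> D (fun x => c * f x)) -> is_lspace (fun_space D).
Proof.
move=> D0 DD DZ; split=> //=.
- by move=> *; apply/funext => t; rewrite addrA.
- by move=> *; apply/funext => t; rewrite addrC.
- by move=> *; apply/funext => t; rewrite add0r.
- by move=> *; apply/funext => t; rewrite mulN1r subrr.
- by move=> *; apply/funext => t; rewrite mulrA.
- by move=> *; apply/funext => t; rewrite mul1r.
- by move=> *; apply/funext => t; rewrite mulrDl.
- by move=> *; apply/funext => t; rewrite mulrDr.
Qed.

Lemma supnorm_eq0 (f : E -> R[i]) : C0 R E f -> supnorm f = 0 -> f = fun=> 0.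
Proof.
move=> f0 f00; apply/funext => x; apply/eq0_normc/eqP.
by rewrite eq_le normc_ge0 andbT -f00 supnorm_ub.
Qed.

Lemma supnormZ (c : R[i]) (f : E -> R[i]) : C0 R E f ->
  supnorm (fun x => c * f x) = normc c * supnorm f.
Proof.
move=> f0; apply/eqP; rewrite eq_le; apply/andP; split.
  apply: supnorm_le => [|x]; first by rewrite mulr_ge0 ?normc_ge0 ?supnorm_ge0.
  by rewrite normcM ler_wpM2l ?normc_ge0 ?supnorm_ub.
have [->|c0] := eqVneq c 0.
  by rewrite normc0 mul0r; apply: supnorm_ge0; exact: C0Z.
have nc : 0 < normc c by rewrite lt_neqAle normc_ge0 andbT eq_sym; apply: contra c0 => /eqP/eq0_normc->.
rewrite -ler_pdivlMl//; apply: supnorm_le => [|x].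
  by rewrite mulr_ge0 ?invr_ge0 ?normc_ge0// supnorm_ge0//; exact: C0Z.
by rewrite ler_pdivlMl// -normcM; apply: (supnorm_ub (f := fun x => c * f x)); exact: C0Z.
Qed.

(** The pointwise limit is a uniform limit: the Cauchy estimate for u_n and u_m
    passes to the limit in m. *)
Lemma supnorm_complete : norm_complete (fun f : fun_space (C0 R E) => supnorm f).
Proof.
move=> u u0 uc.
have sub0 (f g : E -> R[i]) : C0 R E f -> C0 R E g ->
    C0 R E (vsub (f : fun_space (C0 R E)) g).
  by move=> f0 g0; apply: C0D => //; exact: C0Z.
have subE (f g : E -> R[i]) x : vsub (f : fun_space (C0 R E)) g x = f x - g x.
  by rewrite /vsub /= mulN1r.
have [|l ul] := @uniform_cauchy_limit R E u.
  move=> e /uc[N uN]; exists N => m n Nm Nn x.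
  by rewrite -subE; apply: le_lt_trans (uN m n Nm Nn); exact: (supnorm_ub x (sub0 _ _ (u0 m) (u0 n))).
have uul e : 0 < e -> exists N : nat, forall n : nat, (N <= n)%N -> forall x, normc (u n x - l x) <= e.
  move=> e0; have [N uN] := uc _ e0; exists N => n Nn x.
  apply/ler_addgt0Pr => d d0; have [M _ Ml] := ul x _ d0.
  rewrite (le_trans (ler_normc_dist _ _ (u (maxn N M) x)))// lerD//.
    rewrite -subE (le_trans (supnorm_ub x (sub0 _ _ (u0 _) (u0 _))))// ltW// uN//.
    exact: leq_maxl.
  by rewrite ltW// Ml//= leq_maxr.
have l0 : C0 R E l.
  apply: C0_uniform_limit => e /uul[N uN]; exists (u N); first exact: u0.
  by move=> x; rewrite normc_distC uN.
exists l => //; apply/cvgrPdistC_le => e e0; have [N uN] := uul e e0.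
exists N => // n /= Nn; rewrite subr0 ger0_norm ?supnorm_ge0//; last exact: (sub0 _ _ (u0 n) l0).
by apply: supnorm_le => [|x]; [exact: ltW | rewrite mulN1r uN].
Qed.

Lemma C0_algebra_cstar : is_cstar_algebra (C0_algebra R E).
Proof.
split=> /=.
- by apply: is_lspace_fun_space; [exact: C0_0 | exact: C0D | exact: C0Z].
- exact: C0M.
- exact: C0_conj.
- by move=> *; apply/funext => x; rewrite mulrA.
- by move=> *; apply/funext => x; rewrite mulrDl.
- by move=> *; apply/funext => x; rewrite mulrDr.
- by move=> *; apply/funext => x; rewrite mulrA.
- by move=> *; apply/funext => x; rewrite mulrCA.
- by move=> *; apply/funext => x; rewrite conjcK.
- by move=> *; apply/funext => x; rewrite rmorphD.
- by move=> *; apply/funext => x; rewrite rmorphM.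
- by move=> *; apply/funext => x; rewrite rmorphM mulrC.
- exact: supnorm_ge0.
- exact: supnorm_eq0.
- move=> f g f0 g0; apply: supnorm_le => [|x]; first by rewrite addr_ge0 ?supnorm_ge0.
  by rewrite (le_trans (ler_normcD _ _))// lerD ?supnorm_ub.
- exact: supnormZ.
- move=> f g f0 g0; apply: supnorm_le => [|x]; first by rewrite mulr_ge0 ?supnorm_ge0.
  by rewrite normcM ler_pM ?normc_ge0 ?supnorm_ub.
- move=> f f0; apply/eqP; rewrite eq_le; apply/andP; split.
    apply: supnorm_le => [|x]; first by rewrite sqr_ge0.
    by rewrite normcM normc_conj -expr2 lerXn2r ?nnegrE ?normc_ge0 ?supnorm_ge0 ?supnorm_ub.
  rewrite -[leRHS]sqr_sqrtr; last by apply: supnorm_ge0; exact: C0M (C0_conj f0) f0.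
  rewrite lerXn2r ?nnegrE ?supnorm_ge0 ?sqrtr_ge0//.
  apply: supnorm_le => [|x]; first exact: sqrtr_ge0.
  rewrite -(ger0_norm (normc_ge0 (f x))) -sqrtr_sqr ler_wsqrtr//.
  have := supnorm_ub x (C0M (C0_conj f0) f0).
  by rewrite normcM normc_conj -expr2.
- exact: supnorm_complete.
Qed.

End C0_algebra.

(** * Fibre sums of a local homeomorphism *)

Lemma near_eq_continuous (T U : topologicalType) (f g : T -> U) (x : T) :
  (\forall y \near x, g y = f y) -> {for x, continuous g} -> {for x, continuous f}.
Proof.
move=> gf gc; have gfx : g x = f x := nbhs_singleton gf.
rewrite /prop_for /continuous_at -gfx; apply: cvg_trans gc.
exact: near_eq_cvg gf.
Qed.

Lemma cvg_big_seq (T : Type) (F : set_system T) (K : numFieldType) (V : normedModType K)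
    (I : eqType) (s : seq I) (f : I -> T -> V) (l : I -> V) : Filter F ->
  (forall i, i \in s -> f i @ F --> l i) ->
  (fun x => \sum_(i <- s) f i x) @ F --> \sum_(i <- s) l i.
Proof.
move=> FF; elim: s => [_|i s IHs sl].
  by under eq_fun do rewrite big_nil; rewrite big_nil; exact: cvg_cst.
under eq_fun do rewrite big_cons; rewrite big_cons; apply: cvgD; first exact: sl (mem_head _ _).
by apply: IHs => j js; apply: sl; rewrite inE js orbT.
Qed.

Lemma near_seq (T : Type) (F : set_system T) (I : eqType) (s : seq I)
    (P : I -> T -> Prop) : Filter F ->
  (forall i, i \in s -> \forall x \near F, P i x) ->
  \forall x \near F, forall i, i \in s -> P i x.
Proof.
move=> FF; elim: s => [_|i s IHs sP]; first by apply: filterE => x i; rewrite in_nil.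
have [|+ Ps] := (sP i (mem_head _ _), IHs _); first by move=> j js; apply: sP; rewrite inE js orbT.
by apply: filterS2 Ps => x Ps Pi j; rewrite inE => /orP[/eqP->//|]; exact: Ps.
Qed.

Lemma hausdorff_near_neq (T U : topologicalType) (f g : T -> U) (x : T) :
  hausdorff_space U -> {for x, continuous f} -> {for x, continuous g} ->
  f x != g x -> \forall y \near x, f y != g y.
Proof.
move=> hU fx gx; rewrite open_hausdorff in hU => /hU[[A B] /= [fA gB] [oA oB AB]].
have fAn : \forall y \near x, A (f y) by apply: fx; apply: open_nbhs_nbhs; split=> //; exact: set_mem.
have gBn : \forall y \near x, B (g y) by apply: gx; apply: open_nbhs_nbhs; split=> //; exact: set_mem.
apply: filterS2 fAn gBn => y Ay By; apply/eqP => fg.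
by move/eqP : AB; rewrite -subset0 => /(_ (f y)); apply; split => //; rewrite fg.
Qed.

Section local_homeomorphism.
Variables (E0 E1 : topologicalType) (s : E1 -> E0).
Hypothesis sl : local_homeomorphism s.

Lemma local_homeomorphism_section (x : E1) : exists (U : set E1) (h : E0 -> E1),
  [/\ open U, U x, open (s @` U), forall y, U y -> h (s y) = y &
      forall v, (s @` U) v -> {for v, continuous h}].
Proof.
have [U [oU Ux osU sc [h [hc hs]]]] := sl x; exists U, h; split => // v sUv.
move: hc; rewrite continuous_open_subspace// => /(_ v); apply; exact: mem_set.
Qed.

Lemma local_homeomorphism_continuous : continuous s.
Proof.
move=> x; have [U [oU Ux _ + _]] := sl x; rewrite continuous_open_subspace//.
by move=> /(_ x); apply; exact: mem_set.
Qed.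

Variable R : realType.
Hypothesis hE1 : hausdorff_space E1.
Local Notation fib v := [set x | s x = v].
Local Open Scope complex_scope.

(** Each point of A moves along a local section of s. As E1 is Hausdorff,
    distinct points stay distinct near v, so that a sum over the moved set is a
    sum along the sections. *)
Lemma lift_fibre_fset v (A : {fset E1}) : (forall x, x \in A -> s x = v) ->
  exists t : E0 -> {fset E1},
    (\forall w \near v, forall x, x \in t w -> s x = w) /\
    forall f : E1 -> R[i]^o, continuous f ->
      (fun w => \sum_(x <- t w) f x : R[i]^o) @ v --> (\sum_(x <- A) f x : R[i]^o).
Proof.
move=> As.
have /choice[h hP] : forall x : E1, exists h : E0 -> E1, [/\ h (s x) = x,
    {for s x, continuous h} & \forall w \near s x, s (h w) = w].
  move=> x; have [U [h [oU Ux osU hs hc]]] := local_homeomorphism_section x.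
  exists h; split; [exact: hs | by apply: hc; exists x|].
  apply: filterS (open_nbhs_nbhs (conj osU _)); last by exists x.
  by move=> w [y Uy <-]; rewrite hs.
exists (fun w => [fset h x w | x in A]%fset); split.
  have : \forall w \near v, forall x, x \in enum_fset A -> s (h x w) = w.
    by apply: near_seq => x /As xv; have [_ _] := hP x; rewrite xv.
  by apply: filterS => w hw _ /imfsetP[x /= xA ->]; exact: hw.
move=> f fc.
have hinj : \forall w \near v, {in A &, injective (h^~ w)}.
  have : \forall w \near v, forall x, x \in enum_fset A ->
      forall y, y \in enum_fset A -> h x w = h y w -> x = y.
    apply: near_seq => x xA; apply: near_seq => y yA.
    have [->|xy] := eqVneq x y; first exact: filterE.
    have [hx hxc _] := hP x; have [hy hyc _] := hP y.
    move: hx hxc hy hyc; rewrite (As _ xA) (As _ yA) => hx hxc hy hyc.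
    have := hausdorff_near_neq hE1 hxc hyc; rewrite hx hy => /(_ xy).
    by apply: filterS => w /eqP.
  by apply: filterS => w hw x y xA yA; exact: hw.
have sumE : \forall w \near v,
    \sum_(x <- [fset h x w | x in A]%fset) f x = \sum_(x <- A) f (h x w).
  by apply: filterS hinj => w hw; rewrite big_imfset.
apply: cvg_trans (near_eq_cvg _) _.
  by apply: filterS sumE => w ->; exact: erefl.
have -> : \sum_(x <- A) f x = \sum_(x <- A) f (h x v).
  by apply: eq_big_seq => x xA; have [hx _ _] := hP x; rewrite -(As _ xA) hx.
have : forall x, x \in enum_fset A -> {for v, continuous (h x)}.
  by move=> x xA; have [_ + _] := hP x; rewrite (As _ xA).
move=> hc; apply: cvg_big_seq => x xA.
by apply: (@continuous_comp _ _ _ (h x) f); [exact: hc | exact: fc].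
Qed.

(** A finite part of the fibre over v that nearly exhausts the dominating sum
    is moved along local sections. Its sum and the dominating sum M are both
    continuous at v, so it nearly exhausts the dominating sum over all nearby
    fibres, and hence also the sum of f. *)
Lemma fibre_sum_continuous (f : E1 -> R[i]^o) (a : E1 -> R) (F : E0 -> R[i]^o)
    (M : E0 -> R) :
  continuous f -> continuous a -> (forall x, normc (f x) <= a x) ->
  (forall v, has_sum (fib v) f (F v)) ->
  (forall v, has_sum (fib v) (fun x => (a x)%:C) (M v)%:C) ->
  continuous M -> continuous F.
Proof.
move=> fc ac fa fF aM Mc v; apply/continuous_complexP => e e0.
have d0 : 0 < e / 5 by rewrite divr_gt0.
have [A [As Ae]] := aM v _ d0.
have {}Ae : M v - \sum_(x <- A) a x < e / 5.
  have := Ae A (fsubset_refl _) As; rewrite sum_RtoC -rmorphB normc_real distrC.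
  by apply: le_lt_trans; rewrite ler_norm.
have [t [ts tf]] := lift_fibre_fset As.
have /cvg_complexP/(_ _ d0) fn := tf _ fc.
have aCc : continuous (fun x => (a x)%:C : R[i]^o).
  by move=> x; exact: (@continuous_RtoC _ _ a x (ac x)).
have /cvg_complexP/(_ _ d0) an := tf _ aCc.
have /cvgrPdistC_lt/(_ _ d0) Mn := Mc v.
apply: filterS2 (filterI ts fn) (filterI an Mn) => w [tw fw] [aw Mw].
have := has_sum_tail (fun x _ => fa x) (fF w) (aM w) tw.
have := has_sum_tail (fun x _ => fa x) (fF v) (aM v) As.
move: aw; rewrite !sum_RtoC -rmorphB normc_real ltr_norml => /andP[aw _].
move: Mw; rewrite ltr_norml => /andP[_ Mw].
have := ler_normc_dist (F w) (F v) (\sum_(x <- t w) f x).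
have := ler_normc_dist (\sum_(x <- t w) f x) (F v) (\sum_(x <- A) f x).
rewrite [normc (\sum_(x <- A) f x - F v)]normc_distC.
by move: fw; lra.
Qed.

End local_homeomorphism.

(** * The Hilbert bimodule of a topological graph *)

Section graph_bimodules.
Variables (R : realType) (E0 E1 : topologicalType) (s r : E1 -> E0).
Hypotheses (sl : local_homeomorphism s) (rc : continuous r).
Hypothesis hE1 : hausdorff_space E1.
Local Open Scope complex_scope.
Local Notation fib v := [set x | s x = v].
Local Notation A := (C0_algebra R E0).
Local Notation X := (@graph_bimodule R E0 E1 s r).
Local Notation GX := (@graph_module R E0 E1 s).
Implicit Types (f g : E1 -> R[i]) (a b : E0 -> R[i]) (v : E0).

Definition fibre_sqnorm f v : R := re (graph_ip s f f v).

Lemma graph_module_C0 f : GX f -> C0 R E1 f. Proof. by case. Qed.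

Lemma fibre_sqnormP f v : GX f ->
  has_sum (fib v) (fun x => (normc (f x) ^+ 2)%:C) (fibre_sqnorm f v)%:C.
Proof.
move=> [_ /(_ v)/is_cvg_fibre_termP ff _].
have : has_sum (fib v) (fun x => (normc (f x) ^+ 2)%:C) (graph_ip s f f v).
  by apply: eq_has_sum ff => x _; rewrite mul_conjc.
by move=> ft; rewrite /fibre_sqnorm (has_sum_real ft).
Qed.

Lemma graph_ip_diag f v : GX f -> graph_ip s f f v = (fibre_sqnorm f v)%:C.
Proof.
move=> fX; apply: graph_ipE; apply: eq_has_sum (fibre_sqnormP v fX) => x _.
by rewrite mul_conjc.
Qed.

Lemma fibre_sqnorm_ge0 f v : GX f -> 0 <= fibre_sqnorm f v.
Proof. by move=> fX; exact: has_sum_sq_ge0 (fibre_sqnormP v fX). Qed.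

Lemma fibre_sqnorm_C0 f : GX f -> C0 R E0 (fun v => (fibre_sqnorm f v)%:C).
Proof.
move=> fX; have [_ _ +] := fX; congr C0; apply/funext => v; exact: graph_ip_diag.
Qed.

Lemma C0_real_continuous (M : E0 -> R) : C0 R E0 (fun v => (M v)%:C) -> continuous M.
Proof. move=> M0 v; refine (@continuous_Re _ _ (fun w => (M w)%:C) v _).
exact: (C0_continuous M0). Qed.

Lemma graph_module_intro f (F : E0 -> R) : C0 R E1 f ->
  (forall v, has_sum (fib v) (fun x => (normc (f x) ^+ 2)%:C) (F v)%:C) ->
  C0 R E0 (fun v => (F v)%:C) -> GX f.
Proof.
move=> f0 fF F0.
have {}fF v : has_sum (fib v) (fun x => (f x)^* * f x) (F v)%:C.
  by apply: eq_has_sum (fF v) => x _; rewrite mul_conjc.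
split => // [v|]; first by apply/is_cvg_fibre_termP; rewrite (graph_ipE (fF v)).
by have -> : graph_ip s f f = fun v => (F v)%:C by apply/funext => v; exact: graph_ipE.
Qed.

Lemma fibre_sum_C0 f (c : E1 -> R) (F : E0 -> R[i]) (M : E0 -> R) :
  continuous (f : E1 -> R[i]^o) -> continuous c -> (forall x, normc (f x) <= c x) ->
  (forall v, has_sum (fib v) f (F v)) ->
  (forall v, has_sum (fib v) (fun x => (c x)%:C) (M v)%:C) ->
  C0 R E0 (fun v => (M v)%:C) -> C0 R E0 F.
Proof.
move=> fc cc fa fF cM M0; apply: (C0_le (M := 1) _ M0) => [|v].
  exact: fibre_sum_continuous fc cc fa fF cM (C0_real_continuous M0).
have M_ge0 : 0 <= M v.
  by apply: has_sum_ge0 (cM v) => x _; exact: le_trans (normc_ge0 _) (fa x).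
by rewrite mul1r normc_real ger0_norm//; apply: has_sum_norm_le (fF v) (cM v) => x _.
Qed.

Lemma continuous_sqnorm (E : topologicalType) (f : E -> R[i]^o) : continuous f ->
  continuous (fun x => normc (f x) ^+ 2).
Proof.
by move=> fc x; apply: (@continuousM R E); exact: continuous_normc (fc x).
Qed.

(** The closure properties of the module come from here: |f + g|^2 and |h f|^2,
    for a bounded continuous h, are dominated by combinations of |f|^2 and
    |g|^2, of which the fibre sums are continuous and vanish at infinity. *)
Lemma graph_module_dominated f (c : E1 -> R) (M : E0 -> R) : C0 R E1 f ->
  continuous c -> (forall x, normc (f x) ^+ 2 <= c x) ->
  (forall v, has_sum (fib v) (fun x => (c x)%:C) (M v)%:C) ->
  C0 R E0 (fun v => (M v)%:C) -> GX f.
Proof.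
move=> f0 cc fc cM M0.
have /choice[F fF] : forall v, exists t,
    has_sum (fib v) (fun x => (normc (f x) ^+ 2)%:C) t%:C.
  move=> v; have cf x : fib v x -> 0 <= normc (f x) ^+ 2 <= c x by rewrite sqr_ge0 fc.
  by have [t _ ft] := has_sum_le_exists cf (cM v); exists t.
apply: (graph_module_intro f0 fF).
apply: (fibre_sum_C0 (f := fun x => (normc (f x) ^+ 2)%:C) _ cc _ fF cM M0) => x.
  apply: (@continuous_RtoC _ _ (fun x => normc (f x) ^+ 2)).
  exact: continuous_sqnorm (C0_continuous f0) x.
by rewrite normc_real ger0_norm ?sqr_ge0.
Qed.

Lemma sqnorm_comb_C0 f g (p q : R) : GX f -> GX g ->
  C0 R E0 (fun v => (p * fibre_sqnorm f v + q * fibre_sqnorm g v)%:C).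
Proof.
move=> fX gX; have := C0D (C0Z p%:C (fibre_sqnorm_C0 fX)) (C0Z q%:C (fibre_sqnorm_C0 gX)).
by congr C0; apply/funext => v; rewrite rmorphD !rmorphM.
Qed.

Lemma sqnorm_comb_continuous f g (p q : R) : GX f -> GX g ->
  continuous (fun x => p * normc (f x) ^+ 2 + q * normc (g x) ^+ 2).
Proof.
move=> fX gX x; apply: (@continuousD R R^o E1).
  apply: (@continuousM R E1); first exact: cvg_cst.
  exact: continuous_sqnorm (C0_continuous (graph_module_C0 fX)) x.
apply: (@continuousM R E1); first exact: cvg_cst.
exact: continuous_sqnorm (C0_continuous (graph_module_C0 gX)) x.
Qed.

Lemma graph_module_le f g h (p q : R) : GX f -> GX g -> C0 R E1 h ->
  (forall x, normc (h x) ^+ 2 <= p * normc (f x) ^+ 2 + q * normc (g x) ^+ 2) -> GX h.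
Proof.
move=> fX gX h0 hfg; apply: graph_module_dominated h0 _ hfg _ _.
- exact: sqnorm_comb_continuous.
- by move=> v; exact: has_sum_sq_comb (fibre_sqnormP v fX) (fibre_sqnormP v gX) p q.
- exact: sqnorm_comb_C0.
Qed.

Lemma graph_moduleD f g : GX f -> GX g -> GX (fun x => f x + g x).
Proof.
move=> fX gX; apply: (graph_module_le (p := 2) (q := 2) fX gX) => [|x].
  exact: C0D (graph_module_C0 fX) (graph_module_C0 gX).
by have /andP[] := sqr_normcD_le2 f g x.
Qed.

Lemma graph_module_mulr h f (M : R) : continuous (h : E1 -> R[i]^o) ->
  (forall x, normc (h x) <= M) -> GX f -> GX (fun x => h x * f x).
Proof.
move=> hc hM fX; apply: (graph_module_le (p := M ^+ 2) (q := 0) fX fX) => [|x].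
  exact: C0_mulr hc hM (graph_module_C0 fX).
rewrite mul0r addr0 normcM exprMn ler_wpM2r ?sqr_ge0//.
by rewrite lerXn2r ?nnegrE ?normc_ge0 ?(le_trans (normc_ge0 (h x))).
Qed.

Lemma graph_moduleZ c f : GX f -> GX (fun x => c * f x).
Proof. by apply: (graph_module_mulr (M := normc c)) => // x; exact: cvg_cst. Qed.

Lemma graph_module_lact a f : C0 R E0 a -> GX f -> GX (fun x => a (r x) * f x).
Proof.
move=> a0; have [M _ aM] := C0_bounded a0.
apply: (graph_module_mulr (M := M)) => // x.
by apply: (@continuous_comp _ _ R[i]^o r a); [exact: rc | exact: (C0_continuous a0)].
Qed.

Lemma graph_module_ract a f : C0 R E0 a -> GX f -> GX (fun x => f x * a (s x)).
Proof.
move=> a0; have [M _ aM] := C0_bounded a0 => fX.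
have -> : (fun x => f x * a (s x)) = fun x => a (s x) * f x.
  by apply/funext => x; rewrite mulrC.
apply: (graph_module_mulr (M := M)) fX => // x.
apply: (@continuous_comp _ _ R[i]^o s a); last exact: (C0_continuous a0).
exact: local_homeomorphism_continuous.
Qed.

Lemma graph_module0 : GX (fun=> 0).
Proof.
apply: (@graph_module_intro _ (fun=> 0)) => [|v|]; first exact: C0_0.
  by apply: has_sum0 => x _; rewrite normc0 expr0n.
exact: C0_0.
Qed.

Lemma graph_ip_sum f g v : GX f -> GX g ->
  has_sum (fib v) (fun x => (f x)^* * g x) (graph_ip s f g v).
Proof.
move=> fX gX.
have [t ft] := square_summableM (fibre_sqnormP v fX) (fibre_sqnormP v gX).
by rewrite (graph_ipE ft).
Qed.

Lemma graph_ip_C0 f g : GX f -> GX g -> C0 R E0 (graph_ip s f g).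
Proof.
move=> fX gX.
apply: (@fibre_sum_C0 (fun x => (f x)^* * g x) (fun x => 1 * normc (f x) ^+ 2 + 1 * normc (g x) ^+ 2)
  _ (fun v => 1 * fibre_sqnorm f v + 1 * fibre_sqnorm g v)).
- apply: (@continuous_mulc _ _ (fun y => (f y)^*)) => y.
    by refine (@continuous_conjc _ _ f y _); exact: (C0_continuous (graph_module_C0 fX)).
  exact: (C0_continuous (graph_module_C0 gX)).
- exact: sqnorm_comb_continuous.
- exact: normc_mul_le.
- by move=> v; exact: graph_ip_sum.
- by move=> v; exact: has_sum_sq_comb (fibre_sqnormP v fX) (fibre_sqnormP v gX) _ _.
- exact: sqnorm_comb_C0.
Qed.

Definition graph_norm f : R := @mnorm R A X f.

Lemma normc_graph_ip_diag f v : GX f -> normc (graph_ip s f f v) = fibre_sqnorm f v.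
Proof.
by move=> fX; rewrite graph_ip_diag// normc_real ger0_norm// fibre_sqnorm_ge0.
Qed.

Lemma fibre_norm_le f v : GX f -> Num.sqrt (fibre_sqnorm f v) <= graph_norm f.
Proof.
move=> fX; rewrite ler_wsqrtr// -normc_graph_ip_diag//.
exact: (supnorm_ub v (graph_ip_C0 fX fX)).
Qed.

Lemma graph_norm_le f (M : R) : GX f -> 0 <= M ->
  (forall v, Num.sqrt (fibre_sqnorm f v) <= M) -> graph_norm f <= M.
Proof.
move=> fX M0 fM; rewrite -[M]ger0_norm// -sqrtr_sqr ler_wsqrtr//.
apply: (@supnorm_le _ _ (graph_ip s f f)) => [|v]; first exact: sqr_ge0.
rewrite normc_graph_ip_diag// -[leLHS]sqr_sqrtr ?fibre_sqnorm_ge0//.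
by rewrite lerXn2r ?nnegrE ?sqrtr_ge0.
Qed.

Lemma graph_norm_ge0 f : 0 <= graph_norm f. Proof. exact: sqrtr_ge0. Qed.

Lemma normc_le_graph_norm f x : GX f -> normc (f x) <= graph_norm f.
Proof.
move=> fX; apply: le_trans (fibre_norm_le (s x) fX).
rewrite -[leLHS]ger0_norm ?normc_ge0// -sqrtr_sqr ler_wsqrtr//.
by have := has_sum_ge1 (fun _ _ => sqr_ge0 _) (fibre_sqnormP (s x) fX) (erefl (s x)).
Qed.

Lemma graph_normD f g : GX f -> GX g ->
  graph_norm (fun x => f x + g x) <= graph_norm f + graph_norm g.
Proof.
move=> fX gX; apply: graph_norm_le => [||v]; first exact: graph_moduleD.
  by rewrite addr_ge0 ?graph_norm_ge0.
rewrite (le_trans (l2_triangle (fibre_sqnormP v fX) (fibre_sqnormP v gX) _))//.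
  exact: (fibre_sqnormP v (graph_moduleD fX gX)).
by rewrite lerD ?fibre_norm_le.
Qed.

Lemma graph_norm_mul_le h f (M : R) : GX f -> GX (fun x => h x * f x) -> 0 <= M ->
  (forall x, normc (h x) <= M) -> graph_norm (fun x => h x * f x) <= M * graph_norm f.
Proof.
move=> fX hfX M0 hM; apply: graph_norm_le => [//||v]; first by rewrite mulr_ge0 ?graph_norm_ge0.
rewrite (@le_trans _ _ (M * Num.sqrt (fibre_sqnorm f v)))//; last first.
  by rewrite ler_wpM2l ?fibre_norm_le.
rewrite -[X in X * _]ger0_norm// -sqrtr_sqr -sqrtrM ?sqr_ge0// ler_wsqrtr//.
have := has_sum_sq_comb (fibre_sqnormP v fX) (fibre_sqnormP v fX) (M ^+ 2) 0.
rewrite mul0r addr0; apply: has_sum_le (fibre_sqnormP v hfX) => x _.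
rewrite mul0r addr0 normcM exprMn ler_wpM2r ?sqr_ge0//.
by rewrite lerXn2r ?nnegrE ?normc_ge0.
Qed.

Lemma graph_Cauchy_Schwarz f g : GX f -> GX g ->
  supnorm (graph_ip s f g) <= graph_norm f * graph_norm g.
Proof.
move=> fX gX; apply: supnorm_le => [|v]; first by rewrite mulr_ge0 ?graph_norm_ge0.
have fg := graph_ip_sum v fX gX.
rewrite (le_trans (l2_Cauchy_Schwarz (fibre_sqnormP v fX) (fibre_sqnormP v gX) fg))//.
by rewrite ler_pM ?sqrtr_ge0 ?fibre_norm_le.
Qed.

Lemma graph_moduleB f g : GX f -> GX g -> GX (fun x => f x - g x).
Proof.
move=> fX gX; have := graph_moduleD fX (graph_moduleZ (-1) gX).
by congr GX; apply/funext => x; rewrite mulN1r.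
Qed.

(** The limit l is first taken uniformly on E1. In the l^2 space of each fibre
    the triangle inequality shows that the norms of the u_n converge to the
    norm of l, uniformly in the fibre; therefore the norm of l is continuous
    and vanishes at infinity. *)
Lemma graph_norm_complete : norm_complete (fun f : X => graph_norm f).
Proof.
move=> u uX uc.
have {}uX n : GX (u n) := uX n.
have subE (f g : X) : vsub f g = fun x => f x - g x.
  by rewrite /vsub /=; apply/funext => x; rewrite mulN1r.
have {}uc (e : R) : 0 < e -> exists N : nat, forall m n : nat, (N <= m)%N -> (N <= n)%N ->
    graph_norm (fun x => u m x - u n x) < e.
  by move=> /uc[N uN]; exists N => m n Nm Nn; rewrite -subE uN.
have [|l ul] := @uniform_cauchy_limit R E1 u.
  move=> e /uc[N uN]; exists N => m n Nm Nn x.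
  by apply: le_lt_trans (uN m n Nm Nn); exact: (normc_le_graph_norm x (graph_moduleB (uX m) (uX n))).
(* As in the lemma of Fatou, bounds on finite sums pass to the limit in m. *)
have ulsum (e : R) : 0 < e -> exists N : nat, forall n, (N <= n)%N -> forall v,
    exists2 D : R, 0 <= D <= e ^+ 2 &
      has_sum (fib v) (fun x => (normc (u n x - l x) ^+ 2)%:C) D%:C.
  move=> e0; have [N uN] := uc e e0; exists N => n Nn v.
  apply: has_sum_bounded => [x _|B Bv]; first by rewrite sqr_ge0.
  have : (fun m => \sum_(x <- B) normc (u n x - u m x) ^+ 2 : R^o) @ \oo -->
      (\sum_(x <- B) normc (u n x - l x) ^+ 2 : R^o).
    apply: cvg_big_seq => x _.
    have cvx : (fun m => normc (u n x - u m x)) @ \oo --> normc (u n x - l x).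
      apply/cvgrPdistC_lt => d d0; apply: filterS (ul x d d0) => m.
      apply: le_lt_trans; rewrite (le_trans (dist_normc_le _ _))// normc_distC.
      by rewrite le_eqVlt; apply/orP; left; apply/eqP; congr normc; ring.
    exact: (cvgM cvx cvx).
  move=> cvB; apply: (closed_cvg _ (@closed_le R (e ^+ 2)) _ _ cvB) => //.
  exists N => // m Nm; have sX := graph_moduleB (uX n) (uX m); rewrite /mkset.
  rewrite (le_trans (has_sum_ge (fun _ _ => sqr_ge0 _) (fibre_sqnormP v sX) Bv))//.
  rewrite -[leLHS]sqr_sqrtr ?fibre_sqnorm_ge0// lerXn2r ?nnegrE ?sqrtr_ge0 ?ltW//.
  by rewrite (le_lt_trans (fibre_norm_le v sX))// uN.
have ul_le (e : R) : 0 < e -> exists N : nat, forall n, (N <= n)%N -> forall x,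
    normc (u n x - l x) <= e.
  move=> e0; have [N uN] := ulsum e e0; exists N => n Nn x.
  have [D /andP[D0 De] uD] := uN n Nn (s x).
  have := has_sum_ge1 (fun _ _ => sqr_ge0 _) uD (erefl (s x)).
  move=> h; have := le_trans h De.
  by rewrite ler_pXn2r ?nnegrE ?normc_ge0 ?(ltW e0).
have l0 : C0 R E1 l.
  apply: C0_uniform_limit => e /ul_le[N uN]; exists (u N); first exact: graph_module_C0.
  by move=> x; rewrite normc_distC uN.
have /choice[F lF] : forall v, exists F : R, has_sum (fib v) (fun x => (normc (l x) ^+ 2)%:C) F%:C.
  move=> v; have [N uN] := ulsum 1 ltr01; have [D _ uD] := uN N (leqnn N) v.
  have [F _ lF] := square_summableD uD (fibre_sqnormP v (uX N)).
  have [G _ lG] := square_summableD (has_sum_sqN uD) (fibre_sqnormP v (uX N)).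
  by exists G; apply: eq_has_sum lG => x _; congr (_%:C); congr (normc _ ^+ 2); ring.
have F0 v : 0 <= F v by exact: has_sum_sq_ge0 (lF v).
have sqrtF0 : C0 R E0 (fun v => (Num.sqrt (F v))%:C).
  apply: C0_uniform_limit => e e0; have [N uN] := ulsum e e0.
  exists (fun v => (Num.sqrt (fibre_sqnorm (u N) v))%:C).
    by apply: C0_sqrt (fibre_sqnorm_C0 (uX N)) => v; exact: fibre_sqnorm_ge0.
  move=> v; have [D /andP[D0 De] uD] := uN N (leqnn N) v.
  have {}De : Num.sqrt D <= e by rewrite -[e]gtr0_norm// -sqrtr_sqr ler_wsqrtr.
  rewrite -rmorphB normc_real ler_norml.
  have := l2_triangle (has_sum_sqN uD) (fibre_sqnormP v (uX N)) (U := F v).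
  have := l2_triangle uD (lF v) (U := fibre_sqnorm (u N) v).
  have h1 : has_sum (fib v) (fun x => (normc (u N x - l x + l x) ^+ 2)%:C) (fibre_sqnorm (u N) v)%:C.
    by apply: eq_has_sum (fibre_sqnormP v (uX N)) => x _; rewrite subrK.
  have h2 : has_sum (fib v) (fun x => (normc (- (u N x - l x) + u N x) ^+ 2)%:C) (F v)%:C.
    by apply: eq_has_sum (lF v) => x _; rewrite opprB subrK.
  by move=> /(_ h1) + /(_ h2); lra.
have lX : GX l.
  apply: (graph_module_intro l0 lF); have := C0M sqrtF0 sqrtF0.
  by congr C0; apply/funext => v; rewrite -rmorphM -expr2 sqr_sqrtr.
exists l => //; apply/cvgrPdistC_le => e e0; have [N uN] := ulsum e e0.
exists N => // n Nn; rewrite subr0 ger0_norm ?graph_norm_ge0// subE.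
have sX := graph_moduleB (uX n) lX.
apply: graph_norm_le => [//||v]; first exact: ltW.
have [D /andP[D0 De] uD] := uN n Nn v.
have [->] := has_sum_unique (fibre_sqnormP v sX) uD.
by rewrite -[e]gtr0_norm// -sqrtr_sqr ler_wsqrtr.
Qed.

Lemma graph_bimodule_hilbert : is_right_hilbert_bimodule X.
Proof.
split=> /=.
- by apply: is_lspace_fun_space; [exact: graph_module0 | exact: graph_moduleD | exact: graph_moduleZ].
- by move=> f a fX aA; exact: graph_module_ract.
- by move=> *; apply/funext => x; rewrite mulrDl.
- by move=> *; apply/funext => x; rewrite mulrDr.
- by move=> *; apply/funext => x; rewrite mulrA.
- by move=> *; apply/funext => x; rewrite mulrCA.
- by move=> *; apply/funext => x; rewrite mulrA.
- exact: graph_ip_C0.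
- move=> f g h fX gX hX; apply/funext => v; apply: graph_ipE.
  apply: eq_has_sum (has_sumD (graph_ip_sum v fX gX) (graph_ip_sum v fX hX)) => x _.
  by rewrite mulrDr.
- move=> t f g fX gX; apply/funext => v; apply: graph_ipE.
  by apply: eq_has_sum (has_sumZ t (graph_ip_sum v fX gX)) => x _; rewrite mulrCA.
- move=> f g a fX gX aA; apply/funext => v; apply: graph_ipE; rewrite mulrC.
  apply: eq_has_sum (has_sumZ (a v) (graph_ip_sum v fX gX)) => x <-.
  by rewrite mulrC mulrA.
- move=> f g fX gX; apply/funext => v; symmetry; apply: graph_ipE.
  apply: eq_has_sum (has_sum_conj (graph_ip_sum v fX gX)) => x _.
  by rewrite rmorphM /= conjcK mulrC.
- move=> f fX; exists (fun v => (Num.sqrt (fibre_sqnorm f v))%:C).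
    by apply: C0_sqrt (fibre_sqnorm_C0 fX) => v; exact: fibre_sqnorm_ge0.
  apply/funext => v; rewrite graph_ip_diag// conjc_real -rmorphM -expr2.
  by rewrite sqr_sqrtr ?fibre_sqnorm_ge0.
- move=> f fX f0; apply/funext => x; apply/eq0_normc/eqP; rewrite eq_le normc_ge0 andbT.
  apply: le_trans (normc_le_graph_norm x fX) _; rewrite -(@sqrtr0 R) ler_wsqrtr//=.
  rewrite -[X in _ <= X]/(0 : R) f0; apply: (@supnorm_le _ _ (fun=> 0)) => // v.
  by rewrite normc0.
- exact: graph_norm_complete.
- by move=> a f aA fX; exact: graph_module_lact.
- by move=> *; apply/funext => x; rewrite mulrDl.
- by move=> *; apply/funext => x; rewrite mulrA.
- by move=> *; apply/funext => x; rewrite mulrA.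
- move=> a f g aA fX gX; apply/funext => v; apply: graph_ipE.
  apply: eq_has_sum (graph_ip_sum v fX (graph_module_lact (C0_conj aA) gX)) => x _.
  by rewrite rmorphM /= mulrCA mulrA.
Qed.

Lemma graph_norm_lact a f : C0 R E0 a -> GX f ->
  graph_norm (fun x => a (r x) * f x) <= supnorm a * graph_norm f.
Proof.
move=> aA fX; apply: graph_norm_mul_le => // [||x].
- exact: graph_module_lact.
- exact: supnorm_ge0.
- exact: supnorm_ub.
Qed.

Lemma graph_norm_ract a f : C0 R E0 a -> GX f ->
  graph_norm (fun x => f x * a (s x)) <= supnorm a * graph_norm f.
Proof.
move=> aA fX.
have fE : (fun x => f x * a (s x)) = fun x => a (s x) * f x.
  by apply/funext => x; rewrite mulrC.
rewrite fE; apply: graph_norm_mul_le => // [||x].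
- by rewrite -fE; exact: graph_module_ract.
- exact: supnorm_ge0.
- exact: supnorm_ub.
Qed.

End graph_bimodules.

(** * Convergence in normed spaces *)

Section normed_lspace.
Variables (R : realType) (V : lspace R) (N : V -> R).
Hypothesis hV : is_lspace V.
Local Notation vopp := (vscale (-1)).

Record is_norm : Prop := IsNorm {
  norm_ge0 : forall x, vcar V x -> 0 <= N x;
  norm_eq0 : forall x, vcar V x -> N x = 0 -> x = vzero;
  normD : forall x y, vcar V x -> vcar V y -> N (vadd x y) <= N x + N y;
  normZ : forall t x, vcar V x -> N (vscale t x) = normc t * N x }.

Implicit Types x y z : V.

Lemma vopp_in x : vcar V x -> vcar V (vopp x). Proof. exact: vscale_in. Qed.

Lemma vsub_in x y : vcar V x -> vcar V y -> vcar V (vsub x y).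
Proof. by move=> xV yV; apply: vadd_in => //; exact: vopp_in. Qed.

Lemma vscale0 x : vcar V x -> vscale 0 x = vzero.
Proof. by move=> xV; rewrite -(addrN 1) vscaleDl// vscale1// vaddN. Qed.

Lemma vaddr0 x : vcar V x -> vadd x vzero = x.
Proof. by move=> xV; rewrite vaddC ?vadd0//; exact: vzero_in. Qed.

Lemma vaddNl x : vcar V x -> vadd (vopp x) x = vzero.
Proof. by move=> xV; rewrite vaddC ?vaddN//; exact: vopp_in. Qed.

Lemma vaddACA x y z w : vcar V x -> vcar V y -> vcar V z -> vcar V w ->
  vadd (vadd x y) (vadd z w) = vadd (vadd x z) (vadd y w).
Proof.
move=> xV yV zV wV; have H := vadd_in hV.
rewrite -(vaddA hV)// ?(vaddA hV yV)// ?(vaddC hV yV zV) -?(vaddA hV zV)//; try exact: H.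
by rewrite (vaddA hV)//; exact: H.
Qed.

Lemma vsubrr x : vcar V x -> vsub x x = vzero. Proof. exact: vaddN. Qed.

Lemma vsub0_eq x y : vcar V x -> vcar V y -> vsub x y = vzero -> x = y.
Proof.
move=> xV yV xy; rewrite -[LHS](vaddr0 xV) -(vaddNl yV) (vaddA hV)//; last exact: vopp_in.
by rewrite -/(vsub x y) xy vadd0.
Qed.

Lemma vsub_trans x y z : vcar V x -> vcar V y -> vcar V z ->
  vsub x z = vadd (vsub x y) (vsub y z).
Proof.
move=> xV yV zV; have yN := vopp_in yV; have zN := vopp_in zV.
rewrite /vsub -(vaddA hV)//; last exact: vadd_in.
by rewrite (vaddA hV yN)// vaddNl// vadd0.
Qed.

Lemma vsubD x x' y y' : vcar V x -> vcar V x' -> vcar V y -> vcar V y' ->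
  vsub (vadd x x') (vadd y y') = vadd (vsub x y) (vsub x' y').
Proof.
by move=> xV xV' yV yV'; rewrite /vsub (vscaleDr hV)// vaddACA//; exact: vopp_in.
Qed.

Lemma vsubZ t x y : vcar V x -> vcar V y ->
  vsub (vscale t x) (vscale t y) = vscale t (vsub x y).
Proof.
move=> xV yV; rewrite /vsub (vscaleDr hV)//; last exact: vopp_in.
by rewrite !(vscaleA hV)// mulrC.
Qed.

Lemma voppB x y : vcar V x -> vcar V y -> vopp (vsub x y) = vsub y x.
Proof.
move=> xV yV; rewrite /vsub (vscaleDr hV)//; last exact: vopp_in.
rewrite (vscaleA hV)// mulrNN mulr1 (vscale1 hV)// (vaddC hV)//; exact: vopp_in.
Qed.

Hypothesis hN : is_norm.

Lemma normc_opp1 : normc (-1 : R[i]) = 1.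
Proof. by rewrite (normcN 1) normc1. Qed.

Lemma dist_sym x y : vcar V x -> vcar V y -> N (vsub x y) = N (vsub y x).
Proof.
move=> xV yV; rewrite -voppB// normZ ?normc_opp1 ?mul1r//; exact: vsub_in.
Qed.

Lemma dist_triangle x y z : vcar V x -> vcar V y -> vcar V z ->
  N (vsub x z) <= N (vsub x y) + N (vsub y z).
Proof.
move=> xV yV zV; rewrite (vsub_trans xV yV zV) normD//; exact: vsub_in.
Qed.

Lemma norm0 : N vzero = 0.
Proof.
have z0 := vzero_in hV; by rewrite -(vscale0 z0) normZ// normc0 mul0r.
Qed.

Definition norm_cvg (u : nat -> V) (l : V) : Prop :=
  forall e : R, 0 < e -> exists n0 : nat, forall n, (n0 <= n)%N -> N (vsub (u n) l) < e.

Lemma norm_cvg_cst x : vcar V x -> norm_cvg (fun=> x) x.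
Proof. by move=> xV e e0; exists 0 => n _; rewrite vsubrr// norm0. Qed.

Lemma norm_cvg_unique u l l' : (forall n, vcar V (u n)) -> vcar V l -> vcar V l' ->
  norm_cvg u l -> norm_cvg u l' -> l = l'.
Proof.
move=> uV lV lV' ul ul'; apply: vsub0_eq => //; apply: (norm_eq0 hN); first exact: vsub_in.
apply/eqP; rewrite eq_le (norm_ge0 hN) ?andbT; last exact: vsub_in.
apply/ler_addgt0Pr => e e0; rewrite add0r; have e2 : 0 < e / 2 by rewrite divr_gt0.
have [n0 n0P] := ul _ e2; have [n1 n1P] := ul' _ e2; pose n := maxn n0 n1.
rewrite (le_trans (dist_triangle lV (uV n) lV'))// [e]splitr lerD//.
  by rewrite dist_sym// ltW// n0P// leq_maxl.
by rewrite ltW// n1P// leq_maxr.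
Qed.

Lemma norm_cvgP u l : (forall n, vcar V (u n)) -> vcar V l ->
  norm_cvg u l <-> (fun n => N (vsub (u n) l)) @ \oo --> (0 : R).
Proof.
move=> uV lV; split=> [ul|/cvgrPdistC_lt ul e /ul[n0 _ n0P]].
  apply/cvgrPdistC_lt => e /ul[n0 n0P]; exists n0 => // n /= /n0P.
  by rewrite subr0 ger0_norm// (norm_ge0 hN)//; exact: vsub_in.
by exists n0 => n /n0P /=; rewrite subr0; apply: le_lt_trans; rewrite ler_norm.
Qed.

Lemma norm_cvg_cauchy u l : (forall n, vcar V (u n)) -> vcar V l -> norm_cvg u l ->
  forall e : R, 0 < e -> exists n0 : nat, forall m n,
    (n0 <= m)%N -> (n0 <= n)%N -> N (vsub (u m) (u n)) < e.
Proof.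
move=> uV lV ul e e0; have e2 : 0 < e / 2 by rewrite divr_gt0.
have [n0 n0P] := ul _ e2; exists n0 => m n mP nP.
rewrite (le_lt_trans (dist_triangle (uV m) lV (uV n)))// [e]splitr ltrD ?n0P//.
by rewrite dist_sym// n0P.
Qed.

Lemma norm_cvg_dist u u' l : (forall n, vcar V (u n)) -> (forall n, vcar V (u' n)) ->
  vcar V l -> norm_cvg u l ->
  (norm_cvg u' l <-> (fun n => N (vsub (u n) (u' n))) @ \oo --> (0 : R)).
Proof.
move=> uV uV' lV ul; split=> [ul'|/cvgrPdistC_lt uu' e e0].
  apply/cvgrPdistC_lt => e e0; have e2 : 0 < e / 2 by rewrite divr_gt0.
  have [n0 n0P] := ul _ e2; have [n1 n1P] := ul' _ e2.
  exists (maxn n0 n1) => // n; rewrite /mkset geq_max => /andP[nn0 nn1].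
  rewrite subr0 ger0_norm ?(norm_ge0 hN)//; last exact: vsub_in.
  rewrite (le_lt_trans (dist_triangle (uV n) lV (uV' n)))// [e]splitr ltrD ?n0P//.
  by rewrite dist_sym// n1P.
have e2 : 0 < e / 2 by rewrite divr_gt0.
have [n0 n0P] := ul _ e2; have [n1 _ n1P] := uu' _ e2.
exists (maxn n0 n1) => // n; rewrite geq_max => /andP[nn0 nn1].
rewrite (le_lt_trans (dist_triangle (uV' n) (uV n) lV))// [e]splitr ltrD ?n0P//.
by rewrite dist_sym//; have := n1P n nn1; rewrite /= subr0; apply: le_lt_trans; rewrite ler_norm.
Qed.

End normed_lspace.

(** * Recognizing a balanced tensor product *)

(** What limits in a Hilbert bimodule need from its norm. For bimodules of
    functions these facts are inequalities between sums, which avoids deriving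
    them from the order of an abstract C*-algebra. *)
Record normed_bimodule (R : realType) (A : star_algebra R) (Z : bimodule A) : Prop :=
  NormedBimodule {
  nb_norm : is_norm (@mnorm R A Z);
  nb_Cauchy_Schwarz : forall x y, vcar Z x -> vcar Z y ->
    anorm (ip x y) <= mnorm x * mnorm y;
  nb_lact : forall a x, vcar A a -> vcar Z x -> mnorm (lact a x) <= anorm a * mnorm x;
  nb_lactB : forall a x y, vcar A a -> vcar Z x -> vcar Z y ->
    lact a (vsub x y) = vsub (lact a x) (lact a y);
  nb_lactD : forall a x y, vcar A a -> vcar Z x -> vcar Z y ->
    lact a (vadd x y) = vadd (lact a x) (lact a y);
  nb_ract : forall x a, vcar A a -> vcar Z x -> mnorm (ract x a) <= anorm a * mnorm x }.

Section tensor_iso.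
Variables (R : realType) (A : star_algebra R) (X Y Z : bimodule A).
Variable mul : X -> Y -> Z.
Hypotheses (hA : is_cstar_algebra A) (hX : is_right_hilbert_bimodule X)
  (hY : is_right_hilbert_bimodule Y) (hZ : is_right_hilbert_bimodule Z).
Hypothesis nZ : normed_bimodule Z.
Hypothesis mul_in : forall x y, vcar X x -> vcar Y y -> vcar Z (mul x y).
Hypothesis mulZ : forall t x y, vcar X x -> vcar Y y ->
  mul (vscale t x) y = vscale t (mul x y).
Hypothesis mul_lact : forall a x y, vcar A a -> vcar X x -> vcar Y y ->
  mul (lact a x) y = lact a (mul x y).
Hypothesis mul_ract : forall x y a, vcar X x -> vcar Y y -> vcar A a ->
  mul x (ract y a) = ract (mul x y) a.
Hypothesis mul_ip : forall x y x' y', vcar X x -> vcar Y y -> vcar X x' -> vcar Y y' ->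
  ip (mul x y) (mul x' y') = ip y (lact (ip x x') y').

Definition mul_sum (s : tsum X Y) : Z := \big[vadd/vzero]_(p <- s) mul p.1 p.2.

Hypothesis mul_dense : forall z (e : R), vcar Z z -> 0 < e ->
  exists2 s, tsum_in s & mnorm (vsub (mul_sum s) z) < e.

Let VA := cs_lspace hA.
Let VZ := hb_lspace hZ.
Let NZ := nb_norm nZ.
Let NA : is_norm (@anorm R A).
Proof.
by split; [exact: cs_norm_ge0 | exact: cs_norm_eq0 | exact: cs_normD | exact: cs_normZ].
Qed.

Lemma tsum_in_cons (p : X * Y) s : tsum_in (p :: s) <->
  [/\ vcar X p.1, vcar Y p.2 & tsum_in s].
Proof.
rewrite /tsum_in /=; split=> [/andP[/andP[/set_mem ? /set_mem ?] ?]//|[/mem_set -> /mem_set -> ->]//].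
Qed.

Lemma tsum_in_cat (s s' : tsum X Y) : tsum_in s -> tsum_in s' -> tsum_in (s ++ s').
Proof. by rewrite /tsum_in all_cat => -> ->. Qed.

Lemma tsum_in_map (f : X * Y -> X * Y) (s : tsum X Y) :
  (forall p, vcar X p.1 -> vcar Y p.2 -> vcar X (f p).1 /\ vcar Y (f p).2) ->
  tsum_in s -> tsum_in (map f s).
Proof.
move=> fP; elim: s => [//|p s IHs] /tsum_in_cons[p1 p2 sP].
by apply/tsum_in_cons; have [? ?] := fP _ p1 p2; split => //; exact: IHs.
Qed.

Lemma mul_sum_cons p s : mul_sum (p :: s) = vadd (mul p.1 p.2) (mul_sum s).
Proof. by rewrite /mul_sum big_cons. Qed.

Lemma mul_sum_in s : tsum_in s -> vcar Z (mul_sum s).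
Proof.
elim: s => [_|p s IHs /tsum_in_cons[p1 p2 sP]].
  by rewrite /mul_sum big_nil; exact: vzero_in.
by rewrite mul_sum_cons; apply: vadd_in => //; [exact: mul_in | exact: IHs].
Qed.

Lemma mul_sum_cat s s' : tsum_in s -> tsum_in s' ->
  mul_sum (s ++ s') = vadd (mul_sum s) (mul_sum s').
Proof.
move=> sP sP'; elim: s sP => [_|p s IHs /tsum_in_cons[p1 p2 sP]].
  by rewrite /= [mul_sum [::]]big_nil vadd0//; exact: mul_sum_in.
rewrite cat_cons !mul_sum_cons IHs// (vaddA VZ)//; first exact: mul_in.
  exact: mul_sum_in.
exact: mul_sum_in.
Qed.

Lemma mul_sum_map (f : X * Y -> X * Y) (F : Z -> Z) s :
  F vzero = vzero ->
  (forall x y, vcar Z x -> vcar Z y -> F (vadd x y) = vadd (F x) (F y)) ->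
  (forall p, vcar X p.1 -> vcar Y p.2 -> mul (f p).1 (f p).2 = F (mul p.1 p.2)) ->
  tsum_in s -> mul_sum (map f s) = F (mul_sum s).
Proof.
move=> F0 FD Fm; elim: s => [_|p s IHs /tsum_in_cons[p1 p2 sP]].
  by rewrite /= /mul_sum !big_nil F0.
rewrite /= !mul_sum_cons Fm// IHs// FD//; [exact: mul_in | exact: mul_sum_in].
Qed.

Let ip0r x : vcar Z x -> ip x vzero = vzero.
Proof.
move=> xZ; have z0 := vzero_in VZ.
by rewrite -{1}(vscale0 VZ z0) hb_ipZ// (vscale0 VA)//; exact: hb_ip_in.
Qed.

Let ip0l x : vcar Z x -> ip vzero x = vzero.
Proof.
move=> xZ; have z0 := vzero_in VZ; have a0 := vzero_in VA.
rewrite -(hb_ip_star hZ)// ip0r// -[X in astar X](vscale0 VA a0) cs_starZ//.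
by rewrite rmorph0 (vscale0 VA)//; exact: cs_star_in.
Qed.

Let ipDl x y z : vcar Z x -> vcar Z y -> vcar Z z ->
  ip (vadd x y) z = vadd (ip x z) (ip y z).
Proof.
move=> xZ yZ zZ; have xyZ := vadd_in VZ xZ yZ.
rewrite -(hb_ip_star hZ)// hb_ipD// cs_starD//; try exact: (hb_ip_in hZ).
by rewrite !(hb_ip_star hZ).
Qed.

Let ipNl x z : vcar Z x -> vcar Z z -> ip (vscale (-1) x) z = vscale (-1) (ip x z).
Proof.
move=> xZ zZ; have xN := vopp_in VZ xZ.
rewrite -(hb_ip_star hZ)// hb_ipZ// cs_starZ//; last exact: (hb_ip_in hZ).
by rewrite rmorphN1 (hb_ip_star hZ).
Qed.

Let ipBl x y z : vcar Z x -> vcar Z y -> vcar Z z ->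
  ip (vsub x y) z = vsub (ip x z) (ip y z).
Proof. by move=> xZ yZ zZ; rewrite ipDl ?ipNl//; exact: vopp_in. Qed.

Let ipBr x y z : vcar Z x -> vcar Z y -> vcar Z z ->
  ip z (vsub x y) = vsub (ip z x) (ip z y).
Proof. by move=> xZ yZ zZ; rewrite hb_ipD ?hb_ipZ//; exact: vopp_in. Qed.

(** The semi-inner product of finite sums of elementary tensors is pulled back
    from Z, so that the map from X (x) Y to Z is isometric. *)
Lemma tpairE s s' : tsum_in s -> tsum_in s' ->
  tpair s s' = ip (mul_sum s) (mul_sum s').
Proof.
move=> sP sP'; elim: s sP => [_|p s IHs /tsum_in_cons[p1 p2 sP]].
  by rewrite /tpair /mul_sum !big_nil ip0l//; exact: mul_sum_in.
have pZ := mul_in p1 p2; have sZ := mul_sum_in sP; have sZ' := mul_sum_in sP'.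
rewrite /tpair big_cons -/(tpair s s') IHs// mul_sum_cons ipDl//.
congr vadd; elim: s' sP' {IHs sZ'} => [_|q s' IHs' /tsum_in_cons[q1 q2 sP']].
  by rewrite /mul_sum !big_nil ip0r.
have qZ := mul_in q1 q2; have sZ' := mul_sum_in sP'.
rewrite big_cons IHs'// mul_sum_cons hb_ipD//.
by rewrite mul_ip.
Qed.

Lemma tscale_in t (s : tsum X Y) : tsum_in s -> tsum_in (tscale t s).
Proof. by apply: tsum_in_map => p p1 p2; split => //; exact: (vscale_in (hb_lspace hX)). Qed.

Lemma mul_sum_tscale t s : tsum_in s -> mul_sum (tscale t s) = vscale t (mul_sum s).
Proof.
apply: (mul_sum_map (F := vscale t)) => [|x y xZ yZ|p p1 p2].
- have z0 := vzero_in VZ; rewrite -[X in vscale t X](vscale0 VZ z0) (vscaleA VZ)//.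
  by rewrite mulr0 (vscale0 VZ).
- exact: vscaleDr.
- exact: mulZ.
Qed.

Lemma tdistE s s' : tsum_in s -> tsum_in s' ->
  tdist s s' = mnorm (vsub (mul_sum s) (mul_sum s')).
Proof.
move=> sP sP'; have sN := tscale_in (-1) sP'.
by rewrite /tdist tpairE ?mul_sum_cat ?mul_sum_tscale//; exact: tsum_in_cat.
Qed.

Implicit Types (z : Z) (c : tensor X Y) (w : nat -> tsum X Y).

Let mcvg := norm_cvg (@mnorm R A Z).
Let sum_in w (wP : forall n, tsum_in (w n)) n : vcar Z (mul_sum (w n)) := mul_sum_in (wP n).

(** The inverse of the isomorphism: as mul_sum is isometric, a class of the
    completed tensor product consists of the sequences of finite sums whose
    products converge to one z. *)
Definition sum_class z : tensor X Y :=
  [set w | (forall n, tsum_in (w n)) /\ mcvg (fun n => mul_sum (w n)) z].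

Lemma tcauchy_sum_class w z : vcar Z z -> sum_class z w -> tcauchy w.
Proof.
move=> zZ [wP wz]; split => // e e0.
have [n0 n0P] := norm_cvg_cauchy VZ NZ (sum_in wP) zZ wz e0.
by exists n0 => m n mP nP; rewrite tdistE// n0P.
Qed.

Lemma tclass_sum_class w z : vcar Z z -> sum_class z w -> tclass w = sum_class z.
Proof.
move=> zZ [wP wz]; apply/seteqP; split=> [w' [[wP' _] ww']|w' w'z].
  split=> //; apply/(norm_cvg_dist VZ NZ (sum_in wP) (sum_in wP') zZ wz).
  by under eq_fun do rewrite -tdistE//.
have [wP' wz'] := w'z; split; first exact: tcauchy_sum_class w'z.
under eq_fun do rewrite tdistE//.
exact/(norm_cvg_dist VZ NZ (sum_in wP) (sum_in wP') zZ wz).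
Qed.

Lemma tcauchy_cvg w : tcauchy w -> exists2 z, vcar Z z & sum_class z w.
Proof.
move=> [wP wc]; have [|z zZ wz] := hb_complete hZ (sum_in wP).
  by move=> e /wc[n0 n0P]; exists n0 => m n mP nP; rewrite -tdistE// n0P.
exists z => //; split => //; apply/norm_cvgP => //; exact: sum_in.
Qed.

(** The only use of density: every z is reached by some sequence. *)
Lemma sum_class_nonempty z : vcar Z z -> sum_class z !=set0.
Proof.
move=> zZ; have /choice[w wP] : forall n : nat, exists s : tsum X Y, tsum_in s /\
    mnorm (vsub (mul_sum s) z) < n.+1%:R^-1.
  move=> n; have n0 : (0 : R) < n.+1%:R^-1 by rewrite invr_gt0 ltr0Sn.
  by have [s sP sz] := mul_dense zZ n0; exists s.
exists w; split=> [n|e e0]; first by have [] := wP n.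
have /cvgrPdistC_lt/(_ e e0)[n0 _ n0P] := @cvg_harmonic R.
exists n0 => n nn0; have [_ /lt_trans] := wP n; apply.
by have := n0P n nn0; rewrite /= subr0 ger0_norm// invr_ge0.
Qed.

Lemma trep_sum_class z : vcar Z z -> sum_class z (trep (sum_class z)).
Proof.
move=> /sum_class_nonempty z0; rewrite /trep /pick_in; case: pselect => // h.
by case: (cid h).
Qed.

Lemma tensorP c : vcar (tensor X Y) c <-> exists2 z, vcar Z z & c = sum_class z.
Proof.
split=> [[w /tcauchy_cvg[z zZ wz] ->]|[z zZ ->]].
  by exists z => //; exact: tclass_sum_class.
have [w wz] := sum_class_nonempty zZ; exists w; first exact: tcauchy_sum_class wz.
by rewrite (tclass_sum_class zZ wz).
Qed.

Lemma sum_class_inj z z' : vcar Z z -> vcar Z z' -> sum_class z = sum_class z' -> z = z'.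
Proof.
move=> zZ zZ' zz'; have [w wz] := sum_class_nonempty zZ.
have [wP wz1] := wz; have [_ wz2] : sum_class z' w by rewrite -zz'.
exact: (norm_cvg_unique VZ NZ (sum_in wP) zZ zZ' wz1 wz2).
Qed.

Definition tensor_map c : Z := pick_in vzero [set z | vcar Z z /\ c = sum_class z].

Lemma tensor_map_class z : vcar Z z -> tensor_map (sum_class z) = z.
Proof.
move=> zZ; rewrite /tensor_map /pick_in; case: pselect => [h|[]]; last by exists z.
by case: (cid h) => z' /= [zZ' /sum_class_inj ->].
Qed.

Lemma tclass_map (z' : Z) (w : nat -> tsum X Y) : vcar Z z' ->
  (forall n, tsum_in (w n)) -> mcvg (fun n => mul_sum (w n)) z' ->
  tensor_map (tclass w) = z'.
Proof. by move=> zZ' wP wz'; rewrite (@tclass_sum_class w z')// tensor_map_class. Qed.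

Lemma mcvg_bounded u (F : Z -> Z) z (M : R) : (forall n, vcar Z (u n)) -> vcar Z z ->
  (forall x y, vcar Z x -> vcar Z y -> mnorm (vsub (F x) (F y)) <= M * mnorm (vsub x y)) ->
  mcvg u z -> mcvg (F \o u) (F z).
Proof.
move=> uZ zZ FM uz e e0; have M1 : 0 < `|M| + 1 by rewrite ltr_wpDl.
have [n0 n0P] := uz _ (divr_gt0 e0 M1); exists n0 => n /n0P.
rewrite ltr_pdivlMr// => ne; apply: le_lt_trans (FM _ _ (uZ n) zZ) _.
apply: le_lt_trans ne; rewrite mulrC ler_wpM2l ?sqrtr_ge0//.
by rewrite (le_trans (ler_norm M))// lerDl.
Qed.

Lemma ip_cvg u u' z z' : (forall n, vcar Z (u n)) -> (forall n, vcar Z (u' n)) ->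
  vcar Z z -> vcar Z z' -> mcvg u z -> mcvg u' z' ->
  norm_cvg (@anorm R A) (fun n => ip (u n) (u' n)) (ip z z').
Proof.
move=> uZ uZ' zZ zZ' uz uz' e e0; have ipZ := hb_ip_in hZ.
pose K := mnorm z + mnorm z' + 1.
have K1 : 1 <= K by rewrite lerDr addr_ge0 ?sqrtr_ge0.
have K0 : 0 < K by exact: lt_le_trans ltr01 K1.
have d0 : 0 < e / (K + K) by rewrite divr_gt0// addr_gt0.
have [n0 n0P] := uz _ d0; have [n1 n1P] := uz' _ d0; have [n2 n2P] := uz' _ ltr01.
exists (maxn n0 (maxn n1 n2)) => n; rewrite !geq_max => /and3P[/n0P un /n1P un' /n2P un1].
have uzZ := vsub_in VZ (uZ n) zZ; have uzZ' := vsub_in VZ (uZ' n) zZ'.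
rewrite (vsub_trans VA (ipZ _ _ (uZ n) (uZ' n)) (ipZ _ _ zZ (uZ' n)) (ipZ _ _ zZ zZ')).
rewrite -ipBl// -ipBr// (le_lt_trans (normD NA (ipZ _ _ uzZ (uZ' n)) (ipZ _ _ zZ uzZ')))//.
have uK : mnorm (u' n) <= K.
  have -> : u' n = vadd (vsub (u' n) z') z'.
    rewrite -(vaddA VZ)//; last exact: vopp_in.
    by rewrite (vaddNl VZ)// (vaddr0 VZ).
  apply: le_trans (normD NZ uzZ' zZ') _.
  have z0 : 0 <= mnorm z by exact: sqrtr_ge0.
  by rewrite /K; move: un1 z0; lra.
have zK : mnorm z <= K by rewrite /K -addrA lerDl addr_ge0 ?sqrtr_ge0.
have -> : e = e / (K + K) * K + K * (e / (K + K)).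
  by rewrite [K * _]mulrC -mulrDr divfK// gt_eqF// addr_gt0.
apply: (@le_lt_trans _ _ (mnorm (vsub (u n) z) * K + K * mnorm (vsub (u' n) z'))).
  rewrite lerD//; first by rewrite (le_trans (nb_Cauchy_Schwarz nZ _ _))// ler_wpM2l ?sqrtr_ge0.
  by rewrite (le_trans (nb_Cauchy_Schwarz nZ _ _))// ler_wpM2r ?sqrtr_ge0.
by rewrite ltrD// ?ltr_pM2r ?ltr_pM2l.
Qed.

Lemma alimE (a : nat -> A) l : (forall n, vcar A (a n)) -> vcar A l ->
  norm_cvg (@anorm R A) a l -> alim a = l.
Proof.
move=> aA lA al; rewrite /alim /pick_in; case: pselect => [h|[]].
  case: (cid h) => l' /= [lA' /(norm_cvgP VA NA aA lA') al'].
  exact: (norm_cvg_unique VA NA aA).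
by exists l; split => //; apply/(norm_cvgP VA NA).
Qed.

Lemma tensor_map_iso : is_bimodule_iso tensor_map.
Proof.
have repP z : vcar Z z -> (forall n, tsum_in (trep (sum_class z) n)) /\
    mcvg (fun n => mul_sum (trep (sum_class z) n)) z by move=> /trep_sum_class.
(* Scalars and the two actions of A act on the representing sequences term by
   term, and on Z by a Lipschitz map F. *)
have termwise (f : X * Y -> X * Y) (F : Z -> Z) (M : R) z : vcar Z z ->
    vcar Z (F z) -> F vzero = vzero ->
    (forall x y, vcar Z x -> vcar Z y -> F (vadd x y) = vadd (F x) (F y)) ->
    (forall x y, vcar Z x -> vcar Z y -> mnorm (vsub (F x) (F y)) <= M * mnorm (vsub x y)) ->
    (forall p, vcar X p.1 -> vcar Y p.2 -> vcar X (f p).1 /\ vcar Y (f p).2) ->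
    (forall p, vcar X p.1 -> vcar Y p.2 -> mul (f p).1 (f p).2 = F (mul p.1 p.2)) ->
    tensor_map (tclass (fun n => map f (trep (sum_class z) n))) = F z.
  move=> zZ FzZ F0 FD FM fP fm; have [wP wz] := repP z zZ; apply: tclass_map => //.
    by move=> n; exact: tsum_in_map.
  under eq_fun do rewrite (mul_sum_map F0 FD fm)//.
  by apply: (mcvg_bounded _ zZ FM wz) => n; exact: mul_sum_in.
split.
- split=> [c /tensorP[z zZ ->]|c c' /set_mem/tensorP[z zZ ->] /set_mem/tensorP[z' zZ' ->]|z zZ].
  + by rewrite tensor_map_class.
  + by rewrite !tensor_map_class// => ->.
  + by exists (sum_class z); [apply/tensorP; exists z | exact: tensor_map_class].
- move=> c c' /tensorP[z zZ ->] /tensorP[z' zZ' ->]; rewrite !tensor_map_class//.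
  have [wP wz] := repP z zZ; have [wP' wz'] := repP z' zZ'.
  apply: tclass_map => [|n|e e0]; [exact: vadd_in | exact: tsum_in_cat |].
  have e2 : 0 < e / 2 by rewrite divr_gt0.
  have [n0 n0P] := wz _ e2; have [n1 n1P] := wz' _ e2.
  exists (maxn n0 n1) => n; rewrite geq_max => /andP[/n0P h /n1P h'].
  have uZ := mul_sum_in (wP n); have uZ' := mul_sum_in (wP' n).
  rewrite mul_sum_cat// (vsubD VZ)// [e]splitr.
  by rewrite (le_lt_trans (normD NZ (vsub_in VZ uZ zZ) (vsub_in VZ uZ' zZ')))// ltrD.
- move=> t c /tensorP[z zZ ->]; rewrite [in RHS]tensor_map_class//.
  apply: (termwise _ (vscale t) (normc t)) => //.
  + exact: vscale_in.
  + have z0 := vzero_in VZ; rewrite -[X in vscale t X](vscale0 VZ z0) (vscaleA VZ)//.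
    by rewrite mulr0 (vscale0 VZ).
  + exact: vscaleDr.
  + move=> x y xZ yZ; rewrite (vsubZ VZ)// (normZ NZ)//; exact: vsub_in.
  + by move=> p p1 p2; split => //; exact: (vscale_in (hb_lspace hX)).
  + by move=> p p1 p2; exact: mulZ.
- move=> a c aA /tensorP[z zZ ->]; rewrite [in RHS]tensor_map_class//.
  apply: (termwise _ (lact a) (anorm a)) => //.
  + exact: hb_lact_in.
  + have z0 := vzero_in VZ; rewrite -{1}(vsubrr VZ z0) (nb_lactB nZ)//.
    by rewrite (vsubrr VZ)//; exact: hb_lact_in.
  + by move=> x y; exact: (nb_lactD nZ).
  + move=> x y xZ yZ; rewrite -(nb_lactB nZ)// (nb_lact nZ)//; exact: vsub_in.
  + by move=> p p1 p2; split => //; exact: (hb_lact_in hX).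
  + by move=> p p1 p2; exact: mul_lact.
- move=> c a /tensorP[z zZ ->] aA; rewrite [in RHS]tensor_map_class//.
  have ractB x y : vcar Z x -> vcar Z y -> ract (vsub x y) a = vsub (ract x a) (ract y a).
    by move=> xZ yZ; rewrite (hb_ractDl hZ) ?(hb_ractZl hZ)//; exact: vopp_in.
  apply: (termwise _ (ract^~ a) (anorm a)) => //.
  + exact: hb_ract_in.
  + have z0 := vzero_in VZ; rewrite -{1}(vsubrr VZ z0) ractB//.
    by rewrite (vsubrr VZ)//; exact: hb_ract_in.
  + by move=> x y xZ yZ; exact: (hb_ractDl hZ).
  + move=> x y xZ yZ; rewrite -ractB// (nb_ract nZ)//; exact: vsub_in.
  + by move=> p p1 p2; split => //; exact: (hb_ract_in hY).
  + by move=> p p1 p2; exact: mul_ract.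
- move=> c c' /tensorP[z zZ ->] /tensorP[z' zZ' ->]; rewrite !tensor_map_class//.
  have [wP wz] := repP z zZ; have [wP' wz'] := repP z' zZ'.
  symmetry; rewrite /ip /=; under eq_fun do rewrite tpairE//.
  apply: alimE; last exact: ip_cvg (sum_in wP) (sum_in wP') zZ zZ' wz wz'.
    by move=> n; apply: (hb_ip_in hZ); exact: mul_sum_in.
  exact: (hb_ip_in hZ).
Qed.

Lemma tensor_map_elementary x y : vcar X x -> vcar Y y ->
  tensor_map (elementary_tensor x y) = mul x y.
Proof.
move=> xX yY; have xyZ := mul_in xX yY; apply: tclass_map => //.
  by move=> n; apply/tsum_in_cons.
rewrite mul_sum_cons /mul_sum big_nil (vaddr0 VZ)//.
exact: (norm_cvg_cst VZ NZ).
Qed.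

End tensor_iso.

(** * Norm estimates in the bimodule of a graph *)

Section graph_bimodule_norm.
Variables (R : realType) (E0 E1 : topologicalType) (s r : E1 -> E0).
Hypotheses (sl : local_homeomorphism s) (rc : continuous r).
Hypothesis hE1 : hausdorff_space E1.
Local Open Scope complex_scope.
Local Notation GX := (@graph_module R E0 E1 s).

Lemma graph_norm_scale c f : GX f -> graph_norm s r (fun x => c * f x) = normc c * graph_norm s r f.
Proof.
move=> fX; rewrite /graph_norm /mnorm /=.
have -> : graph_ip s (fun x => c * f x) (fun x => c * f x) =
    fun v => (normc c ^+ 2)%:C * graph_ip s f f v.
  apply/funext => v; apply: graph_ipE.
  apply: eq_has_sum (has_sumZ (normc c ^+ 2)%:C (graph_ip_sum v fX fX)) => x _.
  by rewrite -mul_conjc rmorphM /=; ring.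
have := supnormZ (normc c ^+ 2)%:C (graph_ip_C0 sl hE1 fX fX); rewrite /supnorm => ->.
by rewrite normc_real ger0_norm ?sqr_ge0// sqrtrM ?sqr_ge0// sqrtr_sqr ger0_norm ?normc_ge0.
Qed.

Lemma graph_bimodule_normed : normed_bimodule (@graph_bimodule R E0 E1 s r).
Proof.
split.
- split=> [f _|f fX f0|f g|t f] /=.
  + exact: sqrtr_ge0.
  + apply/funext => x; apply/eq0_normc/eqP; rewrite eq_le normc_ge0 andbT.
    by rewrite -[leRHS]f0; exact: (normc_le_graph_norm r sl hE1).
  + exact: graph_normD.
  + exact: graph_norm_scale.
- by move=> f g; exact: graph_Cauchy_Schwarz.
- by move=> a f; exact: graph_norm_lact.
- by move=> a f g aA fX gX; apply/funext => x; rewrite /vsub /= mulrDr mulrCA.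
- by move=> a f g aA fX gX; apply/funext => x; rewrite /= mulrDr.
- by move=> f a; exact: graph_norm_ract.
Qed.

End graph_bimodule_norm.

(** * Levels of a topological k-graph *)

Section subtype_topology.
Variables (X : topologicalType) (B : set X).

Lemma continuous_set_val : continuous (\val : B -> X).
Proof. exact: initial_continuous. Qed.

Lemma continuous_to_subtype (T : topologicalType) (f : T -> B) (t : T) :
  {for t, continuous (fun u => \val (f u) : X)} -> {for t, continuous f}.
Proof.
move=> fc U [_ [[W oW <-] /= Wt] WU]; apply: filterS WU _.
by apply: (fc W); apply: open_nbhs_nbhs.
Qed.

Lemma hausdorff_subtype : hausdorff_space X -> hausdorff_space B.
Proof.
move=> hX p q pq; apply: val_inj; apply: hX => U V Up Vq.
have [z [zU zV]] := pq _ _ (continuous_set_val Up) (continuous_set_val Vq).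
by exists (\val z).
Qed.

(** A cluster point in X of a filter on B lies in B because B is closed. *)
Lemma compact_val_preimage (K : set X) : closed B -> compact K ->
  compact (\val @^-1` K : set B).
Proof.
move=> cB cK F PF FK.
have [|x [Kx clx]] := cK (\val @ F) (fmap_proper_filter _ PF); first exact: FK.
have Bx : B x.
  apply: cB => V Vx; have [|y [By Vy]] := clx (\val @` [set: B]) V _ Vx.
    by apply: (@filterE _ F) => y; exists y.
  by case: By Vy => z _ <- Vy; exists (\val z); split => //; exact: set_mem (valP z).
exists (SigSub (mem_set Bx)); split=> // U V FU [_ [[W oW <-] /= Wx] WV].
have [|y [[z Uz <-] Wz]] := clx (\val @` U) W _ (open_nbhs_nbhs (conj oW Wx)).
  by apply: (@filterS _ F _ U) FU => z Uz; exists z.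
by exists z; split => //; exact: WV.
Qed.

End subtype_topology.

Section kgraph_topology.
Variables (k : nat) (L : topological_kgraph k).
Implicit Types (m n : {ffun 'I_k -> nat}) (x y u w : L).
Let kg := kg_axioms L.

Lemma level_nbhs n x : deg x = n -> \forall y \near x, deg y = n.
Proof.
move=> <-; have := kg_deg_continuous kg; move=> /(_ x [set deg x]); apply.
by rewrite /= nbhs_principalE; exact/principal_filterP.
Qed.

Lemma level_open n : open (level L n).
Proof. by rewrite openE => x; exact: level_nbhs. Qed.

Lemma level_closed n : closed (level L n).
Proof.
move=> x xn; have [y [yn yx]] := xn _ (level_nbhs (erefl (deg x))).
by rewrite /level /= -yx.
Qed.

Lemma continuous_src : continuous (@src k L).
Proof.
move=> x; apply: (@continuous_comp _ _ _ (@src0 k L) \val).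
  exact: local_homeomorphism_continuous (kg_src_local_homeo kg) x.
exact: continuous_set_val.
Qed.

Lemma continuous_rng : continuous (@rng k L).
Proof.
move=> x; apply: (@continuous_comp _ _ _ (@rng0 k L) \val).
  exact: kg_rng_continuous kg x.
exact: continuous_set_val.
Qed.

Definition level_src n (x : level L n) : level L 0 := src0 (\val x).
Definition level_rng n (x : level L n) : level L 0 := rng0 (\val x).

Lemma level_hausdorff n : hausdorff_space (level L n).
Proof. exact: hausdorff_subtype (kg_hausdorff kg). Qed.

Lemma level_rng_continuous n : continuous (@level_rng n).
Proof.
move=> x; apply: (@continuous_comp _ _ _ (\val : level L n -> L) (@rng0 k L)).
  exact: continuous_set_val.
exact: kg_rng_continuous kg _.
Qed.

(** A level is open in Lambda: near a point that a local inverse h of the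
    source map sends into the level, h takes its values in the level. *)
Lemma level_src_local_homeo n : local_homeomorphism (@level_src n).
Proof.
move=> x; have [U [h [oU Ux osU hs hc]]] :=
  local_homeomorphism_section (kg_src_local_homeo kg) (\val x).
have oV : open (\val @^-1` U : set (level L n)).
  by apply: open_comp => // y _; exact: continuous_set_val.
have imE : (@level_src n) @` (\val @^-1` U) =
    (@src0 k L) @` U `&` h @^-1` level L n.
  apply/seteqP; split=> [_ [y Uy <-]|_ [[y Uy <-]]] /=.
    by split; [exists (\val y) | rewrite /level_src hs//; exact: set_mem (valP y)].
  by rewrite hs// => yn; exists (SigSub (mem_set yn)).
have oi : open ((@level_src n) @` (\val @^-1` U)).
  rewrite imE openE => v [Uv hv].
  have hn : \forall w \near v, level L n (h w).
    by apply: hc => //; apply: open_nbhs_nbhs; split => //; exact: level_open.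
  by apply: filterI => //; apply: open_nbhs_nbhs.
have sc : continuous (@level_src n).
  move=> y; apply: (@continuous_comp _ _ _ (\val : level L n -> L) (@src0 k L)).
    exact: continuous_set_val.
  exact: local_homeomorphism_continuous (kg_src_local_homeo kg) _.
exists (\val @^-1` U); split => //; first exact: continuous_subspaceT.
pose g (v : level L 0) : level L n :=
  if pselect (level L n (h v)) is left hv then SigSub (mem_set hv) else x.
have gE v : level L n (h v) -> \val (g v) = h v by rewrite /g; case: pselect.
exists g; split=> [|y Uy]; last first.
  by apply: val_inj; rewrite gE hs//; exact: set_mem (valP y).
rewrite continuous_open_subspace// => v /set_mem Uv; move: (Uv); rewrite imE => -[sUv hv].
apply: continuous_to_subtype; apply: near_eq_continuous (hc _ sUv).
have : \forall w \near v, ((@level_src n) @` (\val @^-1` U)) w by exact: open_nbhs_nbhs.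
by apply: filterS => w; rewrite imE => -[_ /gE].
Qed.

End kgraph_topology.

(** * Factorization of paths *)

Local Notation comp := Defs.comp.

Section kgraph_factorization.
Variables (k : nat) (L : topological_kgraph k).
Implicit Types (m n : {ffun 'I_k -> nat}) (x y u w : L).
Let kg := kg_axioms L.

Lemma ffun_addnI m n n' : m + n = m + n' -> n = n'.
Proof.
by move=> /ffunP h; apply/ffunP => i; have := h i; rewrite !ffunE => /addnI.
Qed.

Lemma factor_unique u u' w w' : src u = rng w -> src u' = rng w' ->
  deg u = deg u' -> deg w = deg w' -> comp u w = comp u' w' -> u = u' /\ w = w'.
Proof.
move=> uw uw' du dw e.
have [p [_ pU]] := kg_factorization kg (deg_comp uw).
have pE : p = (u, w) by apply: pU.
have pE' : p = (u', w') by apply: pU; split.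
by move: pE'; rewrite pE => -[].
Qed.

(** x = x (src x) = (rng x) x are two factorizations of x into paths of
    degree 0. *)
Lemma deg0_identity x : deg x = 0 -> src x = x /\ rng x = x.
Proof.
move=> dx; have [||||| e1 e2] := @factor_unique x (rng x) (src x) x.
- by rewrite rng_src.
- by rewrite src_rng.
- by rewrite dx deg_rng.
- by rewrite dx deg_src.
- by rewrite comp_src comp_rng.
by [].
Qed.

Lemma segment_comp m n u w : deg u = m -> deg w = n -> src u = rng w ->
  segment (comp u w) 0 m = u /\ segment (comp u w) m (m + n) = w.
Proof.
move=> du dw uw; have dx : deg (comp u w) = m + n by rewrite deg_comp ?du ?dw.
split; rewrite /segment /pick_in.
  case: pselect => [ex|[]]; last first.
    by have := @segment_exists _ _ (comp u w) 0 m n; rewrite add0r; apply.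
  case: (cid ex) => y /= [u0 [w0 [/deg0_identity[su0 _] dy dw0 [u0y yw0] e]]].
  (* The factor in front of x(0,m) has degree 0, so it is an identity. *)
  have u0E : u0 = rng y by rewrite -u0y su0.
  have e' : comp u w = comp y w0 by rewrite e u0E -(rng_comp yw0) comp_rng.
  rewrite add0r in dy; rewrite dx in dw0.
  have dww : deg w = deg w0 by rewrite dw; apply: ffun_addnI (esym dw0).
  by have [-> _] := factor_unique uw yw0 (etrans du (esym dy)) dww e'.
case: pselect => [ex|[]]; last first.
  by apply: (@segment_exists _ _ _ _ _ 0); rewrite addr0.
case: (cid ex) => y /= [u0 [w0 [du0 dy dw0 [u0y yw0] e]]].
have {}dw0 : deg w0 = 0 by apply: (@ffun_addnI (m + n)); rewrite dw0 dx addr0.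
have [_ rw0] := deg0_identity dw0.
have w0E : w0 = src y by rewrite yw0 rw0.
rewrite w0E comp_src in e.
have dwy : deg w = deg y by rewrite dw; exact: ffun_addnI (esym dy).
by have [_ ->] := factor_unique uw u0y (etrans du (esym du0)) dwy e.
Qed.

Section heads_and_tails.
Variables m n : {ffun 'I_k -> nat}.
Implicit Types (p : level L (m + n)) (a : level L m) (b : level L n).

Lemma level_deg n' (a : level L n') : deg (\val a) = n'.
Proof. exact: set_mem (valP a). Qed.

Lemma path_split p : [/\ src (\val (path_head p)) = rng (\val (path_tail p)) &
  comp (\val (path_head p)) (\val (path_tail p)) = \val p].
Proof.
have [[u w] [[/= du dw uw xE] _]] := kg_factorization kg (level_deg p).
by have [hE tE] := segment_comp du dw uw; rewrite /= xE hE tE.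
Qed.

Lemma path_joinE a b p : src (\val a) = rng (\val b) ->
  comp (\val a) (\val b) = \val p -> path_head p = a /\ path_tail p = b.
Proof.
move=> ab pE; have [hE tE] := segment_comp (level_deg a) (level_deg b) ab.
by split; apply: val_inj; rewrite /= -pE.
Qed.

Lemma path_join a b : src (\val a) = rng (\val b) ->
  exists p, [/\ path_head p = a, path_tail p = b & \val p = comp (\val a) (\val b)].
Proof.
move=> ab; have dp : level L (m + n) (comp (\val a) (\val b)).
  by rewrite /level /= deg_comp ?level_deg.
exists (SigSub (mem_set dp)).
by have [] := @path_joinE a b (SigSub (mem_set dp)) ab.
Qed.

Lemma path_eq p q : path_head p = path_head q -> path_tail p = path_tail q -> p = q.
Proof.
move=> h t; apply: val_inj; have [_ <-] := path_split p; have [_ <-] := path_split q.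
by rewrite h t.
Qed.

Lemma level_src_tail p : level_src p = level_src (path_tail p).
Proof.
apply: val_inj => /=; have [h e] := path_split p.
by rewrite -[in LHS]e src_comp.
Qed.

Lemma level_rng_head p : level_rng p = level_rng (path_head p).
Proof.
apply: val_inj => /=; have [h e] := path_split p.
by rewrite -[in LHS]e rng_comp.
Qed.

Lemma level_src_head p : level_src (path_head p) = level_rng (path_tail p).
Proof. by apply: val_inj => /=; have [] := path_split p. Qed.

Lemma path_join_level a b : level_src a = level_rng b ->
  exists p, [/\ path_head p = a, path_tail p = b & \val p = comp (\val a) (\val b)].
Proof. by move=> ab; apply: path_join; exact: (congr1 (fun c : level L 0 => \val c) ab). Qed.

(** Composition is open and factorizations are unique, so the two factors of
    a path depend continuously on it. *)
Lemma path_factors_continuous p (U W : set L) :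
  nbhs (\val (path_head p)) U -> nbhs (\val (path_tail p)) W ->
  \forall q \near p, U (\val (path_head q)) /\ W (\val (path_tail q)).
Proof.
have [ht pE] := path_split p => hU tW.
pose U' := U `&` level L m; pose W' := W `&` level L n.
pose O : set (composable L) := [set z | U'° (\val z).1 /\ W'° (\val z).2].
have oO : open O.
  apply: (@open_comp _ _ (\val : composable L -> (L * L)%type) (U'° `*` W'°)).
    by move=> z _; exact: continuous_set_val.
  rewrite openE => -[a b] [/= Ua Wb]; exists (U'°, W'°) => //=.
  by split; apply: open_nbhs_nbhs; split => //; exact: open_interior.
have := kg_comp_open kg oO.
have Ip : ((compose L) @` O) (\val p).
  exists (SigSub (mem_set (ht : composable L (_, _)))); last exact: pE.
  by split; apply: filterI => //; apply: level_nbhs; rewrite level_deg.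
move=> oc; have : \forall q \near p, ((compose L) @` O) (\val q).
  by apply: continuous_set_val; exact: open_nbhs_nbhs.
apply: filterS => q [z [/nbhs_singleton[Uz z1] /nbhs_singleton[Wz z2]] zq].
have zc : src (\val z).1 = rng (\val z).2 := set_mem (valP z).
have [-> ->] := @path_joinE (SigSub (mem_set z1)) (SigSub (mem_set z2)) q zc zq.
by [].
Qed.

Lemma path_head_continuous : continuous (@path_head k L m n).
Proof.
move=> p; apply: continuous_to_subtype => U hU.
have tT : nbhs (\val (path_tail p)) [set: L] by exact: filterT.
have := path_factors_continuous hU tT.
by apply: filterS => q [].
Qed.

Lemma path_tail_continuous : continuous (@path_tail k L m n).
Proof.
move=> p; apply: continuous_to_subtype => U hU.
have hT : nbhs (\val (path_head p)) [set: L] by exact: filterT.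
have := path_factors_continuous hT hU.
by apply: filterS => q [].
Qed.

(** The composable pairs in K1 x K2 form a compact set, since composability is
    a closed condition in a Hausdorff space; composition sends it to a compact
    set of paths. *)
Lemma compact_paths (K1 : set (level L m)) (K2 : set (level L n)) :
  compact K1 -> compact K2 ->
  exists2 K : set (level L (m + n)), compact K &
    forall p, K1 (path_head p) -> K2 (path_tail p) -> K p.
Proof.
move=> c1 c2; have vc n' (K : set (level L n')) : compact K -> compact (\val @` K : set L).
  by move=> cK; apply: continuous_compact cK; apply: continuous_subspaceT; exact: continuous_set_val.
have cc : closed (composable L).
  move=> -[u w] uw; rewrite /composable /=; apply: (kg_hausdorff kg) => U W Uu Ww.
  have [|[u' w'] [/= e [Uu' Ww']]] := uw (src @^-1` U `*` rng @^-1` W).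
    by exists (src @^-1` U, rng @^-1` W) => //=; split; [exact: continuous_src Uu | exact: continuous_rng Ww].
  by exists (src u'); split => //; rewrite e.
have cK : compact ((compose L) @` (\val @^-1` ((\val @` K1) `*` (\val @` K2)))).
  apply: (@continuous_compact (composable L) L (compose L)).
    by apply: continuous_subspaceT; exact: (kg_comp_continuous kg).
  by apply: compact_val_preimage => //; apply: compact_setX; exact: vc.
exists (\val @^-1` ((compose L) @` (\val @^-1` ((\val @` K1) `*` (\val @` K2))))).
  by apply: compact_val_preimage => //; exact: level_closed.
move=> p p1 p2; have [ht pE] := path_split p.
exists (SigSub (mem_set (ht : composable L (_, _)))); last exact: pE.
by split; [exists (path_head p) | exists (path_tail p)].
Qed.

End heads_and_tails.
End kgraph_factorization.

(** * Products of functions on paths *)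

Section kgraph_multiplication.
Variables (R : realType) (k : nat) (L : topological_kgraph k).
Implicit Types m n : {ffun 'I_k -> nat}.
Local Open Scope complex_scope.
Let kg := kg_axioms L.
Local Notation src_ n := (@level_src k L n).
Local Notation rng_ n := (@level_rng k L n).
Local Notation GX n := (@graph_module R (level L 0) (level L n) (src_ n)).
Let sl n : local_homeomorphism (src_ n) := @level_src_local_homeo k L n.
Let rc n : continuous (rng_ n) := @level_rng_continuous k L n.
Let hd n : hausdorff_space (level L n) := @level_hausdorff k L n.

Lemma kgraph_bimodule_hilbert n : is_right_hilbert_bimodule (kgraph_bimodule R L n).
Proof. exact: (graph_bimodule_hilbert R (@sl n) (@rc n) (@hd n)). Qed.

Lemma kgraph_bimodule_normed n : normed_bimodule (kgraph_bimodule R L n).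
Proof. exact: (graph_bimodule_normed R (@sl n) (@rc n) (@hd n)). Qed.

Let ip_C0 n f f' : GX n f -> GX n f' -> C0 R (level L 0) (graph_ip (src_ n) f f').
Proof. exact: graph_ip_C0 (@sl n) (@hd n) _ _. Qed.

Let lact_in n (c : level L 0 -> R[i]) f : C0 R (level L 0) c -> GX n f ->
  GX n (fun b => c (level_rng b) * f b).
Proof. exact: graph_module_lact (@sl n) (@rc n) (@hd n) _ _. Qed.

Section two_degrees.
Variables m n : {ffun 'I_k -> nat}.
Implicit Types (f : level L m -> R[i]) (g : level L n -> R[i]).
Local Notation hd_ := (@path_head k L m n).
Local Notation tl_ := (@path_tail k L m n).

(** Convertible to [kgraph_mul]. *)
Definition path_mul f g (p : level L (m + n)) : R[i] := f (hd_ p) * g (tl_ p).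

(** Outside a compact set of paths, the head is where f is small or the tail is
    where g is small. *)
Lemma path_mul_C0 f g : C0 R (level L m) f -> C0 R (level L n) g ->
  C0 R (level L (m + n)) (path_mul f g).
Proof.
move=> f0 g0; split.
  apply: continuous_mulc => p.
    apply: (@continuous_comp _ _ R[i]^o hd_ f); first exact: path_head_continuous.
    exact: (C0_continuous f0).
  apply: (@continuous_comp _ _ R[i]^o tl_ g); first exact: path_tail_continuous.
  exact: (C0_continuous g0).
move=> e e0; have [M M0 fM] := C0_bounded f0; have [N N0 gN] := C0_bounded g0.
have M1 : 0 < M + 1 by rewrite ltr_wpDl.
have N1 : 0 < N + 1 by rewrite ltr_wpDl.
have [K cK hK] := compact_paths (C0_compact f0 (divr_gt0 e0 N1)) (C0_compact g0 (divr_gt0 e0 M1)).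
exists K => // p Kp; rewrite normcM.
have [fe|fe] := leP (e / (N + 1)) (normc (f (hd_ p))).
  have [ge|ge] := leP (e / (M + 1)) (normc (g (tl_ p))); first by case: Kp; exact: hK.
  move: ge; rewrite ltr_pdivlMr// mulrC; apply: le_lt_trans.
  by rewrite ler_wpM2r ?normc_ge0// (le_trans (fM _))// lerDl.
move: fe; rewrite ltr_pdivlMr//; apply: le_lt_trans.
by rewrite ler_wpM2l ?normc_ge0// (le_trans (gN _))// lerDl.
Qed.

(** The paths with tail b correspond to their heads, which are all the paths
    with source rng b. *)
Lemma tail_fibre_has_sum (F : level L m -> R[i]) (b : level L n) v t : level_src b = v ->
  has_sum [set a | level_src a = level_rng b] F t ->
  has_sum [set p | level_src p = v /\ tl_ p = b] (fun p => F (hd_ p)) t.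
Proof.
move=> bv; apply: (iffLR (has_sum_reindex _ _ _ _ _)).
- by move=> p [_ <-] /=; exact: level_src_head.
- by move=> p q [_ p2] [_ q2] pq; apply: path_eq => //; rewrite p2 q2.
- move=> a /path_join_level[p [p1 p2 _]]; exists p => //; split => //.
  by rewrite level_src_tail p2.
Qed.

(** Summing over the heads first shows that the fibre sums of |f g|^2 are the
    inner product of g with <f, f> g, which vanishes at infinity. *)
Lemma path_mul_in f g : GX m f -> GX n g -> GX (m + n) (path_mul f g).
Proof.
move=> fX gX; pose u (b : level L n) := normc (g b) ^+ 2 * fibre_sqnorm (src_ m) f (level_rng b).
have ffgX : GX n (fun b => graph_ip (src_ m) f f (level_rng b) * g b).
  by apply: (lact_in _ gX); exact: ip_C0.
have uT v : has_sum [set b | level_src b = v] (fun b => (u b)%:C)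
    (graph_ip (src_ n) g (fun b => graph_ip (src_ m) f f (level_rng b) * g b) v).
  apply: eq_has_sum (graph_ip_sum v gX ffgX) => b _.
  by rewrite (graph_ip_diag _ fX) mulrCA mul_conjc -rmorphM mulrC.
have fibre v b : level_src b = v ->
    has_sum [set p | level_src p = v /\ tl_ p = b] (fun p => (normc (path_mul f g p) ^+ 2)%:C) (u b)%:C.
  move=> bv; have := has_sumZ (normc (g b) ^+ 2)%:C (fibre_sqnormP (level_rng b) fX).
  rewrite -rmorphM -/(u b) => /(tail_fibre_has_sum bv); apply: eq_has_sum => p [_ <-].
  by rewrite /path_mul normcM exprMn -rmorphM mulrC.
have st v p : level_src p = v -> level_src (tl_ p) = v by rewrite level_src_tail.
have /choice[T pT] : forall v, exists T : R,
    has_sum [set p | level_src p = v] (fun p => (normc (path_mul f g p) ^+ 2)%:C) T%:C.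
  move=> v; have := uT v; rewrite -(has_sum_real (uT v)).
  by apply: (has_sum_fibres_ge0 (@st v) _ (fibre v)) => p _; exact: sqr_ge0.
apply: (graph_module_intro (path_mul_C0 (graph_module_C0 fX) (graph_module_C0 gX)) pT).
have -> : (fun v => (T v)%:C) =
    graph_ip (src_ n) g (fun b => graph_ip (src_ m) f f (level_rng b) * g b).
  by apply/funext => v; exact: has_sum_unique (has_sum_fibres (@st v) (fibre v) (pT v)) (uT v).
exact: ip_C0.
Qed.

(** A path with source v is a tail b with source v together with a head with
    source rng b. Summing over the heads first gives <f, f'>(rng b), as in the
    inner product of the balanced tensor product. *)
Lemma path_mul_ip f g f' g' : GX m f -> GX n g -> GX m f' -> GX n g' ->
  graph_ip (src_ (m + n)) (path_mul f g) (path_mul f' g') =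
  graph_ip (src_ n) g (fun b => graph_ip (src_ m) f f' (level_rng b) * g' b).
Proof.
move=> fX gX fX' gX'; apply/funext => v; symmetry; apply: graph_ipE.
have st p : level_src p = v -> level_src (tl_ p) = v by rewrite level_src_tail.
have fgX := path_mul_in fX gX; have fgX' := path_mul_in fX' gX'.
refine (has_sum_fibres st _ (graph_ip_sum v fgX fgX')) => b bv.
have := has_sumZ ((g b)^* * g' b) (graph_ip_sum (level_rng b) fX fX').
move=> /(tail_fibre_has_sum bv); rewrite [X in has_sum _ _ X -> _](_ : _ =
  (g b)^* * (graph_ip (src_ m) f f' (level_rng b) * g' b)); last by ring.
by apply: eq_has_sum => p [_ <-]; rewrite /path_mul rmorphM /=; ring.
Qed.

End two_degrees.
End kgraph_multiplication.

(** * Bump functions *)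

Lemma continuous_complement (R : realType) (T : topologicalType) (f : T -> R) x :
  {for x, continuous f} -> {for x, continuous (fun y => 1 - f y)}.
Proof. by move=> fc; apply: (@cvgB R R^o); [exact: cvg_cst | exact: fc]. Qed.

Section bump_functions.
Variables (R : realType) (X : topologicalType).
Hypotheses (lX : locally_compact [set: X]) (hX : hausdorff_space X).

(** A locally compact Hausdorff space is completely regular: x is separated
    from the complement of the interior of a compact neighbourhood. *)
Lemma bump_function (x : X) (U : set X) : nbhs x U ->
  exists (a : X -> R) (K : set X), [/\ continuous a, forall y, 0 <= a y <= 1, a x = 1,
    compact K /\ K `<=` U & forall y, ~ K y -> a y = 0].
Proof.
move=> xU; have [N xN cN] : exists2 N, nbhs x N & compact N.
  have [N NN [cN _]] := @lX x I; exists N => //.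
  by move: NN; rewrite withinE => -[V xV]; rewrite !setIT => ->.
have cr := @locally_compact_completely_regular X R lX hX.
have [W xW WU] := @completely_regular_regular R X cr x _ (filterI xU xN).
have cW : compact (closure W).
  by apply: (subclosed_compact (@closed_closure _ W) cN) => y /WU[].
have cI : closed (~` (closure W)°) by rewrite closedC; exact: open_interior.
have xI : ~ (~` (closure W)°) x.
  by apply: contrapT => /contrapT; apply; apply: filterS xW; exact: subset_closure.
have /(uniform_separatorP (R := R))[f [fc f01 f0 f1]] := cr x _ cI xI.
exists (fun y => 1 - f y), (closure W); split => //.
- by move=> y; exact: continuous_complement (fc y).
- move=> y; have : range f (f y) by exists y.
  by move=> /f01; rewrite /= in_itv /=; lra.
- have /f0 /= -> : [set f y | y in [set x]] (f x) by exists x.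
  by rewrite subr0.
- by split=> // y /WU[].
- move=> y Wy; have /f1 /= -> : [set f y | y in ~` (closure W)°] (f y).
    by exists y => // /interior_subset.
  by rewrite subrr.
Qed.

End bump_functions.

Lemma C0_compact_support (R : realType) (E : topologicalType) (f : E -> R[i]^o) (K : set E) :
  continuous f -> compact K -> (forall x, ~ K x -> f x = 0) -> C0 R E f.
Proof. by move=> fc cK fK; split=> // e e0; exists K => // x /fK->; rewrite normc0. Qed.

(** Functions with compact support in an open set on which s is injective. *)
Section section_domains.
Variables (R : realType) (E0 E1 : topologicalType) (s : E1 -> E0).
Hypotheses (hE0 : hausdorff_space E0) (sc : continuous s).
Variables (U K : set E1) (h : E0 -> E1).
Hypotheses (oU : open (s @` U)) (hs : forall y, U y -> h (s y) = y)
  (hc : forall v, (s @` U) v -> {for v, continuous h}).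
Hypotheses (cK : compact K) (KU : K `<=` U).
Local Open Scope complex_scope.

(** The sum of f over the fibres of s: it has at most one non-zero term. *)
Definition push_forward (f : E1 -> R[i]) (v : E0) : R[i] :=
  if `[< (s @` U) v >] then f (h v) else 0.

Lemma push_forwardE f x : U x -> push_forward f (s x) = f x.
Proof. by move=> Ux; rewrite /push_forward asboolT ?hs//; exists x. Qed.

Lemma push_forward_out f v : ~ (s @` U) v -> push_forward f v = 0.
Proof. by move=> Uv; rewrite /push_forward asboolF. Qed.

Variable f : E1 -> R[i].
Hypotheses (fc : continuous (f : E1 -> R[i]^o)) (fK : forall x, ~ K x -> f x = 0).

Let c_sK : compact (s @` K).
Proof. by apply: continuous_compact cK; exact: continuous_subspaceT. Qed.

Lemma push_forward_support v : ~ (s @` K) v -> push_forward f v = 0.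
Proof.
move=> Kv; have [[x Ux xv]|/push_forward_out//] := pselect ((s @` U) v).
by rewrite -xv push_forwardE//; apply: fK => Kx; apply: Kv; exists x.
Qed.

(** On the open set s(U) the function is f o h. The compact set s(K) is closed,
    and off it the function is 0. *)
Lemma push_forward_continuous : continuous (push_forward f : E0 -> R[i]^o).
Proof.
move=> v; have [Uv|Uv] := pselect ((s @` U) v).
  have Un : \forall w \near v, (s @` U) w by exact: open_nbhs_nbhs.
  apply: (@near_eq_continuous _ R[i]^o _ (f \o h)).
    by apply: filterS Un => w Uw; rewrite /push_forward asboolT.
  by apply: (@continuous_comp _ _ R[i]^o h f); [exact: hc | exact: fc].
have sKc : closed (s @` K) by exact: compact_closed.
have Kn : \forall w \near v, ~ (s @` K) w.
  apply: open_nbhs_nbhs; split; first by rewrite -openC in sKc.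
  by move=> [x /KU Ux xv]; apply: Uv; exists x.
apply: (@near_eq_continuous _ R[i]^o _ (fun=> 0)); last exact: cvg_cst.
by apply: filterS Kn => w /push_forward_support->.
Qed.

Lemma push_forward_C0 : C0 R E0 (push_forward f).
Proof. exact: C0_compact_support push_forward_continuous c_sK push_forward_support. Qed.

Lemma push_forward_sum v : has_sum [set x | s x = v] f (push_forward f v).
Proof.
have [[x Ux xv]|Uv] := pselect ((s @` U) v).
  rewrite -xv push_forwardE//; apply: has_sum_single => // y /= yx xy.
  by apply: fK => /KU Uy; apply: xy; rewrite -(hs Ux) -(hs Uy) yx.
rewrite push_forward_out//; apply: has_sum0 => x xv; apply: fK => /KU Ux.
by apply: Uv; exists x.
Qed.

End section_domains.

Lemma section_support_in_graph_module (R : realType) (E0 E1 : topologicalType)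
    (s : E1 -> E0) (U K : set E1) (h : E0 -> E1) (f : E1 -> R[i]) :
  hausdorff_space E0 -> continuous s -> open (s @` U) ->
  (forall y, U y -> h (s y) = y) -> (forall v, (s @` U) v -> {for v, continuous h}) ->
  compact K -> K `<=` U -> continuous (f : E1 -> R[i]^o) -> (forall x, ~ K x -> f x = 0) ->
  graph_module s f.
Proof.
move=> hE0 sc oU hs hc cK KU fc fK.
pose q x : R[i] := (normc (f x) ^+ 2)%:C%C.
have qc : continuous (q : E1 -> R[i]^o).
  by move=> x; apply: (@continuous_RtoC _ _ (fun x => normc (f x) ^+ 2)); exact: continuous_sqnorm.
have qK x : ~ K x -> q x = 0 by move=> /fK fx; rewrite /q fx normc0 expr0n.
have qs v := push_forward_sum hs KU qK v.
have q0 := push_forward_C0 hE0 sc oU hs hc cK KU qc qK.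
have qE v : (complex.Re (push_forward s U h q v))%:C%C = push_forward s U h q v := has_sum_real (qs v).
apply: (@graph_module_intro _ _ _ _ _ (fun v => complex.Re (push_forward s U h q v))).
- exact: C0_compact_support fc cK fK.
- by move=> v; rewrite qE; exact: qs.
- by move: q0; congr C0; apply/funext => v; rewrite qE.
Qed.

(** * Density of the products *)

Section splitting.
Variables (R : realType) (k : nat) (L : topological_kgraph k).
Variables m n : {ffun 'I_k -> nat}.
Local Open Scope complex_scope.
Let kg := kg_axioms L.
Local Notation src_ n := (@level_src k L n).
Local Notation GX n := (@graph_module R (level L 0) (level L n) (src_ n)).
Local Notation E := (level L (m + n)).

(** Density of the products rests on having enough functions of which all the
    multiples are single products f g. *)
Definition splitting (w : E -> R) : Prop :=
  [/\ continuous w, forall p, 0 <= w p <= 1 &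
      forall (b : E -> R[i]) (M : R), continuous (b : E -> R[i]^o) ->
        (forall p, normc (b p) <= M) ->
        exists f g, [/\ GX m f, GX n g &
          forall p, (w p)%:C * b p = f (path_head p) * g (path_tail p)]].

Lemma level_bump n0 (x : level L n0) :
  exists (a : level L n0 -> R) (U K : set (level L n0)) (h : level L 0 -> level L n0),
  [/\ continuous a, forall y, 0 <= a y <= 1, a x = 1 & forall y, ~ K y -> a y = 0] /\
  [/\ open (src_ n0 @` U), forall y, U y -> h (src_ n0 y) = y,
      forall v, (src_ n0 @` U) v -> {for v, continuous h}, compact K & K `<=` U].
Proof.
have [U [h [oU Ux osU hs hc]]] := local_homeomorphism_section (@level_src_local_homeo k L n0) x.
have [_ [[W oW <-] /= Wx] WsU] : nbhs x U by exact: open_nbhs_nbhs.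
have [a [K [ac a01 ax [cK KW] aK]]] :=
  bump_function R (kg_locally_compact kg) (kg_hausdorff kg) (open_nbhs_nbhs (conj oW Wx)).
exists (fun y => a (\val y)), U, (\val @^-1` K), h; split; split => //.
- move=> y; apply: (@continuous_comp _ _ _ (\val : level L n0 -> L) a); last exact: ac.
  exact: continuous_set_val.
- by move=> y; exact: aK.
- by apply: compact_val_preimage cK; exact: level_closed.
- by move=> y /KW Wy; exact: WsU.
Qed.

(** The pairs (a u, b u) are composable for u near t only; elsewhere they are
    replaced by a fixed composable pair. *)
Lemma continuous_comp_paths (T : topologicalType) (a : T -> level L m) (b : T -> level L n)
    (p : T -> E) t :
  {for t, continuous a} -> {for t, continuous b} ->
  (\forall u \near t, level_src (a u) = level_rng (b u) /\
     \val (p u) = Defs.comp (\val (a u)) (\val (b u))) ->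
  {for t, continuous p}.
Proof.
move=> ac bc ab; have [abt pt] := nbhs_singleton ab.
have cmp u : level_src (a u) = level_rng (b u) -> composable L (\val (a u), \val (b u)).
  by move=> e; exact: (congr1 (fun c : level L 0 => \val c) e).
pose z u : composable L := if pselect (level_src (a u) = level_rng (b u)) is left e
  then SigSub (mem_set (cmp u e)) else SigSub (mem_set (cmp t abt)).
have zE u : level_src (a u) = level_rng (b u) -> \val (z u) = (\val (a u), \val (b u)).
  by rewrite /z; case: pselect.
have zc : {for t, continuous z}.
  apply: continuous_to_subtype.
  apply: (@near_eq_continuous _ _ _ (fun u => (\val (a u), \val (b u)))).
    by apply: filterS ab => u [/zE].
  apply: cvg_pair.
    apply: (@continuous_comp _ _ _ a (\val : level L m -> L)) => //.
    exact: continuous_set_val.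
  apply: (@continuous_comp _ _ _ b (\val : level L n -> L)) => //.
  exact: continuous_set_val.
apply: continuous_to_subtype.
apply: (@near_eq_continuous _ _ _ (fun u => compose L (z u))).
  by apply: filterS ab => u [e ->]; rewrite /compose zE.
by apply: (@continuous_comp _ _ _ z (compose L)) => //; exact: (kg_comp_continuous kg).
Qed.

(** Let w be the product of the square of a bump a at the head and of a bump c
    at the tail, both supported where the source maps are injective. A tail y
    extends to at most one path J y with head in the support of a, and then the
    head is determined by y. So one factor a, the bump c and the values b (J y)
    make up a function of the tail, and the other factor a is a function of the
    head. It is for the continuity of the former function at the boundary of
    the domain of J that a occurs twice. *)
Lemma splitting_bump (p0 : E) : exists2 w, splitting w & w p0 = 1.
Proof.
have [a [U [K [h [[ac a01 a1 aK] [oU hs hc cK KU]]]]]] := level_bump (path_head p0).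
have [c [V [K' [h' [[cc c01 c1 cK'] [oV hs' hc' cK'' KV]]]]]] := level_bump (path_tail p0).
exists (fun p => a (path_head p) ^+ 2 * c (path_tail p)); last first.
  by rewrite a1 c1 expr1n mul1r.
have hE0 : hausdorff_space (level L 0) by exact: level_hausdorff.
have sc n0 : continuous (src_ n0).
  by apply: local_homeomorphism_continuous; exact: level_src_local_homeo.
have aCc : continuous (fun x => (a x)%:C : R[i]^o).
  by move=> x; exact: (@continuous_RtoC _ _ a x (ac x)).
have cCc : continuous (fun x => (c x)%:C : R[i]^o).
  by move=> x; exact: (@continuous_RtoC _ _ c x (cc x)).
have aCK x : ~ K x -> (a x)%:C = 0 by move=> /aK->.
split.
- move=> p; apply: (@continuousM R E); last first.
    by apply: (@continuous_comp _ _ _ (@path_tail k L m n) c); [exact: path_tail_continuous | exact: cc].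
  apply: (@continuousM R E);
    by apply: (@continuous_comp _ _ _ (@path_head k L m n) a); [exact: path_head_continuous | exact: ac].
- move=> p; have /andP[a0 a1'] := a01 (path_head p); have /andP[c0 c1'] := c01 (path_tail p).
  by rewrite mulr_ge0 ?sqr_ge0//= mulr_ile1 ?sqr_ge0// expr_le1.
move=> b M bc bM.
pose at_ := push_forward (src_ m) U h (fun x => (a x)%:C).
have atc : continuous (at_ : level L 0 -> R[i]^o).
  exact: (push_forward_continuous hE0 (sc m) oU hs hc cK KU aCc aCK).
have /choice[J JP] : forall y : level L n, exists p : E,
    (src_ m @` U) (level_rng y) ->
    [/\ path_head p = h (level_rng y), path_tail p = y &
        \val p = Defs.comp (\val (h (level_rng y))) (\val y)].
  move=> y; have [[x Ux xy]|nU] := pselect ((src_ m @` U) (level_rng y)); last by exists p0.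
  have [|p pP] := @path_join_level _ _ _ _ (h (level_rng y)) y; last by exists p.
  by rewrite -xy hs.
exists (fun x => (a x)%:C), (fun y => (c y)%:C * (at_ (level_rng y) * b (J y))); split.
- exact: (section_support_in_graph_module hE0 (sc m) oU hs hc cK KU aCc aCK).
- apply: (section_support_in_graph_module hE0 (sc n) oV hs' hc' cK'' KV).
    move=> y; refine (@continuous_mulc_at _ _ (fun y => (c y)%:C)
      (fun y => at_ (level_rng y) * b (J y)) y (cCc y) _).
    have arc : {for y, continuous (fun y => at_ (level_rng y) : R[i]^o)}.
      by apply: (@continuous_comp _ _ R[i]^o (@level_rng k L n) at_); [exact: level_rng_continuous | exact: atc].
    have [Uy|Uy] := pselect ((src_ m @` U) (level_rng y)).
      refine (@continuous_mulc_at _ _ (fun y => at_ (level_rng y)) (fun y => b (J y)) y arc _).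
      apply: (@continuous_comp _ _ R[i]^o J b); last exact: bc.
      apply: (@continuous_comp_paths _ (fun y => h (level_rng y)) id).
      + apply: (@continuous_comp _ _ _ (@level_rng k L n) h); last exact: hc.
        exact: level_rng_continuous.
      + exact: cvg_id.
      + have Un : \forall z \near y, (src_ m @` U) (level_rng z).
          by apply: (@level_rng_continuous k L n y); exact: open_nbhs_nbhs.
        apply: filterS Un => z Uz; have [hz tz ->] := JP z Uz; split => //.
        by have := level_src_head (J z); rewrite hz tz.
    (* Where the section is not defined, the first factor tends to 0. *)
    have at0 : at_ (level_rng y) = 0 by exact: push_forward_out.
    apply/continuous_complexP => e e0.
    have M1 : 0 < `|M| + 1 by rewrite ltr_wpDl.
    have /continuous_complexP/(_ _ (divr_gt0 e0 M1)) := arc.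
    apply: filterS => z; rewrite at0 mul0r !subr0 normcM ltr_pdivlMr//.
    apply: le_lt_trans; rewrite ler_wpM2l ?normc_ge0// (le_trans (bM _))//.
    by rewrite (le_trans (ler_norm M))// lerDl.
  by move=> y /cK' ->; rewrite mul0r.
move=> p /=; have [Ux|Ux] := pselect (U (path_head p)).
  have rE := level_src_head p.
  have Ur : (src_ m @` U) (level_rng (path_tail p)) by exists (path_head p).
  have [hJ tJ _] := JP _ Ur.
  have -> : J (path_tail p) = p by apply: path_eq => //; rewrite hJ -rE hs.
  by rewrite -rE /at_ push_forwardE// rmorphM rmorphXn /= expr2; ring.
have -> : a (path_head p) = 0 by apply: aK => /KU.
by rewrite expr0n mul0r !mul0r.
Qed.

Let mul_sums (z : E -> R[i]) : Prop := exists2 t : tsum (kgraph_bimodule R L m) (kgraph_bimodule R L n),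
  tsum_in t & mul_sum (@kgraph_mul R k L m n) t = z.

Variable w : E -> E -> R.
Hypothesis wP : forall q, splitting (w q).

(** Multiplication by this function cuts out the points of qs, and it differs
    from the identity by functions that are split by the w q. *)
Definition cut (qs : seq E) (p : E) : R := \prod_(q <- qs) (1 - w q p).

Lemma cut_itv qs p : 0 <= cut qs p <= 1.
Proof.
rewrite /cut; elim: qs => [|q qs /andP[h0 h1]]; first by rewrite big_nil ler01 lexx.
have [_ /(_ p)/andP[w0 w1] _] := wP q.
by rewrite big_cons mulr_ge0 ?subr_ge0//= mulr_ile1 ?subr_ge0// lerBlDr lerDl.
Qed.

Lemma continuous_cut qs : continuous (cut qs).
Proof.
elim: qs => [|q qs IHqs] p.
  have -> : cut [::] = fun=> 1 by apply/funext => u; rewrite /cut big_nil.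
  exact: cst_continuous.
have -> : cut (q :: qs) = fun u => (1 - w q u) * cut qs u.
  by apply/funext => u; rewrite /cut big_cons.
have [wc _ _] := wP q; apply: (@continuousM R E); last exact: IHqs.
exact: continuous_complement (wc p).
Qed.

Lemma continuous_cutC qs : continuous (fun p => (cut qs p)%:C : R[i]^o).
Proof. by move=> p; exact: (@continuous_RtoC _ _ (cut qs) p (@continuous_cut qs p)). Qed.

Lemma normc_cut_le1 qs p : normc (cut qs p)%:C <= 1.
Proof. by have /andP[h0 h1] := cut_itv qs p; rewrite normc_real ger0_norm. Qed.

(** For splitting functions w_1, ..., w_N the functions
    b w_i (1 - w_1) ... (1 - w_(i-1)) are products, and they add up to
    b (1 - (1 - w_1) ... (1 - w_N)). *)
Lemma mul_sum_splitting (qs : seq E) (b : E -> R[i]) (M : R) :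
  continuous (b : E -> R[i]^o) -> (forall p, normc (b p) <= M) ->
  mul_sums (fun p => b p * (1 - (cut qs p)%:C)).
Proof.
elim: qs b => [|q qs IHqs] b bc bM.
  exists [::] => //; rewrite /mul_sum big_nil; apply/funext => p.
  by rewrite /cut big_nil subrr mulr0.
have [wc w01 wfg] := wP q; have [f [g [fX gX fgE]]] := wfg b M bc bM.
have [||t tP tE] := IHqs (fun p => b p * (1 - w q p)%:C).
- refine (@continuous_mulc _ _ b (fun p => (1 - w q p)%:C) bc _) => p.
  apply: (@continuous_RtoC _ _ (fun p => 1 - w q p)).
  exact: continuous_complement (wc p).
- move=> p; have /andP[w0 w1] := w01 p; rewrite normcM normc_real.
  rewrite (le_trans _ (bM p))// -[leRHS]mulr1 ler_wpM2l ?normc_ge0//.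
  by rewrite ger0_norm; lra.
exists ((f, g) :: t); first by apply/tsum_in_cons.
rewrite mul_sum_cons tE; apply/funext => p.
transitivity (f (path_head p) * g (path_tail p) + b p * (1 - w q p)%:C * (1 - (cut qs p)%:C)).
  by [].
rewrite -fgE; have -> : cut (q :: qs) p = (1 - w q p) * cut qs p by rewrite /cut big_cons.
rewrite (rmorphM (real_complex R)) !(rmorphB (real_complex R)) !rmorph1.
have alg (x y z : R[i]) : x * z + z * (1 - x) * (1 - y) = z * (1 - (1 - x) * y) by ring.
exact: alg.
Qed.

Hypothesis w1 : forall q, w q q = 1.

Lemma cut_eq0 qs p : p \in qs -> cut qs p = 0.
Proof.
move=> pqs; apply/eqP; rewrite /cut prodf_seq_eq0; apply/hasP; exists p => //=.
by rewrite w1 subrr.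
Qed.

Lemma cut_flatten_le (I : eqType) (c : I -> seq E) (s : seq I) i p : i \in s ->
  cut (flatten (map c s)) p <= cut (c i) p.
Proof.
elim: s => [//|j s IHs]; rewrite inE /= {1}/cut big_cat -/(cut (c j) p) -/(cut (flatten _) p).
have /andP[j0 j1] := cut_itv (c j) p.
have /andP[s0 s1] := cut_itv (flatten (map c s)) p.
move=> /orP[/eqP->|/IHs h]; first by rewrite ler_piMr.
by rewrite (le_trans _ h)// ler_piMl.
Qed.

Let sl n0 : local_homeomorphism (src_ n0) := @level_src_local_homeo k L n0.
Let hd n0 : hausdorff_space (level L n0) := @level_hausdorff k L n0.

Lemma cut_in (h : E -> R[i]) qs : GX (m + n) h -> GX (m + n) (fun p => (cut qs p)%:C * h p).
Proof.
by apply: (graph_module_mulr (@sl _) (@hd _)); [exact: continuous_cutC | exact: normc_cut_le1].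
Qed.

Lemma fibre_sqnorm_cut_le (h : E -> R[i]) qs qs' v : GX (m + n) h ->
  (forall p, cut qs p <= cut qs' p) ->
  fibre_sqnorm (src_ (m + n)) (fun p => (cut qs p)%:C * h p) v <=
  fibre_sqnorm (src_ (m + n)) (fun p => (cut qs' p)%:C * h p) v.
Proof.
move=> hX qq'; apply: has_sum_le (fibre_sqnormP v (cut_in _ hX)) (fibre_sqnormP v (cut_in _ hX)).
move=> p _; have /andP[q0 _] := cut_itv qs p; have /andP[q0' _] := cut_itv qs' p.
rewrite !normcM !normc_real !ger0_norm// lerXn2r ?nnegrE ?mulr_ge0 ?normc_ge0//.
by rewrite ler_wpM2r ?normc_ge0.
Qed.

(** Cutting out a finite part of a fibre that carries most of the sum of
    |h|^2 leaves little of it on all nearby fibres. *)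
Lemma cut_near (h : E -> R[i]) (d : R) (v : level L 0) : GX (m + n) h -> 0 < d ->
  exists qs, \forall u \near v,
    fibre_sqnorm (src_ (m + n)) (fun p => (cut qs p)%:C * h p) u < d.
Proof.
move=> hX d0; have hv := fibre_sqnormP v hX.
have [A [Av /(_ A (fsubset_refl _) Av)]] := hv d d0.
rewrite sum_RtoC -rmorphB normc_real distrC => Ad.
exists (enum_fset A); pose h' p := (cut (enum_fset A) p)%:C * h p; rewrite -/h'.
have h'X : GX (m + n) h' by exact: cut_in.
have h'v : fibre_sqnorm (src_ (m + n)) h' v < d.
  have h'h p : normc (normc (h' p) ^+ 2)%:C <= normc (h p) ^+ 2.
    rewrite normc_real ger0_norm ?sqr_ge0// /h' normcM exprMn ler_piMl ?sqr_ge0//.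
    by rewrite expr_le1 ?normc_ge0// normc_cut_le1.
  have := has_sum_tail (fun p _ => h'h p) (fibre_sqnormP v h'X) hv Av.
  rewrite big_seq big1 => [|p pA]; last first.
    by rewrite /h' cut_eq0// mul0r normc0 expr0n.
  rewrite subr0 normc_real ger0_norm ?fibre_sqnorm_ge0// => /le_lt_trans; apply.
  by apply: le_lt_trans Ad; rewrite ler_norm.
have h'c := C0_real_continuous (fibre_sqnorm_C0 h'X).
have /cvgr_lt/(_ d h'v) := h'c v; exact.
Qed.

(** The set of vertices where the fibre norm of h is not small is compact, and
    finitely many of the cuts of [cut_near] serve for all of it. Elsewhere any
    cut will do. *)
Lemma cut_small (h : E -> R[i]) (d : R) : GX (m + n) h -> 0 < d ->
  exists qs, forall v, fibre_sqnorm (src_ (m + n)) (fun p => (cut qs p)%:C * h p) v < d.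
Proof.
move=> hX d0; have /choice[c cP] := fun v => cut_near v hX d0.
pose cD (D : {fset level L 0}) := flatten (map c (enum_fset D)).
have /compact_near_coveringP cK := C0_compact (fibre_sqnorm_C0 hX) d0.
have [|D0 _ DK] := cK _ totally (fun D u => fibre_sqnorm (src_ (m + n))
  (fun p => (cut (cD D) p)%:C * h p) u < d) totally_filter.
  move=> v _; exists ([set u | fibre_sqnorm (src_ (m + n)) (fun p => (cut (c v) p)%:C * h p) u < d],
    [set D | ([fset v] `<=` D)%fset]); first by split; [exact: cP | exists [fset v]%fset].
  move=> [u D] /= [uv /fsubsetP vD]; apply: le_lt_trans uv.
  apply: fibre_sqnorm_cut_le => // p; apply: cut_flatten_le; apply: vD.
  by rewrite inE.
exists (cD D0) => v.
have [Kv|] := boolP (d <= normc (fibre_sqnorm (src_ (m + n)) h v)%:C).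
  exact: (DK D0 (fsubset_refl _) v Kv).
rewrite -ltNge normc_real ger0_norm ?fibre_sqnorm_ge0//; apply: le_lt_trans.
have := fibre_sqnorm_cut_le (qs := cD D0) (qs' := [::]) v hX.
have -> : (fun p => (cut [::] p)%:C * h p) = h.
  by apply/funext => p; rewrite /cut big_nil mul1r.
by apply=> p; rewrite {2}/cut big_nil; have /andP[] := cut_itv (cD D0) p.
Qed.

End splitting.

Section density.
Variables (R : realType) (k : nat) (L : topological_kgraph k).
Variables m n : {ffun 'I_k -> nat}.
Local Open Scope complex_scope.

(** z splits into cut w qs z, of small norm, and (1 - cut w qs) z, a sum of
    products. *)
Lemma kgraph_mul_dense (z : kgraph_bimodule R L (m + n)) (e : R) :
  vcar (kgraph_bimodule R L (m + n)) z -> 0 < e ->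
  exists2 t : tsum (kgraph_bimodule R L m) (kgraph_bimodule R L n), tsum_in t &
    mnorm (vsub (mul_sum (@kgraph_mul R k L m n) t) z) < e.
Proof.
move=> zX e0.
have bump (p : level L (m + n)) : exists w : level L (m + n) -> R, splitting w /\ w p = 1.
  by have [w ws wp] := @splitting_bump R k L m n p; exists w.
have [w wP] := choice bump.
have wS q := (wP q).1; have w1 q := (wP q).2.
have e2 : 0 < (e / 2) ^+ 2 by rewrite exprn_gt0 ?divr_gt0.
have [qs qsP] := cut_small wS w1 zX e2.
have [M _ zM] := C0_bounded (graph_module_C0 zX).
have [t tP tE] := mul_sum_splitting wS qs (C0_continuous (graph_module_C0 zX)) zM.
exists t => //; rewrite tE.
have cX := cut_in wS qs zX.
pose zc : kgraph_bimodule R L (m + n) := fun p : level L (m + n) => (cut w qs p)%:C * z p.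
have -> : vsub ((fun p : level L (m + n) => z p * (1 - (cut w qs p)%:C))
                : kgraph_bimodule R L (m + n)) z =
    vscale (-1) zc.
  by apply/funext => p; rewrite /vsub /zc /=; ring.
have nX := kgraph_bimodule_normed R L (m + n).
rewrite (normZ (nb_norm nX) _ cX) normc_opp1 mul1r.
have e20 : 0 < e / 2 by rewrite divr_gt0.
apply: (@le_lt_trans _ _ (e / 2)); last by lra.
refine (graph_norm_le (@level_rng k L (m + n)) cX (ltW e20) _) => v.
by rewrite -[leRHS](gtr0_norm e20) -sqrtr_sqr ler_wsqrtr// ltW.
Qed.

End density.

(** * The product system *)

Section product_system.
Variables (R : realType) (k : nat) (L : topological_kgraph k).
Implicit Types m n l : {ffun 'I_k -> nat}.
Local Open Scope complex_scope.
Local Notation A := (C0_algebra R (level L 0)).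
Local Notation X := (kgraph_bimodule R L).

(** Degrees such as m + n + l and m + (n + l) are equal but not convertible.
    Functions on the two levels are compared on the paths of Lambda that the
    points of both levels come from. *)
Lemma existT_kgraph_bimodule n n' (f : X n) (g : X n') : n = n' ->
  (forall (x : level L n) (y : level L n'), \val x = \val y -> f x = g y) ->
  existT (fun n => vsort (X n)) n f = existT (fun n => vsort (X n)) n' g.
Proof.
move=> nn'; case: n' / nn' g => g fg; congr existT.
by apply/funext => x; exact: fg.
Qed.

Lemma level0_src (x : level L 0) : src0 (\val x) = x.
Proof. by apply: val_inj => /=; have [] := deg0_identity (level_deg x). Qed.

Lemma level0_rng (x : level L 0) : rng0 (\val x) = x.
Proof. by apply: val_inj => /=; have [] := deg0_identity (level_deg x). Qed.

(** For a path x = a b c both sides are f a * (g b * h c). *)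
Lemma kgraph_mulA m n l (f : X m) (g : X n) (h : X l) :
  existT (fun n => vsort (X n)) _ (kgraph_mul (kgraph_mul f g) h) =
  existT (fun n => vsort (X n)) _ (kgraph_mul f (kgraph_mul g h)).
Proof.
apply: existT_kgraph_bimodule => [|x y xy]; first by rewrite addrA.
rewrite /kgraph_mul.
have [ht xE] := path_split x; have [ht' hE] := path_split (path_head x).
have st : src (\val (path_tail (path_head x))) = rng (\val (path_tail x)).
  by rewrite -ht -hE src_comp.
have [z [zh zt zE]] := path_join st.
have az : src (\val (path_head (path_head x))) = rng (\val z) by rewrite zE rng_comp.
have [||yh yt] := @path_joinE k L m (n + l) (path_head (path_head x)) z y.
- exact: az.
- by rewrite zE Defs.compA// hE xE xy.
by rewrite yh yt zh zt mulrA.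
Qed.

Lemma kgraph_mul_vertex_l n (a : A) (f : X n) :
  existT (fun n => vsort (X n)) _ (kgraph_mul (a : X 0) f) =
  existT (fun n => vsort (X n)) n (lact a f).
Proof.
apply: existT_kgraph_bimodule => [|x y xy]; first by rewrite add0r.
have [||xh xt] := @path_joinE k L 0 n (rng0 (\val y)) y x.
- exact: src_rng.
- by rewrite /= comp_rng.
by rewrite /kgraph_mul xh xt.
Qed.

Lemma kgraph_mul_vertex_r n (f : X n) (a : A) :
  existT (fun n => vsort (X n)) _ (kgraph_mul f (a : X 0)) =
  existT (fun n => vsort (X n)) n (ract f a).
Proof.
apply: existT_kgraph_bimodule => [|x y xy]; first by rewrite addr0.
have [||xh xt] := @path_joinE k L n 0 y (src0 (\val y)) x.
- by rewrite /= rng_src.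
- by rewrite /= comp_src.
by rewrite /kgraph_mul xh xt.
Qed.

Lemma vertex_fibre_sum (f : level L 0 -> R[i]) v :
  has_sum [set x : level L 0 | src0 (\val x) = v] f (f v).
Proof.
by apply: has_sum_single => [|x xv] /=; [exact: level0_src | rewrite -xv level0_src].
Qed.

(** A vertex is its own range and source, so that the fibres of the source map
    on vertices are single points. *)
Lemma vertex_bimodule_iso :
  is_bimodule_iso (X := standard_bimodule A) (Y := X 0) (fun a : A => a).
Proof.
have carE : vcar (standard_bimodule A) = vcar (X 0).
  apply/seteqP; split=> [f f0|f [f0 _ _]] //.
  apply: (@graph_module_intro _ _ _ _ _ (fun v => normc (f v) ^+ 2)) => //.
    by move=> v; exact: (vertex_fibre_sum (fun x => (normc (f x) ^+ 2)%:C)).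
  have := C0M (C0_conj f0) f0; congr C0; apply/funext => v.
  exact: mul_conjc.
split=> //=.
- rewrite -[C0 _ _]/(vcar (standard_bimodule A)) carE.
  by split=> [f|f g _ _|f fX] //; exists f.
- by move=> a f _ _; apply/funext => x; rewrite level0_rng.
- by move=> f a _ _; apply/funext => x; rewrite level0_src.
- move=> f g _ _; apply/funext => v; apply: graph_ipE.
  exact: (vertex_fibre_sum (fun x => (f x)^* * g x)).
Qed.

Lemma kgraph_tensor_iso m n : exists U : tensor (X m) (X n) -> X (m + n),
  is_bimodule_iso U /\ (forall f g, vcar (X m) f -> vcar (X n) g ->
    U (elementary_tensor f g) = @kgraph_mul R k L m n f g).
Proof.
have hA := C0_algebra_cstar R (level L 0).
have hX n' := kgraph_bimodule_hilbert R L n'.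
have hN := kgraph_bimodule_normed R L (m + n).
exists (@tensor_map _ _ _ _ _ (@kgraph_mul R k L m n)).
have mul_in f g : vcar (X m) f -> vcar (X n) g -> vcar (X (m + n)) (kgraph_mul f g).
  exact: path_mul_in.
have mulZ t f g : vcar (X m) f -> vcar (X n) g ->
    kgraph_mul (vscale t f) g = vscale t (kgraph_mul f g).
  by move=> _ _; apply/funext => p; rewrite /kgraph_mul /= mulrA.
have mul_lact a f g : vcar A a -> vcar (X m) f -> vcar (X n) g ->
    kgraph_mul (lact a f) g = lact a (kgraph_mul f g).
  move=> _ _ _; apply/funext => p; have := level_rng_head p.
  by rewrite /kgraph_mul /= /level_rng => ->; rewrite mulrA.
have mul_ract f g a : vcar (X m) f -> vcar (X n) g -> vcar A a ->
    kgraph_mul f (ract g a) = ract (kgraph_mul f g) a.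
  move=> _ _ _; apply/funext => p; have := level_src_tail p.
  by rewrite /kgraph_mul /= /level_src => ->; rewrite mulrA.
have mul_ip f g f' g' : vcar (X m) f -> vcar (X n) g -> vcar (X m) f' -> vcar (X n) g' ->
    ip (kgraph_mul f g) (kgraph_mul f' g') = ip g (lact (ip f f') g').
  exact: path_mul_ip.
have dense := @kgraph_mul_dense R k L m n.
split; first exact: tensor_map_iso.
by move=> f g fX gX; apply: tensor_map_elementary.
Qed.

End product_system.

Theorem proposition5p9 (R : realType) (k : nat) (L : topological_kgraph k) :
  @is_product_system R (C0_algebra R (level L 0))
    {ffun 'I_k -> nat} 0 +%R
    (kgraph_bimodule R L) (@kgraph_mul R k L)
    (fun a : C0_algebra R (level L 0) => a).
Proof.
split.
- exact: C0_algebra_cstar.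
- exact: kgraph_bimodule_hilbert.
- by move=> m n f g; exact: path_mul_in.
- by move=> m n l f g h _ _ _; exact: kgraph_mulA.
- exact: vertex_bimodule_iso.
- by move=> m n _ _; exact: kgraph_tensor_iso.
- by move=> n a f _ _; exact: kgraph_mul_vertex_l.
- by move=> n f a _ _; exact: kgraph_mul_vertex_r.
Qed.
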